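(* Let $d\ge 1$, let $\Lambda\subset\mathbb{R}^d$ be a lattice with dual lattice $\Lambda^*$ and co-volume $|\Lambda|$. Let $\kappa_N:\Lambda^*\to\{0,1\}$ be a finitely supported function and put $t_N=\sum_{w\in\Lambda^*}\kappa_N(w)$. Let $\omega=(x_1,\dots,x_{t_N})$ be drawn from the determinantal process on the flat torus $\mathbb{R}^d/\Lambda$ given by the kernel $$K_N(u,v)=\sum_{w\in\Lambda^*}\kappa_N(w)\,e^{2\pi i\langle u-v,w\rangle}.$$ Then, for every $0<s<d$, $$\mathbb{E}\big(E_{s,\Lambda}(\omega)\big)=\frac{2\pi^{d/2}}{\Gamma\left(\frac{s}{2}\right)(d-s)\,|\Lambda|}\,(t_N^2-t_N)-\frac{\pi^{s-\frac d2}\,\Gamma\left(\frac{d-s}{2}\right)}{\Gamma\left(\frac s2\right)|\Lambda|}\sum_{\substack{w,w'\in\Lambda^*\\ w\ne w'}}\frac{\kappa_N(w)\kappa_N(w')}{|w-w'|^{d-s}},$$ where $E_{s,\Lambda}$ is the periodic Riesz $s$-energy.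
   Context: A lattice is $\Lambda=A\mathbb{Z}^d$ with $A$ a nonsingular real $d\times d$ matrix; its co-volume is $|\Lambda|=|\det A|$ and its dual lattice is $\Lambda^*=\{x\in\mathbb{R}^d:\langle x,\lambda\rangle\in\mathbb{Z}\ \ \forall\lambda\in\Lambda\}=(A^t)^{-1}\mathbb{Z}^d$. With $v_1,\dots,v_d$ the columns of $A$, the fundamental domain $\Omega=\{t_1v_1+\dots+t_dv_d:t_i\in[0,1)\}$ is identified with the flat torus $\mathbb{R}^d/\Lambda$, and $\mu$ is Lebesgue measure on $\Omega$ normalized so that $\mu(\Omega)=1$. For $0<s<d$ and $x\in\mathbb{R}^d\setminus\Lambda$ define $$F_{s,\Lambda}(x)=\sum_{v\in\Lambda}\int_1^{+\infty}e^{-|x+v|^2t}\frac{t^{\frac s2-1}}{\Gamma(\frac s2)}\,dt+\frac1{|\Lambda|}\sum_{w\in\Lambda^*\setminus\{0\}}e^{2\pi i\langle x,w\rangle}\int_0^1\frac{\pi^{d/2}}{t^{d/2}}e^{-\frac{\pi^2|w|^2}{t}}\frac{t^{\frac s2-1}}{\Gamma(\frac s2)}\,dt$$ (the formula gives $+\infty$ for $x\in\Lambda$). The periodic Riesz $s$-energy of $\omega=(x_1,\dots,x_n)$ is $E_{s,\Lambda}(\omega)=\sum_{k\ne j}F_{s,\Lambda}(x_k-x_j)$, the sum being over ordered pairs $k\neq j$. A determinantal process with kernel $K$ (with respect to $\mu$) is a simple point process whose joint intensities with respect to $\mu$ are $\rho_k(x_1,\dots,x_k)=\det(K(x_i,x_j))_{1\le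 i,j\le k}$ for all $k\geq 1$. The kernel $K_N$ is the kernel of an orthogonal projection in $L^2(\mu)$ of rank $t_N$, so the process has exactly $t_N$ points almost surely; as a random vector in $\Omega^{t_N}$, $\omega$ has density $\frac1{t_N!}\det(K_N(x_i,x_j))_{1\le i,j\le t_N}$ with respect to $\mu^{\otimes t_N}$. *)

(* Defs.v *)
From HB Require Import structures.
From mathcomp Require Import all_boot all_order all_algebra.
From mathcomp Require Import complex.
From mathcomp Require Import all_classical all_reals all_analysis.

Set Implicit Arguments.
Unset Strict Implicit.
Unset Printing Implicit Defensive.

Import Order.TTheory GRing.Theory Num.Theory.
Import numFieldNormedType.Exports.

Local Open Scope classical_set_scope.
Local Open Scope ring_scope.

(* n-fold product measures: mu^n on n.-tuple T is the image of mu \x mu^(n-1)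
   under (x, t) |-> x :: t.  The next definitions only equip that image with
   the sigma-finiteness needed to iterate the construction. *)

Definition consT (T : Type) (n : nat) (x : T * n.-tuple T) : n.+1.-tuple T :=
  [tuple of x.1 :: x.2].

Section product_step.
Context {d} {T : measurableType d} {R : realType} {n : nat}.
Variables (mu : {sigma_finite_measure set T -> \bar R})
  (nu : {sigma_finite_measure set (n.-tuple T) -> \bar R}).

Lemma measurable_consT : measurable_fun [set: T * n.-tuple T] (@consT T n).
Proof. by exact: measurable_cons. Qed.

Definition product_step : set (n.+1.-tuple T) -> \bar R :=
  pushforward (mu \x nu)%E (@consT T n).

Let step0 : product_step set0 = 0%E.
Proof. by have mf := measurable_consT; exact: measure0. Qed.

Let step_ge0 A : (0 <= product_step A)%E.
Proof. by have mf := measurable_consT; exact: measure_ge0. Qed.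

Let step_sigma_additive : semi_sigma_additive product_step.
Proof. by have mf := measurable_consT; exact: measure_semi_sigma_additive. Qed.

HB.instance Definition _ := isMeasure.Build _ _ _ product_step
  step0 step_ge0 step_sigma_additive.

Let step_sigma_finite : sigma_finite setT product_step.
Proof.
have [F FT mF] := sigma_finiteT mu; have [G GT mG] := sigma_finiteT nu.
pose H (A : set T) (B : set (n.-tuple T)) : set (n.+1.-tuple T) :=
  (@thead n T) @^-1` A `&` (fun x : n.+1.-tuple T => [tuple of behead x] : n.-tuple T) @^-1` B.
have mH A B : measurable A -> measurable B -> measurable (H A B).
  move=> mA mB; apply: measurableI.
  - rewrite -[_ @^-1` _]setTI.
    exact: (measurable_tnth ord0).
  - rewrite -[_ @^-1` _]setTI.
    exact: (@measurable_behead _ T n).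
pose H' (k : nat) := let ij := odflt (0%N, 0%N) (unpickle k : option (nat * nat)) in
  H (F ij.1) (G ij.2).
exists H'.
- apply/esym; rewrite -subTset => x _.
  have : [set: T] (thead x) by [].
  rewrite FT => -[i _ Fi].
  have : [set: n.-tuple T] [tuple of behead x] by [].
  rewrite GT => -[j _ Gj].
  by exists (pickle (i, j)) => //; rewrite /H' pickleK.
- move=> k; rewrite /H'; move: (odflt _ _) => -[i j] /=.
  have [mFi Fioo] := mF i; have [mGj Gjoo] := mG j.
  split; first exact: mH.
  rewrite /product_step /pushforward.
  rewrite (_ : _ @^-1` _ = F i `*` G j); last first.
    have hE (x : T) (t : n.-tuple T) : thead (consT (x, t)) = x by [].
    have bE (x : T) (t : n.-tuple T) : [tuple of behead (consT (x, t))] = t.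
      exact/val_inj.
    by apply/seteqP; split => -[x t]; rewrite /H /= hE bE.
  by rewrite product_measure1E// lte_mul_pinfty// ge0_fin_numE.
Qed.

HB.instance Definition _ := Measure_isSigmaFinite.Build _ _ _ product_step
  step_sigma_finite.

End product_step.

Fixpoint product_power d (T : measurableType d) (R : realType)
    (mu : {sigma_finite_measure set T -> \bar R}) (n : nat) :
    {sigma_finite_measure set (n.-tuple T) -> \bar R} :=
  match n with
  | 0 => @dirac _ (0.-tuple T) [tuple] R
  | m.+1 => product_step mu (product_power mu m)
  end.

(* R^d is 'cV[R]_d, with the (Borel) sigma-algebra transported from
   d.-tuple R along the coordinates. *)

Definition tuple_of_col (R : Type) (d : nat) (x : 'cV[R]_d) : d.-tuple R :=
  [tuple x i 0 | i < d].

Definition col_of_tuple (R : Type) (d : nat) (t : d.-tuple R) : 'cV[R]_d :=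
  \col_i tnth t i.

Definition measure_col_display : measure_display. Proof. by []. Qed.

Section measurable_col.
Context {R : realType} {d : nat}.

Definition measurable_col : set (set 'cV[R]_d) :=
  preimage_set_system setT (@tuple_of_col R d) measurable.

Let col_sigma_algebra : sigma_algebra setT measurable_col.
Proof. apply: sigma_algebra_preimage; exact: sigma_algebra_measurable. Qed.

Let col0 : measurable_col set0.
Proof. by case: col_sigma_algebra. Qed.

Let colC A : measurable_col A -> measurable_col (~` A).
Proof. by case: col_sigma_algebra => _ h _ /h; rewrite setTD. Qed.

Let col_bigcup (F : _^nat) : (forall i, measurable_col (F i)) ->
  measurable_col (\bigcup_i (F i)).
Proof. by case: col_sigma_algebra => _ _; apply. Qed.

HB.instance Definition _ := @isMeasurable.Build measure_col_display
  'cV[R]_d measurable_col col0 colC col_bigcup.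

Lemma measurable_tuple_of_col : measurable_fun setT (@tuple_of_col R d).
Proof. by move=> _ Y mY; exists Y. Qed.

Lemma measurable_col_of_tuple : measurable_fun setT (@col_of_tuple R d).
Proof.
move=> _ _ [Y mY <-]; rewrite !setTI -comp_preimage.
rewrite (_ : _ \o _ = id) ?preimage_id//.
by apply/funext => t /=; apply/eq_from_tnth => i; rewrite tnth_mktuple mxE.
Qed.

Lemma measurable_coord (i : 'I_d) :
  measurable_fun setT (fun x : 'cV[R]_d => x i 0).
Proof.
rewrite (_ : (fun _ => _) = (fun t => tnth t i) \o @tuple_of_col R d).
  by apply: measurableT_comp; [exact: measurable_tnth|
    exact: measurable_tuple_of_col].
by apply/funext => x /=; rewrite tnth_mktuple.
Qed.

End measurable_col.

Section lebesgue_col.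
Context (R : realType) (d : nat).

Definition lebesgue_col : set 'cV[R]_d -> \bar R :=
  pushforward (product_power (@lebesgue_measure R) d) (@col_of_tuple R d).

Let mcol := @measurable_col_of_tuple R d.

Let col_measure0 : lebesgue_col set0 = 0%E.
Proof. by have mf := mcol; exact: measure0. Qed.

Let col_measure_ge0 A : (0 <= lebesgue_col A)%E.
Proof. by have mf := mcol; exact: measure_ge0. Qed.

Let col_semi_sigma_additive : semi_sigma_additive lebesgue_col.
Proof. by have mf := mcol; exact: measure_semi_sigma_additive. Qed.

HB.instance Definition _ := isMeasure.Build _ _ _ lebesgue_col
  col_measure0 col_measure_ge0 col_semi_sigma_additive.

End lebesgue_col.

Section lattices.
Context {R : realType} {d : nat}.
Implicit Types (A : 'M[R]_d) (x y : 'cV[R]_d).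

Definition dotcv x y : R := \sum_i x i 0 * y i 0.

(* The Euclidean norm; the library's `|x| on matrices is the sup norm. *)
Definition norm2 x : R := Num.sqrt (dotcv x x).

Definition lattice A : set 'cV[R]_d :=
  [set A *m map_mx intr z | z in [set: 'cV[int]_d]].

Definition covolume A : R := `|\det A|.

Definition dual_lattice A : set 'cV[R]_d :=
  [set x | forall l, lattice A l -> dotcv x l \is a Num.int].

Definition fundamental_domain A : set 'cV[R]_d :=
  [set A *m t | t in [set t : 'cV[R]_d | forall i, 0 <= t i 0 < 1]].

Lemma measurable_fundamental_domain A :
  A \in unitmx -> measurable (fundamental_domain A).
Proof.
move=> uA; pose c i x := (invmx A *m x) i 0.
have -> : fundamental_domain A = \bigcap_(i : 'I_d) (c i @^-1` `[0, 1[).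
  apply/seteqP; split=> [_ [t t01 <-] i _|x cx].
    by rewrite /c /= mulKmx// in_itv/=; exact: t01.
  exists (invmx A *m x); last by rewrite mulKVmx.
  by move=> i; have := cx i I; rewrite /c /= in_itv.
apply: fin_bigcap_measurable => // i _; rewrite -[_ @^-1` _]setTI.
suff mc : measurable_fun setT (c i) by apply: mc => //; exact: measurable_itv.
rewrite (_ : c i = fun x => \sum_j invmx A i j * x j 0); last first.
  by apply/funext => x; rewrite /c mxE.
apply: measurable_sum => j; apply: measurable_realfun.measurable_funM => //.
exact: measurable_coord.
Qed.

End lattices.

(* Normalized Lebesgue measure on the fundamental domain, seen as a measure on
   R^d.  The Dirac mass is only a default value required by mnormalize, for
   measures of total mass 0 or +oo. *)
Definition torus_measure (R : realType) (d : nat) (A : 'M[R]_d)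
    (uA : A \in unitmx) : probability 'cV[R]_d R :=
  mnormalize (mrestr (@lebesgue_col R d) (measurable_fundamental_domain uA))
    (dirac (0 : 'cV[R]_d)).

Section sums.
Context {R : realType} {I : choiceType}.

(* Sum over a set of an absolutely summable family. *)
Definition sum_set (D : set I) (f : I -> R) : R :=
  fine (\esum_(i in D) (f^\+ i)%:E) - fine (\esum_(i in D) (f^\- i)%:E).

Definition csum_set (D : set I) (f : I -> R[i]) : R[i] :=
  (sum_set D (fun i => complex.Re (f i)) +i*
   sum_set D (fun i => complex.Im (f i)))%C.

End sums.

(* exp(2 pi i t) *)
Definition cexp2pi {R : realType} (t : R) : R[i] :=
  (cos (2 * pi * t) +i* sin (2 * pi * t))%C.

(* Euler's integral; it diverges, and the value is meaningless, for a <= 0. *)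
Definition Gamma {R : realType} (a : R) : R :=
  \int[lebesgue_measure]_(t in `]0, +oo[) (t `^ (a - 1) * expR (- t)).

Section riesz.
Context {R : realType} {d : nat}.
Variables (A : 'M[R]_d) (s : R).

Definition riesz_direct (x : 'cV[R]_d) : \bar R :=
  (\esum_(v in lattice A)
     \int[lebesgue_measure]_(t in `[(1%R : R), +oo[)
       (expR (- norm2 (x + v) ^+ 2 * t) *
        (t `^ (s / 2 - 1) / Gamma (s / 2)))%:E)%E.

Definition riesz_dual (x : 'cV[R]_d) : R[i] :=
  csum_set (dual_lattice A `\ 0) (fun w => cexp2pi (dotcv x w) *
    (\int[lebesgue_measure]_(t in `]0, 1])
       (pi `^ (d%:R / 2) / t `^ (d%:R / 2) *
        expR (- (pi ^+ 2 * norm2 w ^+ 2) / t) *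
        (t `^ (s / 2 - 1) / Gamma (s / 2))))%:C%C).

(* The dual sum is real, since w and - w contribute conjugate terms; taking its
   real part only serves to get a value in \bar R.  On the lattice the direct
   sum is +oo. *)
Definition riesz_potential (x : 'cV[R]_d) : \bar R :=
  (riesz_direct x + ((covolume A)^-1 * complex.Re (riesz_dual x))%:E)%E.

Definition riesz_energy (n : nat) (x : n.-tuple 'cV[R]_d) : \bar R :=
  (\sum_(p : 'I_n * 'I_n | p.1 != p.2)
     riesz_potential (tnth x p.1 - tnth x p.2))%E.

End riesz.

Section determinantal.
Context {dO dS : measure_display} {O : measurableType dO}
  {S : measurableType dS} {R : realType}.
Variables (P : probability O R) (mu : {sigma_finite_measure set S -> \bar R}).

(* A point process with n points is given by an enumeration X of its points. *)
Definition point_count (n : nat) (x : n.-tuple S) (D : set S) : nat :=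
  \sum_(i < n) `[< D (tnth x i) >].

Definition simple_process (n : nat) (X : {RV P >-> n.-tuple S}) : Prop :=
  {ae P, forall o, uniq (X o)}.

Definition joint_intensity (n : nat) (X : {RV P >-> n.-tuple S}) (k : nat)
    (rho : k.-tuple S -> R) : Prop :=
  forall D : 'I_k -> set S,
    (forall i, measurable (D i)) -> trivIset setT D ->
    ('E_P[fun o => (\prod_(i < k) point_count (X o) (D i))%:R] =
     \int[product_power mu k]_(x in [set x | forall i, D i (tnth x i)])
       (rho x)%:E)%E.

Definition determinantal (K : S -> S -> R[i]) (n : nat)
    (X : {RV P >-> n.-tuple S}) : Prop :=
  simple_process X /\
  forall k, (0 < k)%N ->
    exists2 rho : k.-tuple S -> R,
      (forall x, ((rho x)%:C)%C = \det (\matrix_(i, j) K (tnth x i) (tnth x j)))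
      & joint_intensity X rho.

End determinantal.

Section kernel.
Context {R : realType} {d : nat}.
(* Only the values of kappa on the dual lattice matter. *)
Variables (A : 'M[R]_d) (kappa : 'cV[R]_d -> bool).

Definition kernel_rank : nat := \sum_(w \in dual_lattice A) (kappa w : nat).

Definition lattice_kernel (u v : 'cV[R]_d) : R[i] :=
  \sum_(w \in dual_lattice A) (kappa w)%:R * cexp2pi (dotcv (u - v) w).

End kernel.

(* Main.v *)
(** The two-point intensity of the process is
      rho_2(x, y) = K(x, x)^2 - |K(x, y)|^2
                  = sum_(w, w') (1 - cos (2 pi <x - y, w - w'>)),
    summed over the pairs of frequencies of the kernel; it is nonnegative and
    vanishes on the diagonal.  The joint intensities only give the expected
    number of pairs in products of disjoint sets, but a finite measure not
    charging the diagonal is determined by these.  So the expected energy is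
    the sum over w <> w' of the torus averages of
    F(x - y) (1 - cos (2 pi <x - y, q>)) with q = w - w'.

    With k_a(t) = t^((s-d)/2 - 1) e^(-a/t), b = (d-s)/2 and
    a_w = pi^2 |w|^2, unfolding the direct sum of F to an integral over R^d
    and using the Fourier transform of Gaussians, its average is a constant
    c = pi^(d/2) / (Gamma(s/2) |Lambda|) times the integral of k_0 - k_(a_q)
    over [1, +oo[.  By orthogonality of the characters only w = q and w = - q
    survive in the dual sum, which contributes - c times the integral of
    k_(a_q) over ]0, 1].  Altogether one gets
    c (1/b - int_0^oo k_(a_q)) = c (1/b - a_q^(-b) Gamma(b)).

    The dual sum is made nonnegative by adding to it its (finite) value at 0,
    and characters appear as 1 + cos (t + _), so that every exchange of sums
    and integrals is an instance of Tonelli's theorem. *)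

Require Import Defs.
From HB Require Import structures.
From mathcomp Require Import all_boot all_order all_algebra.
From mathcomp Require Import complex.
From mathcomp Require Import all_classical all_reals all_analysis.
From mathcomp Require Import measurable_realfun ring lra.

Set Implicit Arguments.
Unset Strict Implicit.
Unset Printing Implicit Defensive.

Import Order.TTheory GRing.Theory Num.Theory.
Import numFieldNormedType.Exports.

Local Open Scope classical_set_scope.
Local Open Scope ring_scope.

(** Nonnegativity shapes every statement. A bare cosine times a lattice sum would need absolute
    integrability at each exchange; [1 + cos (t + _)] with a free phase [t] does not, and the family
    is stable under integrating out one coordinate, which only shrinks the coefficient of the
    cosine. Phase [pi] yields the factor [1 - cos] of the two-point intensity; phase [pi / 2] at
    frequency zero removes the cosine. The singularity of the potential then needs no estimate.

    The shift of the dual sum costs a constant per ordered pair of points. As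
    [1 - cos (2 pi <., q>)] has average 1 on the torus for [q] nonzero, the averages contain the
    same constant once per ordered pair of frequencies. There are as many frequencies as points, so
    the shift disappears.

    Averages run over both points of [x - y], so that translation invariance on R^d replaces any
    discussion of the periodicity of the potential. The cut at [t = 1] matters: [k_0] is integrable
    at infinity but not at 0, so [1/b] can only come from the direct sum, in agreement with the
    omission of the frequency 0 from the dual sum. *)

Local Notation lebcol := (@lebesgue_col _ _).

(** * Lebesgue measure on column vectors *)

Section affine1.
Context {R : realType}.
Local Notation leb := (@lebesgue_measure R).
Local Open Scope ereal_scope.

Lemma measurable_affine (a b : R) : measurable_fun [set: measurableTypeR R]
  (fun x : measurableTypeR R => (a * x + b)%R : measurableTypeR R).
Proof.
by apply: measurable_funD => //; exact: measurable_funM.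
Qed.

(** By uniqueness of Lebesgue measure it is enough to compare both sides on intervals []u, v]]. For
    [a < 0] the preimage is closed at the other end, which leaves its length unchanged. *)
Lemma lebesgue_measure_affine (a b : R) (E : set R) : (a != 0)%R -> measurable E ->
  lebesgue_measure E =
  `|a|%:E * lebesgue_measure ((fun x : R => a * x + b)%R @^-1` E).
Proof.
move=> a0 mE; pose k : {nonneg R} := NngNum (normr_ge0 a).
pose phi : measurableTypeR R -> measurableTypeR R := fun x => (a * x + b)%R.
have mphi : measurable_fun [set: measurableTypeR R] phi by exact: measurable_affine.
pose phim : {mfun measurableTypeR R >-> measurableTypeR R} :=
  HB.pack phi (isMeasurableFun.Build _ _ _ _ _ mphi).
rewrite (@lebesgue_measure_unique R (mscale k (pushforward leb phim)) _ E mE)//.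
move=> _ [[u v] _ <-].
change (lebesgue_measure [set` `]u, v]%R] =
  `|a|%:E * lebesgue_measure (phi @^-1` [set` `]u, v]%R])).
have [a_gt0|a_lt0|aE] := ltgtP 0%R a; last by rewrite -aE eqxx in a0.
- have -> : phi @^-1` [set` `]u, v]%R] = [set` `](u - b) / a, (v - b) / a]%R].
    apply/seteqP; split => x /=; rewrite !in_itv/= /phi.
      by rewrite ltr_pdivrMr// ler_pdivlMr// ltrBlDr lerBrDr mulrC.
    by rewrite ltr_pdivrMr// ler_pdivlMr// ltrBlDr lerBrDr mulrC.
  rewrite !lebesgue_measure_itv /= !lte_fin ltr_pM2r ?invr_gt0// ltrD2r.
  case: ifPn => _; last by rewrite mule0.
  by rewrite -!EFinB -EFinM gtr0_norm//; congr EFin; field.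
- have -> : phi @^-1` [set` `]u, v]%R] = [set` `[(v - b) / a, (u - b) / a[%R].
    apply/seteqP; split => x /=; rewrite !in_itv/= /phi.
      by rewrite ltr_ndivlMr// ler_ndivrMr// ltrBlDr lerBrDr mulrC andbC.
    by rewrite ltr_ndivlMr// ler_ndivrMr// ltrBlDr lerBrDr mulrC andbC.
  rewrite !lebesgue_measure_itv /= !lte_fin ltr_nM2r ?invr_lt0// ltrD2r.
  case: ifPn => _; last by rewrite mule0.
  by rewrite -!EFinB -EFinM ltr0_norm//; congr EFin; field.
Qed.

Lemma ge0_integral_affine (a b : R) (f : R -> \bar R) : (a != 0)%R ->
  measurable_fun [set: measurableTypeR R] f -> (forall x, 0 <= f x) ->
  \int[leb]_x f x = `|a|%:E * \int[leb]_x f (a * x + b)%R.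
Proof.
move=> a0 mf f0; pose k : {nonneg R} := NngNum (normr_ge0 a).
pose phi : measurableTypeR R -> measurableTypeR R := fun x => (a * x + b)%R.
have mphi : measurable_fun [set: measurableTypeR R] phi by exact: measurable_affine.
pose phim : {mfun measurableTypeR R >-> measurableTypeR R} :=
  HB.pack phi (isMeasurableFun.Build _ _ _ _ _ mphi).
rewrite (eq_measure_integral (mscale k (pushforward leb phim))); last first.
  by move=> E mE _; exact: lebesgue_measure_affine.
rewrite ge0_integral_mscale//=; congr (_ * _).
by rewrite (@ge0_integral_pushforward _ _ _ _ _ phi)//.
Qed.

End affine1.

Section columns.
Context {R : realType}.
Local Notation leb := (@lebesgue_measure R).

Lemma measurable_fun_col d (T : measurableType d) n (f : T -> 'cV[R]_n) :
  (forall i, measurable_fun setT (fun x => f x i 0)) -> measurable_fun setT f.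
Proof.
move=> mf; rewrite (_ : f = @col_of_tuple R n \o (fun x => tuple_of_col (f x))).
  apply: measurableT_comp; first exact: measurable_col_of_tuple.
  apply/measurable_fun_tnthP => i.
  by rewrite (_ : _ \o _ = fun x => f x i 0)//; apply/funext => x /=; rewrite tnth_mktuple.
by apply/funext => x /=; apply/colP => i; rewrite mxE tnth_mktuple.
Qed.

Definition col_cons n (x : R) (y : 'cV[R]_n) : 'cV[R]_n.+1 :=
  \col_i (if unlift ord0 i is Some j then y j 0 else x).

Lemma col_cons0 n x (y : 'cV[R]_n) : col_cons x y ord0 0 = x.
Proof. by rewrite mxE unlift_none. Qed.

Lemma col_consS n x (y : 'cV[R]_n) i : col_cons x y (lift ord0 i) 0 = y i 0.
Proof. by rewrite mxE liftK. Qed.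

Lemma measurable_col_cons d (T : measurableType d) n (f : T -> R) (g : T -> 'cV[R]_n) :
  measurable_fun setT f -> measurable_fun setT g ->
  measurable_fun setT (fun x => col_cons (f x) (g x)).
Proof.
move=> mf mg; apply: measurable_fun_col => i.
case: (unliftP ord0 i) => [j ->|->].
  rewrite (_ : (fun x => _) = (fun y : 'cV[R]_n => y j 0) \o g).
    by apply: measurableT_comp => //; exact: measurable_coord.
  by apply/funext => x /=; rewrite col_consS.
by rewrite (_ : (fun x => _) = f)//; apply/funext => x /=; rewrite col_cons0.
Qed.

Lemma col_of_tuple_cons n (x : R) (t : n.-tuple R) :
  col_of_tuple (consT (x, t)) = col_cons x (col_of_tuple t).
Proof.
apply/colP => i; rewrite mxE; case: (unliftP ord0 i) => [j ->|->].
  by rewrite col_consS mxE tnthS.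
by rewrite col_cons0.
Qed.

Let lebesgue_col_sigma_finite n : sigma_finite setT (@lebesgue_col R n).
Proof.
have [F FT mF] := sigma_finiteT (product_power leb n).
exists (fun k => @tuple_of_col R n @^-1` F k).
  by rewrite -preimage_bigcup -FT preimage_setT.
move=> k; have [mFk Fk] := mF k; split.
  by rewrite -[_ @^-1` _]setTI; exact: measurable_tuple_of_col.
rewrite /lebesgue_col /pushforward (_ : _ @^-1` _ = F k)//.
rewrite -comp_preimage (_ : _ \o _ = id)// .
by apply/funext => t /=; apply/eq_from_tnth => i; rewrite tnth_mktuple mxE.
Qed.

HB.instance Definition _ n := Measure_isSigmaFinite.Build _ _ _ (@lebesgue_col R n)
  (lebesgue_col_sigma_finite n).

Local Open Scope ereal_scope.

Lemma ge0_integral_col_of_tuple n (f : 'cV[R]_n -> \bar R) :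
  measurable_fun setT f -> (forall x, 0 <= f x) ->
  \int[lebcol]_x f x = \int[product_power leb n]_t f (col_of_tuple t).
Proof.
move=> mf f0; rewrite /lebesgue_col ge0_integral_pushforward//.
exact: measurable_col_of_tuple.
Qed.

Lemma ge0_integral_col0 (f : 'cV[R]_0 -> \bar R) :
  measurable_fun setT f -> (forall x, 0 <= f x) ->
  \int[lebcol]_x f x = f (0 : 'cV[R]_0)%R.
Proof.
move=> mf f0; rewrite ge0_integral_col_of_tuple//=.
rewrite integral_dirac//; last first.
  by apply: measurableT_comp => //; exact: measurable_col_of_tuple.
by rewrite diracT mul1e; congr f; apply/colP; case.
Qed.

Lemma ge0_integral_colS n (f : 'cV[R]_n.+1 -> \bar R) :
  measurable_fun setT f -> (forall x, 0 <= f x) ->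
  \int[lebcol]_x f x = \int[leb]_x \int[lebcol]_y f (col_cons x y).
Proof.
move=> mf f0; rewrite ge0_integral_col_of_tuple//= /product_step.
have mfc : measurable_fun setT (f \o @col_of_tuple R n.+1).
  by apply: measurableT_comp => //; exact: measurable_col_of_tuple.
rewrite (ge0_integral_pushforward (@measurable_consT _ _ _))//=.
rewrite fubini_tonelli1//=; last first.
  apply: (measurableT_comp mfc (@measurable_consT _ (measurableTypeR R) n)).
apply: eq_integral => x _; rewrite /fubini_F /= ge0_integral_col_of_tuple//.
  by apply: eq_integral => t _ /=; rewrite col_of_tuple_cons.
by apply: measurableT_comp => //; exact: measurable_col_cons.
Qed.

Lemma measurable_col_cons2 n (f : 'cV[R]_n.+1 -> \bar R) :
  measurable_fun setT f ->
  measurable_fun setT (fun p : measurableTypeR R * 'cV[R]_n => f (col_cons p.1 p.2)).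
Proof. by move=> mf; apply: measurableT_comp => //; exact: measurable_col_cons. Qed.

(** With the first coordinate innermost, a shear that moves this coordinate becomes a translation of
    the line. *)
Lemma ge0_integral_colS' n (f : 'cV[R]_n.+1 -> \bar R) :
  measurable_fun setT f -> (forall x, 0 <= f x) ->
  \int[lebcol]_x f x = \int[lebcol]_y \int[leb]_x f (col_cons x y).
Proof.
move=> mf f0; rewrite ge0_integral_colS//.
by rewrite (fubini_tonelli _ (measurable_col_cons2 mf)).
Qed.

Lemma measurable_fun_colD n (a : 'cV[R]_n) :
  measurable_fun setT (fun x : 'cV[R]_n => (x + a)%R).
Proof.
apply: measurable_fun_col => i.
rewrite (_ : (fun x => _) = fun x : 'cV[R]_n => (x i 0 + a i 0)%R); last first.
  by apply/funext => x; rewrite mxE.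
by apply: measurable_funD => //; exact: measurable_coord.
Qed.

Lemma measurable_fun_colM m n (A : 'M[R]_(m, n)) :
  measurable_fun setT (fun x : 'cV[R]_n => (A *m x)%R).
Proof.
apply: measurable_fun_col => i.
rewrite (_ : (fun x => _) = fun x : 'cV[R]_n => (\sum_j A i j * x j 0)%R); last first.
  by apply/funext => x; rewrite mxE.
apply: measurable_sum => j; apply: measurable_funM => //; exact: measurable_coord.
Qed.

Lemma ge0_integral_translation n (a : 'cV[R]_n) (f : 'cV[R]_n -> \bar R) :
  measurable_fun setT f -> (forall x, 0 <= f x) ->
  \int[lebcol]_x f (x + a)%R = \int[lebcol]_x f x.
Proof.
elim: n a f => [|n IH] a f mf f0.
  have mfa : measurable_fun setT (fun x : 'cV[R]_0 => f (x + a)%R).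
    by apply: measurableT_comp => //; exact: measurable_fun_colD.
  by rewrite (ge0_integral_col0 mfa)// (ge0_integral_col0 mf)//; congr f; apply/colP; case.
have mfa : measurable_fun setT (fun x : 'cV[R]_n.+1 => f (x + a)%R).
  by apply: measurableT_comp => //; exact: measurable_fun_colD.
rewrite (ge0_integral_colS mfa (fun x => f0 _)).
rewrite (ge0_integral_colS mf f0).
pose b : 'cV[R]_n := (\col_i a (lift ord0 i) 0)%R.
pose c := (a ord0 0)%R.
transitivity (\int[leb]_x \int[lebcol]_y f (col_cons (x + c)%R y)).
  apply: eq_integral => x _.
  transitivity (\int[lebcol]_y f (col_cons (x + c)%R (y + b)%R)).
    apply: eq_integral => y _; congr f; apply/colP => i.
    case: (unliftP ord0 i) => [j ->|->]; first by rewrite mxE !col_consS !mxE.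
    by rewrite mxE !col_cons0.
  rewrite (IH b (fun y => f (col_cons (x + c)%R y)))//.
  by apply: measurableT_comp => //; exact: measurable_col_cons.
have mg := measurable_fun_fubini_tonelli_F (m2 := @lebesgue_col R n) _
  (measurable_col_cons2 mf) (fun _ => f0 _).
rewrite [RHS](ge0_integral_affine c (oner_neq0 R))//; last first.
  by move=> x; exact: integral_ge0.
by rewrite normr1 mul1e; apply: eq_integral => x _; rewrite mul1r.
Qed.
End columns.

(** * Linear change of variables *)

Section linear_change.
Context {R : realType}.
Local Notation leb := (@lebesgue_measure R).

Lemma col_consE n (x : R) (y : 'cV[R]_n) :
  col_cons x y = col_mx x%:M y :> 'cV_(1 + n).
Proof.
apply/colP => i; case: (unliftP ord0 i) => [j ->|->].
  rewrite col_consS (_ : lift ord0 j = rshift 1 j); last exact/val_inj.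
  by rewrite (@col_mxEd _ 1 n).
rewrite col_cons0 (_ : (ord0 : 'I_n.+1) = lshift n (ord0 : 'I_1)); last exact/val_inj.
by rewrite (@col_mxEu _ 1 n) mxE eqxx.
Qed.

(** A property of a single matrix, so that it can be proved for elementary factors and then
    multiplied. With the determinant on the left no inverse occurs. *)
Definition has_linear_change n (A : 'M[R]_n) := forall f : 'cV[R]_n -> \bar R,
  measurable_fun setT f -> (forall x, 0 <= f x)%E ->
  (`|\det A|%:E * \int[lebcol]_x f (A *m x) = \int[lebcol]_x f x)%E.

Lemma has_linear_changeM n (A B : 'M[R]_n) :
  has_linear_change A -> has_linear_change B -> has_linear_change (A *m B).
Proof.
move=> hA hB f mf f0; rewrite det_mulmx normrM EFinM -muleA.
under eq_integral do rewrite -mulmxA.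
rewrite (hB (fun x => f (A *m x)))//; first exact: hA.
by apply: measurableT_comp => //; exact: measurable_fun_colM.
Qed.

(** For a fixed first coordinate [x], the shear translates the other coordinates by [x *: c]. *)
Lemma has_linear_change_lower n (c : 'cV[R]_n) :
  has_linear_change (block_mx 1%:M 0 c 1%:M : 'M[R]_(1 + n)).
Proof.
move=> f mf f0; rewrite det_lblock !det1 mulr1 normr1 mul1e.
have mfA : measurable_fun setT (fun x : 'cV[R]_(1 + n) => f (block_mx 1%:M 0 c 1%:M *m x)).
  by apply: measurableT_comp => //; exact: measurable_fun_colM.
rewrite [RHS](ge0_integral_colS mf f0) (ge0_integral_colS mfA (fun x => f0 _)).
apply: eq_integral => x _.
rewrite -[RHS](ge0_integral_translation (x *: c))//; last first.
  by apply: measurableT_comp => //; exact: measurable_col_cons.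
apply: eq_integral => y _; rewrite !col_consE mul_block_col.
by rewrite !mul1mx mul0mx addr0 mul_mx_scalar addrC.
Qed.

(** For fixed [y] the first coordinate is translated by [b *m y], hence the other order of
    integration. *)
Lemma has_linear_change_upper n (b : 'rV[R]_n) :
  has_linear_change (block_mx 1%:M b 0 1%:M : 'M[R]_(1 + n)).
Proof.
move=> f mf f0; rewrite det_ublock !det1 mulr1 normr1 mul1e.
have mfA : measurable_fun setT (fun x : 'cV[R]_(1 + n) => f (block_mx 1%:M b 0 1%:M *m x)).
  by apply: measurableT_comp => //; exact: measurable_fun_colM.
rewrite [RHS](ge0_integral_colS' mf f0) (ge0_integral_colS' mfA (fun x => f0 _)).
apply: eq_integral => y _.
rewrite [RHS](ge0_integral_affine ((b *m y) 0 0) (oner_neq0 R))//; last first.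
  by apply: measurableT_comp => //; exact: measurable_col_cons.
rewrite normr1 mul1e; apply: eq_integral => x _; rewrite !col_consE mul_block_col.
rewrite !mul1mx mul0mx add0r mul1r; congr (f (col_mx _ _)).
by rewrite [b *m y]mx11_scalar -raddfD/= -mx11_scalar.
Qed.

Lemma has_linear_change_diag n (a : R) (B : 'M[R]_n) : a != 0 ->
  has_linear_change B -> has_linear_change (block_mx a%:M 0 0 B : 'M[R]_(1 + n)).
Proof.
move=> a0 hB f mf f0; rewrite det_lblock det_scalar1 normrM.
have mfA : measurable_fun setT (fun x : 'cV[R]_(1 + n) => f (block_mx a%:M 0 0 B *m x)).
  by apply: measurableT_comp => //; exact: measurable_fun_colM.
rewrite [RHS](ge0_integral_colS mf f0) (ge0_integral_colS mfA (fun x => f0 _)).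
have mI := measurable_fun_fubini_tonelli_F (m2 := @lebesgue_col R n) _
  (measurable_col_cons2 mf) (fun _ => f0 _).
pose F x : \bar R := (\int[lebcol]_y f (col_cons x y))%E.
have F0 x : (0 <= F x)%E by exact: integral_ge0.
transitivity (`|a|%:E * \int[leb]_x F (a * x + 0)%R)%E; last first.
  by rewrite -(ge0_integral_affine 0 a0 mI F0).
rewrite EFinM -muleA; congr (_ * _)%E.
rewrite -ge0_integralZl//; last 2 first.
  - exact: (measurable_fun_fubini_tonelli_F (m2 := @lebesgue_col R n) _
      (measurable_col_cons2 mfA) (fun _ => f0 _)).
  - by move=> x _; exact: integral_ge0.
apply: eq_integral => x _.
rewrite /F addr0 -(hB (fun y => f (col_cons (a * x) y)))//; last first.
  by apply: measurableT_comp => //; exact: measurable_col_cons.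
congr (_ * _)%E; apply: eq_integral => y _; rewrite !col_consE mul_block_col.
by rewrite !mul0mx addr0 add0r -scalar_mxM.
Qed.

(** If the corner vanishes, invertibility forces a nonzero entry below it in the first column.
    Adding that row to the first one is an upper shear, so no permutation matrix is needed. *)
Lemma pivot n (A : 'M[R]_(1 + n)) : A \in unitmx ->
  exists u : 'rV_n, ulsubmx (block_mx 1%:M u 0 1%:M *m A) 0 0 != 0.
Proof.
move=> uA; rewrite -[A]submxK; set a := ulsubmx A; set c := dlsubmx A.
have [a0|a0] := eqVneq (a 0 0) 0; last first.
  by exists 0; rewrite mulmx_block block_mxKul mul1mx mul0mx addr0.
have [c0|/matrix0Pn[i [j cij]]] := eqVneq c 0.
  suff : \det A = 0 by move=> dA; move: uA; rewrite unitmxE dA unitr0.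
  rewrite -[A]submxK -/a -/c c0 (mx11_scalar a) a0.
  rewrite (_ : 0%:M = 0) ?det_ublock; first by rewrite (_ : \det 0 = 0) ?mul0r// det0.
  by apply/matrixP => ? ?; rewrite !mxE mul0rn.
exists (delta_mx 0 i).
rewrite mulmx_block block_mxKul mul1mx mxE a0 add0r -rowE mxE.
by rewrite -(ord1 j).
Qed.

(** Block Gaussian elimination: once a shear has made the corner nonzero, the matrix is a lower
    shear times a block diagonal matrix times an upper shear, and the induction handles the
    remaining block. *)
Lemma linear_change n (A : 'M[R]_n) : A \in unitmx -> has_linear_change A.
Proof.
elim: n A => [A uA f mf f0|n IH].
  rewrite det_mx00 normr1 mul1e; apply: eq_integral => x _.
  by congr f; apply/colP; case.
change (forall A : 'M[R]_(1 + n), A \in unitmx -> has_linear_change A) => A uA.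
have [u] := pivot uA; set A' := _ *m A => a0.
have uU (v : 'rV_n) : (block_mx 1%:M v 0 1%:M : 'M[R]_(1 + n)) \in unitmx.
  by rewrite unitmxE det_ublock !det1 mulr1 unitr1.
have -> : A = block_mx 1%:M (- u) 0 1%:M *m A'.
  rewrite /A' mulmxA mulmx_block !mul1mx !mulmx1 !mul0mx !mulmx0 !addr0 add0r.
  by rewrite subrr -scalar_mx_block mul1mx.
apply: has_linear_changeM; first exact: has_linear_change_upper.
have uA' : A' \in unitmx by rewrite unitmx_mul uU.
move: A' a0 uA' => {u uU} A'.
set a := ulsubmx A' 0 0 => a0 uA'.
pose b := ursubmx A'; pose c := dlsubmx A'; pose d := drsubmx A'.
(* [B] is the Schur complement of the corner [a]; it inherits invertibility from [A']. *)
pose B := d - a^-1 *: (c *m b).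
have A'E : A' = block_mx 1%:M 0 (a^-1 *: c) 1%:M *m
    (block_mx a%:M 0 0 B *m block_mx 1%:M (a^-1 *: b) 0 1%:M).
  rewrite !mulmx_block !mul1mx !mulmx1 !mul0mx !mulmx0 !addr0 !add0r.
  rewrite -{1}[A']submxK -/b -/c -/d (mx11_scalar (ulsubmx A')) -/a.
  congr block_mx.
  - by rewrite mul_scalar_mx scalerA divff// scale1r.
  - by rewrite mul_mx_scalar scalerA divff// scale1r.
  - rewrite /B mul_scalar_mx scalerA divff// scale1r -scalemxAl.
    by rewrite addrC subrK.
rewrite A'E; apply: has_linear_changeM; first exact: has_linear_change_lower.
apply: has_linear_changeM; last exact: has_linear_change_upper.
apply: has_linear_change_diag => //; apply: IH.
move: uA'; rewrite A'E !unitmx_mul => /andP[_ /andP[+ _]].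
by rewrite !unitmxE det_ublock unitrM => /andP[].
Qed.

End linear_change.

(** * Integration against an image measure with density *)

Section density.
Context d1 d2 (X : measurableType d1) (Y : measurableType d2) (R : realType).
Variables (mu : {measure set X -> \bar R}) (nu : {measure set Y -> \bar R}).
Variables (phi : X -> Y) (h : X -> R).
Hypotheses (mphi : measurable_fun setT phi) (mh : measurable_fun setT h).
Hypothesis h0 : forall x, 0 <= h x.
Hypothesis nuE : forall B, measurable B ->
  nu B = (\int[mu]_x (\1_B (phi x) * h x)%:E)%E.

Import HBNNSimple.
Local Open Scope ereal_scope.

Let mB (B : set Y) : measurable B -> measurable_fun setT (fun x => (\1_B (phi x))%R : R).
Proof. by move=> ?; exact: measurableT_comp. Qed.

(** [nu] is known only through its values on measurable sets, so the formula is proved for simple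
    functions and passed to the limit by monotone convergence. It serves twice: with [phi] the
    multiplication by [A] for the torus, and with [phi = id] for the law of the pairs of points. *)
Lemma ge0_integral_density (f : Y -> \bar R) :
  measurable_fun setT f -> (forall y, 0 <= f y) ->
  \int[nu]_y f y = \int[mu]_x (f (phi x) * (h x)%:E).
Proof.
move=> mf f0; pose f_ := nnsfun_approx measurableT mf.
transitivity (limn (fun n => \int[nu]_y (f_ n y)%:E)).
  rewrite -monotone_convergence//.
  - by apply: eq_integral => y _; apply/esym/cvg_lim => //; exact: cvg_nnsfun_approx.
  - by move=> n; exact/measurable_EFinP/measurable_funP.
  - by move=> n y _; rewrite lee_fin.
  - by move=> y _ m n mn; rewrite lee_fin; exact/lefP/nd_nnsfun_approx.
have mfphi n : measurable_fun setT (fun x => f_ n (phi x)).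
  by apply: measurableT_comp => //; exact: measurable_funP.
transitivity (limn (fun n => \int[mu]_x (f_ n (phi x) * h x)%:E)); last first.
  rewrite -monotone_convergence//; last 3 first.
  - by move=> n; apply/measurable_EFinP/measurable_funM.
  - by move=> n x _; rewrite lee_fin mulr_ge0.
  - move=> x _ m n mn; rewrite lee_fin ler_wpM2r//.
    by have /lefP := @nd_nnsfun_approx _ _ _ _ measurableT _ mf _ _ mn; exact.
  apply: eq_integral => x _; apply/cvg_lim => //.
  under eq_fun do rewrite EFinM.
  apply: cvgeZr => //; exact: cvg_nnsfun_approx.
congr (limn _); apply/funext => n.
have mp r : measurable (f_ n @^-1` [set r]) by [].
transitivity (\sum_(k \in range (f_ n)) k%:E * nu (f_ n @^-1` [set k])).
  under eq_integral do rewrite fimfunE -fsumEFin//.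
  rewrite ge0_integral_fsum//; last 2 first.
  - by move=> y; exact/measurable_EFinP/measurable_funM.
  - by move=> y x _; rewrite nnfun_muleindic_ge0.
  apply: eq_fsbigr => r _; rewrite integralZl_indic_nnsfun// integral_indic//=.
  by rewrite setIT.
transitivity (\sum_(k \in range (f_ n)) \int[mu]_x
    (k * (\1_(f_ n @^-1` [set k]) (phi x) * h x))%:E).
  apply: eq_fsbigr => r /set_mem [y _ <-].
  rewrite nuE//; under [in RHS]eq_integral do rewrite EFinM.
  rewrite ge0_integralZl//; last by rewrite lee_fin.
  - apply/measurable_EFinP/measurable_funM => //; exact: mB.
  - by move=> x _; rewrite lee_fin mulr_ge0.
rewrite -ge0_integral_fsum//.
- apply: eq_integral => x _; rewrite fsumEFin//; congr EFin.
  by rewrite fimfunE mulr_fsuml//; apply: eq_fsbigr => r _; rewrite mulrA.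
- move=> r; apply/measurable_EFinP/measurable_funM => //.
  by apply/measurable_funM => //; exact: mB.
- move=> r x _; rewrite mulrA EFinM; apply: mule_ge0; last by rewrite lee_fin.
  exact: nnfun_muleindic_ge0.
Qed.

End density.

(** * Fourier integrals of products *)

Section phase.
Context {R : realType}.
Local Notation leb := (@lebesgue_measure R).
(** [G * eps b] is the Fourier transform of the weight [g] at [b], real by assumption, and [C] is
    the set of frequencies where it is known: the multiples of [2 * pi] for the indicator of [[0,
    1[], the whole line for a Gaussian. *)
Variables (g eps : R -> R) (C : set R) (G : R).
Hypotheses (mg : measurable_fun [set: measurableTypeR R] g) (g0 : forall x, 0 <= g x).
Hypotheses (eps0 : forall b, C b -> 0 <= eps b) (eps1 : forall b, C b -> eps b <= 1).
Hypothesis intg : (\int[leb]_x (g x)%:E = G%:E)%E.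
Hypothesis intgcos : forall b, C b -> forall t,
  (\int[leb]_x (g x * (1 + cos (t + x * b)))%:E = (G * (1 + cos t * eps b))%:E)%E.

Let cos1_ge0 (t : R) : 0 <= 1 + cos t.
Proof. by rewrite -lerBlDl sub0r cos_geN1. Qed.

Lemma measurable_dotcv n (b : 'cV[R]_n) : measurable_fun setT (fun x : 'cV[R]_n => dotcv x b).
Proof.
apply: measurable_sum => i; apply: measurable_funM => //; exact: measurable_coord.
Qed.

Lemma measurable_cos_dotcv n (t : R) (b : 'cV[R]_n) :
  measurable_fun setT (fun x : 'cV[R]_n => cos (t + dotcv x b)).
Proof.
apply: (@measurableT_comp _ _ _ _ _ _ (@cos R)).
  by apply: continuous_measurable_fun; exact: continuous_cos.
by apply: measurable_funD => //; exact: measurable_dotcv.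
Qed.

Lemma measurable_prod_coord n : measurable_fun setT (fun x : 'cV[R]_n => \prod_i g (x i 0)).
Proof.
apply: measurable_prod => i _.
by apply: (@measurableT_comp _ _ _ _ _ _ g) => //; exact: measurable_coord.
Qed.

Lemma dotcv_cons n x (y : 'cV[R]_n) (b : 'cV[R]_n.+1) :
  dotcv (col_cons x y) b = x * b ord0 0 + dotcv y (\col_i b (lift ord0 i) 0).
Proof.
rewrite /dotcv big_ord_recl col_cons0; congr (_ + _).
by apply: eq_bigr => i _; rewrite col_consS mxE.
Qed.

(** Integrating out all coordinates but the first leaves, up to a factor, a convex combination of 1
    and [1 + cos (t + x * b)], so nonnegative integrals suffice throughout the induction. This is
    why [eps] has to lie in [[0, 1]]. *)
Lemma integral_prod_phase n (b : 'cV[R]_n) (t : R) : (forall i, C (b i 0)) ->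
  (\int[lebcol]_x ((\prod_i g (x i 0)) * (1 + cos (t + dotcv x b)))%:E =
   (G ^+ n * (1 + cos t * \prod_i eps (b i 0)))%:E)%E.
Proof.
have mf m (c : 'cV[R]_m) u : measurable_fun setT (fun x : 'cV[R]_m =>
   ((\prod_i g (x i 0)) * (1 + cos (u + dotcv x c)))%:E).
  apply/measurable_EFinP; apply: measurable_funM; first exact: measurable_prod_coord.
  by apply: measurable_funD => //; exact: measurable_cos_dotcv.
have f0 m (c : 'cV[R]_m) u (x : 'cV[R]_m) :
    (0 <= ((\prod_i g (x i 0)) * (1 + cos (u + dotcv x c)))%:E)%E.
  by rewrite lee_fin mulr_ge0// prodr_ge0.
elim: n b t => [|n IH] b t Cb.
  rewrite ge0_integral_col0// !big_ord0 !expr0 !mul1r mulr1.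
  by rewrite /dotcv big_ord0 addr0.
rewrite ge0_integral_colS//.
pose b' : 'cV[R]_n := \col_i b (lift ord0 i) 0.
set e := \prod_i eps (b i 0).
pose e' := \prod_i eps (b' i 0).
have eE : e = eps (b ord0 0) * e'.
  by rewrite /e big_ord_recl; congr (_ * _); apply: eq_bigr => i _; rewrite mxE.
have Cb' i : C (b' i 0) by rewrite mxE.
have e'0 : 0 <= e' by apply: prodr_ge0 => i _; exact: eps0.
have e'1 : e' <= 1 by apply: prodr_ile1 => i _; rewrite eps0// eps1.
have G0 : 0 <= G by rewrite -lee_fin -intg; apply: integral_ge0 => x _; rewrite lee_fin.
transitivity (\int[leb]_x ((G ^+ n * (1 - e'))%:E * (g x)%:E +
    (G ^+ n * e')%:E * (g x * (1 + cos (t + x * b ord0 0)))%:E))%E.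
  apply: eq_integral => x _.
  transitivity (\int[lebcol]_y ((g x)%:E * ((\prod_i g (y i 0)) *
      (1 + cos ((t + x * b ord0 0) + dotcv y b')))%:E))%E.
    apply: eq_integral => y _; rewrite -EFinM big_ord_recl col_cons0 dotcv_cons addrA.
    rewrite mulrA; congr (_ * _ * _)%:E.
    by apply: eq_bigr => i _; rewrite col_consS.
  rewrite ge0_integralZl//; [|exact: mf|by rewrite lee_fin].
  rewrite IH// -/e' -!EFinM -EFinD; congr EFin; ring.
have mgc : measurable_fun [set: measurableTypeR R]
    (fun x => (g x * (1 + cos (t + x * b ord0 0)))%:E).
  apply/measurable_EFinP; apply: measurable_funM => //; apply: measurable_funD => //.
  apply: (@measurableT_comp _ _ _ _ _ _ (@cos R)).
    by apply: continuous_measurable_fun; exact: continuous_cos.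
  by apply: measurable_funD => //; exact: measurable_funM.
have Gn0 : 0 <= G ^+ n by rewrite exprn_ge0.
rewrite ge0_integralD//; last 4 first.
- by move=> x _; rewrite -EFinM lee_fin !mulr_ge0// subr_ge0.
- by apply/measurable_EFinP; apply: measurable_funM.
- by move=> x _; rewrite -EFinM lee_fin !mulr_ge0.
- by apply: emeasurable_funM => //; exact: measurable_cst.
rewrite !ge0_integralZl//; last 5 first.
- by move=> x _; rewrite lee_fin mulr_ge0.
- by rewrite lee_fin mulr_ge0.
- exact/measurable_EFinP.
- by move=> x _; rewrite lee_fin.
- by rewrite lee_fin mulr_ge0// subr_ge0.
rewrite intg intgcos// -!EFinM -EFinD eE exprS; congr EFin; ring.
Qed.

End phase.

(** * Two Fourier transforms on the line: unit interval and Gaussian *)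

Section one_dimensional.
Context {R : realType}.
Local Notation leb := (@lebesgue_measure R).

Lemma is_derive1_continuous (f df : R -> R) :
  (forall x, is_derive x (1 : R) f (df x)) -> continuous f.
Proof.
by move=> fdf x; apply: differentiable_continuous; apply/derivable1_diffP.
Qed.

Lemma integral_itv_is_derive (F f : R -> R) (a b : R) : a < b -> continuous f ->
  (forall x, is_derive x (1 : R) F (f x)) ->
  (\int[leb]_(x in `[a, b]) (f x)%:E = (F b - F a)%:E)%E.
Proof.
move=> ab cf Ff; have cF := is_derive1_continuous Ff.
rewrite (@continuous_FTC2 R f F)//.
- by apply: continuous_subspaceT => x; exact: cf.
- by split => //; [apply: cvg_at_right_filter|apply: cvg_at_left_filter]; exact: cF.
- by move=> x _; rewrite derive1E derive_val.
Qed.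

Lemma continuous_measurable_EFin (f : R -> R) (D : set (measurableTypeR R)) :
  continuous f -> measurable_fun D (EFin \o f).
Proof.
move=> cf; apply/measurable_EFinP; apply: measurable_funTS.
exact: continuous_measurable_fun.
Qed.

Lemma periodic2piz (f : R -> R) (m : int) (t : R) :
  periodic f (pi *+ 2) -> f (t + 2 * pi * m%:~R) = f t.
Proof.
have E (n : nat) : 2 * pi * n%:R = pi *+ 2 *+ n :> R.
  by rewrite -(mulr_natr (pi *+ 2)) -(mulr_natr pi 2) [2 * pi]mulrC.
move=> pf; case: m => n; first by rewrite -pmulrn E periodicn.
by rewrite NegzE rmorphN/= -pmulrn mulrN E -[LHS](periodicn pf n.+1) subrK.
Qed.

(** For [b != 0] the sine part of the antiderivative takes equal values at 0 and 1, because [b] is a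
    multiple of [2 * pi]. *)
Lemma integral_indic01_phase (t b : R) : (exists m : int, b = 2 * pi * m%:~R) ->
  (\int[leb]_x (\1_`[0%R, 1%R[ x * (1 + cos (t + x * b)))%:E =
   (1 * (1 + cos t * (b == 0)%:R))%:E)%E.
Proof.
move=> [m bm].
have cc : continuous (fun x : R => 1 + cos (t + x * b)).
  by apply: is_derive1_continuous => x; exact: is_derive_eq.
transitivity (\int[leb]_(x in `[0%R, 1%R[) (1 + cos (t + x * b))%:E)%E.
  rewrite [RHS]integral_mkcond; apply: eq_integral => x _.
  by rewrite patchE indicE; case: ifPn => _; rewrite ?mul1r ?mul0r.
rewrite integral_itv_bndo_bndc; last first.
  exact: continuous_measurable_EFin.
have [b0|b0] := eqVneq b 0.
  rewrite mulr1 mul1r b0 (eq_integral (fun=> (1 + cos t)%:E)); last first.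
    by move=> x _; rewrite mulr0 addr0.
  by rewrite integral_cst//= lebesgue_measure_itv/= lte01 oppr0 adde0 mule1.
rewrite mulr0 addr0 mul1r.
have dF (x : R) : is_derive x (1 : R) (fun x => x + sin (t + x * b) / b)
    (1 + cos (t + x * b)).
  by apply: is_derive_eq; rewrite /GRing.scale/=; field.
rewrite (integral_itv_is_derive ltr01 cc dF).
congr EFin; rewrite mul1r mul0r addr0 bm periodic2piz; first by ring.
exact: sinD2pi.
Qed.

Lemma measurable_indic01 : measurable_fun [set: measurableTypeR R]
  (\1_`[0%R, 1%R[%classic : R -> R).
Proof. exact: measurable_indic. Qed.

Lemma integral_indic01 :
  (\int[leb]_x ((\1_`[0%R, 1%R[%classic : R -> R) x)%:E = 1%:E)%E.
Proof.
by rewrite integral_indic// setIT /= lebesgue_measure_itv/= lte01 oppr0 adde0.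
Qed.

(* e^(-x^2/2) dominates every integrand below *)
Lemma integrable_gauss2 : leb.-integrable [set: R] (fun x => (expR (- x ^+ 2 / 2))%:E).
Proof.
have s0 : Num.sqrt (2 : R) != 0 by rewrite sqrtr_eq0 -ltNge.
have mg : measurable_fun [set: measurableTypeR R] (fun x : R => (expR (- x ^+ 2 / 2))%:E).
  apply: continuous_measurable_EFin.
  by apply: is_derive1_continuous => x; exact: is_derive_eq.
apply/integrableP; split => //.
under eq_integral do rewrite gee0_abs ?lee_fin ?expR_ge0//.
rewrite (ge0_integral_affine 0 s0 mg) => [|x]; last by rewrite lee_fin expR_ge0.
under eq_integral => x _.
  rewrite addr0 exprMn sqr_sqrtr// (_ : - (2 * x ^+ 2) / 2 = - x ^+ 2); last by field.
  over.
by rewrite integralT_gauss -EFinM ltry.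
Qed.

Lemma gauss_le (x : R) : expR (- x ^+ 2) <= expR (- x ^+ 2 / 2).
Proof. rewrite ler_expR; have := sqr_ge0 x; nra. Qed.

(** From [|x| <= 1 + x^2 / 2 <= exp (x^2 / 2)], where the left inequality is a weak form of
    [(|x| - 1)^2 >= 0]. *)
Lemma normr_gauss_le (x : R) : `|x| * expR (- x ^+ 2) <= expR (- x ^+ 2 / 2).
Proof.
have -> : - x ^+ 2 / 2 = x ^+ 2 / 2 + - x ^+ 2 by field.
rewrite expRD ler_wpM2r ?expR_ge0// (le_trans _ (expR_ge1Dx _))//.
have := sqr_ge0 (`|x| - 1); rewrite -(real_normK (num_real x)); nra.
Qed.

Section fourier_gauss.
Variable t : R.

Let phase (b x : R) := expR (- x ^+ 2) * cos (t + x * b).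
Let dphase (b x : R) := - x * expR (- x ^+ 2) * sin (t + x * b).
Let phi b := \int[leb]_x phase b x.

Let sin_le (x : R) : `|sin x| <= 1.
Proof. by rewrite ler_norml sin_geN1 sin_le1. Qed.
Let cos_le (x : R) : `|cos x| <= 1.
Proof. by rewrite ler_norml cos_geN1 cos_le1. Qed.

Let dphase_le b x : `|dphase b x| <= expR (- x ^+ 2 / 2).
Proof.
rewrite /dphase !normrM normrN (ger0_norm (expR_ge0 _)).
by rewrite (le_trans _ (normr_gauss_le x))// ler_piMr// mulr_ge0// expR_ge0.
Qed.

Let phase_le b x : `|phase b x| <= expR (- x ^+ 2 / 2).
Proof.
rewrite /phase normrM (ger0_norm (expR_ge0 _)).
by rewrite (le_trans _ (gauss_le x))// ler_piMr// expR_ge0.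
Qed.

Let dom_integrable (f : R -> R) : continuous f ->
  (forall x, `|f x| <= expR (- x ^+ 2 / 2)) -> leb.-integrable [set: R] (EFin \o f).
Proof.
move=> cf fle; apply: (le_integrable measurableT _ _ integrable_gauss2).
  exact: continuous_measurable_EFin.
by move=> x _; rewrite /= lee_fin (ger0_norm (expR_ge0 _)).
Qed.

Let int_phase b : leb.-integrable [set: R] (EFin \o phase b).
Proof.
apply: dom_integrable => //; apply: is_derive1_continuous => x; exact: is_derive_eq.
Qed.

Let int_dphase b : leb.-integrable [set: R] (EFin \o dphase b).
Proof.
apply: dom_integrable => //; apply: is_derive1_continuous => x; exact: is_derive_eq.
Qed.

(** Integration by parts: the integrand is the derivative in [x] of [exp (- x^2) * sin (t + x * b)],
    which vanishes at both ends of the line. As [dphase] is the derivative of [phase] in [b], this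
    is the differential equation of [phi]. *)
Let total b : \int[leb]_x (2 * dphase b x + b * phase b x) = 0.
Proof.
pose h x := 2 * dphase b x + b * phase b x.
pose F (x : R) := expR (- x ^+ 2) * sin (t + x * b).
have Fh x : is_derive x (1 : R) F (h x).
  by apply: is_derive_eq; rewrite /GRing.scale/= /h /phase /dphase; ring.
have ch : continuous h by apply: is_derive1_continuous => x; exact: is_derive_eq.
have int_h : leb.-integrable [set: R] (EFin \o h).
  rewrite (_ : _ \o _ = (fun x => (2%:E * (EFin \o dphase b) x)%E) \+
      (fun x => (b%:E * (EFin \o phase b) x)%E))%E//.
  by apply: integrableD => //; exact: integrableZl.
(* Truncation to [[- n, n]], where the fundamental theorem of calculus applies; the absolute value
   of [h] dominates. *)
pose f_ n := ((EFin \o h) \_ `[(- n%:R), n%:R]).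
have mf_ n : measurable_fun [set: R] (f_ n).
  apply: (measurable_restrictT _ _).1 => //; exact: continuous_measurable_EFin.
have mh : measurable_fun [set: R] (EFin \o h) by exact: continuous_measurable_EFin.
have f_h : {ae leb, forall x, [set: R] x -> f_ n x @[n --> \oo] --> (EFin \o h) x}.
  apply: aeW => x _; apply: cvg_near_cst; near=> n.
  rewrite /f_ patchE ifT// inE/= in_itv/= -ler_norml.
  by near: n; exact: nbhs_infty_ger.
have f_le : {ae leb, forall x n, [set: R] x -> (`|f_ n x| <= (abse \o (EFin \o h)) x)%E}.
  by apply: aeW => x n _; rewrite /f_ patchE; case: ifPn => // _; rewrite abse0 abse_ge0.
have [_ _ cv] := @dominated_convergence _ (measurableTypeR R) R leb _ measurableT
  f_ _ _ mf_ mh f_h (integrable_abse int_h) f_le.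
suff -> : \int[leb]_x h x = 0 by [].
rewrite /Rintegral; suff -> : (\int[leb]_x (h x)%:E = 0)%E by [].
apply: (cvg_unique _ cv) => //.
(* The Gaussian is weakened to [exp (1 - |x|)], so that the boundary terms are controlled by the
   sequence [exp (- n)]. *)
have F_le x : `|F x| <= expR (- `|x|) * expR 1.
  rewrite /F normrM (ger0_norm (expR_ge0 _)) -expRD.
  rewrite (@le_trans _ _ (expR (- x ^+ 2)))//; first by rewrite ler_piMr// expR_ge0.
  rewrite ler_expR -(real_normK (num_real x)).
  have := normr_ge0 x; have := sqr_ge0 (2 * `|x| - 1); nra.
have Fn0 (e : R) : `|e| = 1 -> F (e * n%:R) @[n --> \oo] --> 0.
  move=> e1; apply: norm_cvg0.
  apply: (@squeeze_cvgr _ _ _ _ (cst 0) (fun n => expR (- n%:R) * expR 1)).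
  - apply: nearW => n; rewrite normr_ge0/= (le_trans (F_le _))//.
    by rewrite normrM e1 mul1r normr_nat.
  - exact: cvg_cst.
  - rewrite -(mul0r (expR 1)); apply: cvgM; last exact: cvg_cst.
    exact: cvgn_expR.
have cF : (F (1 * n%:R) - F (- 1 * n%:R))%:E @[n --> \oo] --> (0 : \bar R)%E.
  apply: cvg_EFin; first exact: nearW.
  rewrite -[X in _ --> X](subr0 0); apply: cvgB; apply: Fn0; rewrite ?normrN1 ?normr1//.
move: cF; apply: cvg_trans; apply: near_eq_cvg; near=> n.
have E : (\int[leb]_x f_ n x = \int[leb]_(x in `[(- n%:R)%R, n%:R%R]) (h x)%:E)%E.
  by rewrite [RHS]integral_mkcond.
rewrite /= E mul1r mulN1r (integral_itv_is_derive _ ch Fh)//.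
by rewrite gtrN// ltr0n; near: n; exact: nbhs_infty_gt.
Unshelve. all: by end_near. Qed.

(** Differentiation under the integral sign, with a dominating function [exp (- y^2 / 2)] that does
    not depend on the frequency; [total] then expresses the integral of [dphase] through [phi]. *)
Let phi_derive b : is_derive b (1 : R) phi (- (b / 2) * phi b).
Proof.
have Ib : `]b - 1, b + 1[%classic b by rewrite /= in_itv/= ltrBlDr ltrDl ltr01.
have dph (c y : R) : is_derive c (1 : R) (phase ^~ y) (dphase c y).
  by rewrite /phase; apply: is_derive_eq; rewrite /GRing.scale/= /dphase; ring.
have dE c y : partial1of2 phase c y = dphase c y by rewrite partial1of2E derive_val.
have H1 x : `]b - 1, b + 1[%classic x -> leb.-integrable setT (EFin \o phase x).
  by [].
have H2 x (y : R) : `]b - 1, b + 1[%classic x -> setT y -> derivable (phase ^~ y) x 1.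
  by [].
have H3 x (y : R) : `]b - 1, b + 1[%classic x -> setT y ->
   `|partial1of2 phase x y| <= expR (- y ^+ 2 / 2).
  by move=> _ _; rewrite dE.
have G0 (y : R) : 0 <= expR (- y ^+ 2 / 2) by exact: expR_ge0.
have dphi := derivable_under_integral measurableT Ib H1 H2 G0 integrable_gauss2 H3.
have phi' := differentiation_under_integral measurableT Ib H1 H2 G0 integrable_gauss2 H3.
apply: DeriveDef => //; rewrite -derive1E phi'.
transitivity (\int[leb]_x dphase b x); first by apply: eq_Rintegral => x _; rewrite dE.
have := total b; rewrite RintegralD//; last 2 first.
- by apply: (@integrableZl _ _ _ leb _ measurableT 2 (EFin \o dphase b)).
- by apply: (@integrableZl _ _ _ leb _ measurableT b (EFin \o phase b)).
rewrite !RintegralZl// -/(phi b) => /eqP; rewrite addr_eq0 => /eqP E.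
by apply: (mulfI (_ : 2 != 0 :> R)) => //; rewrite E; field.
Qed.

(** The equation [phi' = - (b / 2) phi] makes [phi b * exp (b^2 / 4)] constant, and its value at 0
    is a Gaussian integral. *)
Lemma fourier_gauss b : \int[leb]_x (expR (- x ^+ 2) * cos (t + x * b)) =
  Num.sqrt pi * cos t * expR (- b ^+ 2 / 4).
Proof.
rewrite -/(phi b); pose chi c := phi c * expR (c ^+ 2 / 4).
have dchi c : is_derive c (1 : R) chi 0.
  have pd := phi_derive c; have ed : is_derive c (1 : R) (fun c => expR (c ^+ 2 / 4))
      (c / 2 * expR (c ^+ 2 / 4)).
    by apply: is_derive_eq; rewrite /GRing.scale/=; field.
  by rewrite /chi; apply: (is_derive_eq (is_deriveM pd ed)); rewrite /GRing.scale/=; field.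
have := is_derive_0_is_cst b 0 dchi; rewrite /chi expr0n/= mul0r expR0 mulr1.
have -> : phi 0 = Num.sqrt pi * cos t.
  rewrite /phi /phase; under eq_Rintegral do rewrite mulr0 addr0.
  rewrite RintegralZr//; last exact: integrableT_gauss.
  by congr (_ * _); rewrite /Rintegral integralT_gauss.
by move=> <-; rewrite -mulrA -expRD -mulrDl subrr mul0r expR0 mulr1.
Qed.

Lemma integral_gauss1_phase b :
  (\int[leb]_x (expR (- x ^+ 2) * (1 + cos (t + x * b)))%:E =
   (Num.sqrt pi * (1 + cos t * expR (- b ^+ 2 / 4)))%:E)%E.
Proof.
have ig := @integrableT_gauss R.
under eq_integral do rewrite mulrDr mulr1 EFinD.
rewrite integralD//; last exact: int_phase.
rewrite integralT_gauss -(fineK (integrable_fin_num _ (int_phase b)))//.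
rewrite -[X in (_ + X%:E)%E]/(\int[leb]_x (expR (- x ^+ 2) * cos (t + x * b))).
by rewrite fourier_gauss -EFinD mulrDr mulr1 mulrA.
Qed.

End fourier_gauss.

Lemma integral_gauss_phase (u t b : R) : 0 < u ->
  (\int[leb]_x (expR (- (u * x ^+ 2)) * (1 + cos (t + x * b)))%:E =
   (Num.sqrt (pi / u) * (1 + cos t * expR (- b ^+ 2 / (4 * u))))%:E)%E.
Proof.
move=> u0; have v0 : Num.sqrt u != 0 by rewrite sqrtr_eq0 -ltNge.
have cf : continuous (fun x : R => expR (- (u * x ^+ 2)) * (1 + cos (t + x * b))).
  by apply: is_derive1_continuous => x; exact: is_derive_eq.
have a0 : (Num.sqrt u)^-1 != 0 by rewrite invr_eq0.
have mf : measurable_fun [set: measurableTypeR R]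
    (fun x => (expR (- (u * x ^+ 2)) * (1 + cos (t + x * b)))%:E).
  exact: continuous_measurable_EFin cf.
rewrite (ge0_integral_affine 0 a0 mf) => [|x]; last first.
  by rewrite lee_fin mulr_ge0// ?expR_ge0// -lerBlDl sub0r cos_geN1.
under eq_integral => x _.
  rewrite addr0 exprMn exprVn sqr_sqrtr ?(ltW u0)// mulrA divff ?gt_eqF// mul1r.
  rewrite -mulrA [x * b]mulrC mulrA [_ * x]mulrC.
  over.
rewrite integral_gauss1_phase -EFinM; congr EFin.
rewrite ger0_norm ?invr_ge0 ?sqrtr_ge0// sqrtrM ?pi_ge0// sqrtrV ?(ltW u0)//.
rewrite mulrA [_^-1 * _]mulrC; congr (_ * (1 + cos t * expR _)).
rewrite exprMn exprVn sqr_sqrtr ?(ltW u0)//; field; exact: lt0r_neq0.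
Qed.

End one_dimensional.

(** * Lattice sums *)

Section countable_sums.
Context {R : realType}.
Local Open Scope ereal_scope.

(** Enumerating the index type through [pickle] turns the sum into a series, to which monotone
    convergence applies; integers that code no element contribute 0. *)
Lemma esum_countT (I : countType) (a : I -> \bar R) :
  (forall i, 0 <= a i) ->
  \esum_(i in [set: I]) a i = \sum_(n <oo) oapp a 0 (pickle_inv n).
Proof.
move=> a0; have b0 n : 0 <= oapp a 0 (@pickle_inv I n) by case: pickle_inv.
rewrite nneseries_esumT//.
transitivity (\esum_(n in range (@pickle I)) oapp a 0 (@pickle_inv I n)).
  rewrite esum_image; last by move=> x y _ _ /(pcan_inj pickleK_inv).
  by apply: eq_esum => i _; rewrite pickleK_inv.
rewrite esum_mkcond; apply: eq_esum => n _; case: ifPn => // nr.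
case E : (pickle_inv n) => [i|]//=; exfalso; move: nr; rewrite notin_setE; apply.
by exists i => //; have := @pickle_invK I n; rewrite E.
Qed.

Lemma measurable_esum (I : countType) d (T : measurableType d) (f : I -> T -> \bar R) :
  (forall i, measurable_fun setT (f i)) -> (forall i x, 0 <= f i x) ->
  measurable_fun setT (fun x => \esum_(i in [set: I]) f i x).
Proof.
move=> mf f0; rewrite (_ : (fun _ => _) =
  (fun x => \sum_(n <oo) oapp (f^~ x) 0 (@pickle_inv I n))); last first.
  by apply/funext => x; rewrite esum_countT.
apply: ge0_emeasurable_sum => n; first by move=> x _ _; case: pickle_inv => //=.
by case: pickle_inv => //= i _; exact: mf.
Qed.

Lemma ge0_integral_esum (I : countType) d (T : measurableType d)
    (mu : {measure set T -> \bar R}) (f : I -> T -> \bar R) :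
  (forall i, measurable_fun setT (f i)) -> (forall i x, 0 <= f i x) ->
  \int[mu]_x (\esum_(i in [set: I]) f i x) = \esum_(i in [set: I]) \int[mu]_x f i x.
Proof.
move=> mf f0; rewrite esum_countT; last by move=> i; exact: integral_ge0.
transitivity (\int[mu]_x \sum_(n <oo) oapp (f^~ x) 0 (@pickle_inv I n)).
  by apply: eq_integral => x _; rewrite esum_countT.
rewrite integral_nneseries//.
- apply: eq_eseriesr => n _; case: pickle_inv => //=; exact: integral0.
- by move=> n; case: pickle_inv => //= i; exact: mf.
- by move=> n x _; case: pickle_inv => //=.
Qed.

Lemma ge0_esumZl (I : countType) (k : R) (a : I -> \bar R) :
  (0 <= k)%R -> (forall i, 0 <= a i) ->
  \esum_(i in [set: I]) (k%:E * a i) = k%:E * \esum_(i in [set: I]) a i.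
Proof.
move=> k0 a0; rewrite !esum_countT//; last by move=> i; rewrite mule_ge0// lee_fin.
rewrite -nneseriesZl; last by move=> n _; case: pickle_inv => //= i; exact: a0.
by apply: eq_eseriesr => n _; case: pickle_inv => //=; rewrite mule0.
Qed.

End countable_sums.

(** * Coordinates on a lattice and on its dual *)

Section lattice_points.
Context {R : realType}.

Definition int_col n (z : 'cV[int]_n) : 'cV[R]_n := map_mx intr z.

Lemma int_col_inj n : injective (@int_col n).
Proof.
move=> x y /colP xy; apply/colP => i.
by have := xy i; rewrite !mxE => /intr_inj.
Qed.

Lemma dotcvE n (x y : 'cV[R]_n) : dotcv x y = (x^T *m y) 0 0.
Proof. by rewrite mxE; apply: eq_bigr => i _; rewrite mxE. Qed.

Lemma dotcv_mulmx n (A : 'M[R]_n) (x y : 'cV[R]_n) :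
  dotcv (A *m x) y = dotcv x (A^T *m y).
Proof. by rewrite !dotcvE trmx_mul mulmxA. Qed.

Lemma dotcvDl n (x y z : 'cV[R]_n) : dotcv (x + y) z = dotcv x z + dotcv y z.
Proof. by rewrite !dotcvE raddfD mulmxDl mxE. Qed.

Lemma dotcvNl n (x z : 'cV[R]_n) : dotcv (- x) z = - dotcv x z.
Proof. by rewrite !dotcvE raddfN mulNmx mxE. Qed.

Lemma dotcvDr n (x y z : 'cV[R]_n) : dotcv x (y + z) = dotcv x y + dotcv x z.
Proof. by rewrite !dotcvE mulmxDr mxE. Qed.

Lemma dotcvNr n (x z : 'cV[R]_n) : dotcv x (- z) = - dotcv x z.
Proof. by rewrite !dotcvE mulmxN mxE. Qed.

Lemma dotcvC n (x y : 'cV[R]_n) : dotcv x y = dotcv y x.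
Proof. by apply: eq_bigr => i _; rewrite mulrC. Qed.

Lemma dotcvZr n (a : R) (x z : 'cV[R]_n) : dotcv x (a *: z) = a * dotcv x z.
Proof. by rewrite !dotcvE -scalemxAr mxE. Qed.

Lemma dotcv_ge0 n (x : 'cV[R]_n) : 0 <= dotcv x x.
Proof. by apply: sumr_ge0 => i _; rewrite -expr2 sqr_ge0. Qed.

Lemma sqr_norm2 n (x : 'cV[R]_n) : norm2 x ^+ 2 = dotcv x x.
Proof. by rewrite sqr_sqrtr// dotcv_ge0. Qed.

Lemma dotcv_int n (x y : 'cV[int]_n) : dotcv (int_col x) (int_col y) \is a Num.int.
Proof.
rewrite /dotcv rpred_sum// => i _; rewrite !mxE -intrM.
by apply/intrP; exists (x i 0 * y i 0).
Qed.

Lemma esum_lattice n (A : 'M[R]_n) (f : 'cV[R]_n -> \bar R) : A \in unitmx ->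
  (\esum_(v in lattice A) f v = \esum_(z in [set: 'cV[int]_n]) f (A *m int_col z))%E.
Proof.
move=> uA; rewrite /lattice esum_image// => x y _ _.
by move=> /(can_inj (mulKmx uA))/int_col_inj.
Qed.

(** Pairing with the basis vector [A *m delta_mx i 0] reads off the [i]-th coordinate of [A^T *m w],
    which is therefore an integer. *)
Lemma dual_latticeE n (A : 'M[R]_n) : A \in unitmx ->
  dual_lattice A = lattice (invmx A)^T.
Proof.
move=> uA; apply/seteqP; split => [w dw|_ [z _ <-]]; last first.
  move=> _ [y _ <-]; rewrite dotcvC dotcv_mulmx mulmxA -trmx_mul mulVmx//.
  by rewrite trmx1 mul1mx; exact: dotcv_int.
have zP i : exists m : int, (A^T *m w) i 0 = m%:~R.
  apply/intrP; have := dw _ (ex_intro2 _ _ (delta_mx i 0) I erefl).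
  rewrite dotcvC dotcv_mulmx (_ : dotcv _ _ = (A^T *m w) i 0)//.
  rewrite /dotcv (bigD1 i)//= big1 ?addr0; first by rewrite !mxE !eqxx mul1r.
  by move=> j ji; rewrite !mxE (negbTE ji) mul0r.
have [z zE] := choice zP.
exists (\col_i z i) => //; apply: (can_inj (mulKmx (_ : A^T \in unitmx))).
  by rewrite unitmx_tr.
rewrite mulmxA -trmx_mul mulVmx// trmx1 mul1mx; apply/colP => i.
by rewrite zE !mxE.
Qed.

End lattice_points.

(** * Unfolding integrals over the unit cube *)

Section unit_cube.
Context {R : realType}.

(** A product of one-dimensional indicators, so that [integral_prod_phase] applies; [unit_cubeE]
    recovers the single indicator. *)
Definition unit_cube n (x : 'cV[R]_n) : R := \prod_i \1_`[0%R, 1%R[%classic (x i 0).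

Lemma unit_cubeE n (x : 'cV[R]_n) : unit_cube x = (`[< forall i, 0 <= x i 0 < 1 >])%:R.
Proof.
rewrite /unit_cube; case: asboolP => [x01|/existsNP[i /negP x01]].
  by apply: big1 => i _; rewrite indicE mem_set//= in_itv/=.
rewrite (bigD1 i)//= indicE memNset ?mul0r//= in_itv/=; exact/negP.
Qed.

Lemma unit_cube_ge0 n (x : 'cV[R]_n) : 0 <= unit_cube x.
Proof. by rewrite unit_cubeE. Qed.

Lemma measurable_unit_cube n : measurable_fun setT (@unit_cube n).
Proof. exact: (measurable_prod_coord measurable_indic01). Qed.

Lemma integral_unit_cube_phase n (z : 'cV[int]_n) (t : R) :
  (\int[lebcol]_x (unit_cube x * (1 + cos (t + 2 * pi * dotcv x (int_col z))))%:E =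
   (1 + cos t * (z == 0)%:R)%:E)%E.
Proof.
have eps0 (b : R) : (exists m : int, b = 2 * pi * m%:~R) -> 0 <= (b == 0)%:R :> R by [].
have eps1 (b : R) : (exists m : int, b = 2 * pi * m%:~R) -> (b == 0)%:R <= 1 :> R.
  by rewrite lern1 leq_b1.
under eq_integral do rewrite -dotcvZr.
rewrite (integral_prod_phase measurable_indic01 _ eps0 eps1 integral_indic01).
- rewrite expr1n mul1r; congr (1 + _ * _)%:E.
  have [->|] := eqVneq z 0; first by rewrite big1// => i _; rewrite !mxE mulr0 eqxx.
  move=> /matrix0Pn[i [j zij]]; rewrite (bigD1 i)//= !mxE -(ord1 j).
  rewrite mulf_eq0 intr_eq0 (negbTE zij) orbF mulf_eq0 pnatr_eq0/=.
  by rewrite gt_eqF ?pi_gt0// mul0r.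
- by move=> x; rewrite indicE.
- by move=> b Cb u; exact: integral_indic01_phase.
- by move=> i; exists (z i 0); rewrite !mxE.
Qed.

Lemma integral_unit_cube n : (\int[lebcol]_(x in [set: 'cV[R]_n]) (unit_cube x)%:E = 1)%E.
Proof.
(* At frequency zero and phase [pi / 2] the cosine vanishes and the plain integral remains. *)
have := @integral_unit_cube_phase n 0 (pi / 2).
rewrite cos_pihalf mul0r addr0 => <-; apply: eq_integral => x _.
by rewrite /int_col raddf0 dotcvE mulmx0 mxE mulr0 addr0 cos_pihalf addr0 mulr1.
Qed.

(** The integer translates of the cube partition the space: the only surviving term is the one at
    the coordinatewise floor of [x]. *)
Lemma esum_unit_cube n (x : 'cV[R]_n) (a : \bar R) : (0 <= a)%E ->
  (\esum_(z in [set: 'cV[int]_n]) ((unit_cube (x - int_col z))%:E * a) = a)%E.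
Proof.
move=> a0; pose z0 : 'cV[int]_n := \col_i Num.floor (x i 0).
have u0 (y : 'cV[R]_n) : (0 <= (unit_cube y)%:E * a)%E.
  by rewrite mule_ge0// lee_fin unit_cube_ge0.
rewrite (esumID [set z0])// setTI esum_set1// esum1 ?adde0.
  rewrite unit_cubeE asboolT ?mul1e// => i; rewrite !mxE.
  have /andP[] := floor_itv (x i 0); rewrite intrD; lra.
move=> z [_ zz0]; rewrite unit_cubeE asboolF ?mul0e// => x01; apply: zz0; apply/colP => i.
rewrite mxE; apply/esym/floor_def; have := x01 i; rewrite !mxE intrD; lra.
Qed.

(** The partition of [esum_unit_cube] is inserted under the right-hand integral and each term is
    translated by its [z]. *)
Lemma ge0_integral_unfold n (f : 'cV[R]_n -> \bar R) :
  measurable_fun setT f -> (forall x, 0 <= f x)%E ->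
  (\int[lebcol]_x ((unit_cube x)%:E * \esum_(z in [set: 'cV[int]_n]) f (x + int_col z)%R) =
   \int[lebcol]_x f x)%E.
Proof.
move=> mf f0.
have mfz (z : 'cV[int]_n) : measurable_fun setT (fun x : 'cV[R]_n => f (x + int_col z)%R).
  by apply: measurableT_comp => //; exact: measurable_fun_colD.
have mu : measurable_fun setT (fun x : 'cV[R]_n => (unit_cube x)%:E).
  exact/measurable_EFinP/measurable_unit_cube.
have muz (z : 'cV[int]_n) :
  measurable_fun setT (fun x : 'cV[R]_n => (unit_cube (x - int_col z)%R)%:E).
  by apply: (measurableT_comp mu); exact: measurable_fun_colD.
transitivity (\int[lebcol]_x \esum_(z in [set: 'cV[int]_n])
    ((unit_cube x)%:E * f (x + int_col z)%R))%E.
  by apply: eq_integral => x _; rewrite ge0_esumZl// unit_cube_ge0.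
transitivity (\int[lebcol]_x \esum_(z in [set: 'cV[int]_n])
    ((unit_cube (x - int_col z)%R)%:E * f x))%E; last first.
  by apply: eq_integral => x _; rewrite esum_unit_cube.
rewrite !ge0_integral_esum//.
- apply: eq_esum => z _; rewrite -[RHS](ge0_integral_translation (int_col z)).
  + by apply: eq_integral => x _; rewrite addrK.
  + exact: emeasurable_funM.
  + by move=> x; rewrite mule_ge0// lee_fin unit_cube_ge0.
- by move=> z; exact: emeasurable_funM.
- by move=> z x; rewrite mule_ge0// lee_fin unit_cube_ge0.
- by move=> z; exact: emeasurable_funM.
- by move=> z x; rewrite mule_ge0// lee_fin unit_cube_ge0.
Qed.
End unit_cube.

(** * Gaussian integrals over R^d and Gaussian sums over lattices *)

Section gaussian_sums.
Context {R : realType}.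

Lemma integral_gauss_dotcv_phase n (u t : R) (b : 'cV[R]_n) : 0 < u ->
  (\int[lebcol]_x (expR (- (u * dotcv x x)) * (1 + cos (t + dotcv x b)))%:E =
   (Num.sqrt (pi / u) ^+ n * (1 + cos t * expR (- dotcv b b / (4 * u))))%:E)%E.
Proof.
move=> u0; pose g (x : R) := expR (- (u * x ^+ 2)).
have mg : measurable_fun [set: measurableTypeR R] g.
  by apply: continuous_measurable_fun; apply: is_derive1_continuous => x; exact: is_derive_eq.
have g0 x : 0 <= g x by exact: expR_ge0.
pose eps (b : R) := expR (- b ^+ 2 / (4 * u)).
have eps0 c : [set: R] c -> 0 <= eps c by move=> _; exact: expR_ge0.
have eps1 c : [set: R] c -> eps c <= 1.
  move=> _; rewrite -expR0 ler_expR mulNr oppr_le0 divr_ge0 ?sqr_ge0//.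
  by rewrite mulr_ge0// ltW.
have gphase c v : (\int[lebesgue_measure]_x (g x * (1 + cos (v + x * c)))%:E =
   (Num.sqrt (pi / u) * (1 + cos v * eps c))%:E)%E by exact: integral_gauss_phase.
have intg : (\int[lebesgue_measure]_x (g x)%:E = (Num.sqrt (pi / u))%:E)%E.
  have := gphase 0 (pi / 2); rewrite cos_pihalf mul0r addr0 mulr1 => <-.
  by apply: eq_integral => x _; rewrite mulr0 addr0 cos_pihalf addr0 mulr1.
have := integral_prod_phase mg g0 eps0 eps1 intg (fun c _ v => gphase c v) t
  (fun i => I : [set: R] (b i 0)).
rewrite (_ : \prod_i eps (b i 0) = expR (- dotcv b b / (4 * u))) => [<-|].
  apply: eq_integral => x _; congr (_ * _)%:E.
  rewrite -expR_sum; congr expR; rewrite /dotcv mulr_sumr -sumrN.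
  by apply: eq_bigr => i _; rewrite expr2.
rewrite -expR_sum; congr expR; rewrite /dotcv mulNr mulr_suml -sumrN.
by apply: eq_bigr => i _; rewrite expr2 mulNr.
Qed.

Lemma measurable_gauss_dotcv n (c : R) :
  measurable_fun setT (fun x : 'cV[R]_n => expR (- (c * dotcv x x))).
Proof.
apply: measurableT_comp => //; apply: measurableT_comp => //.
apply: measurable_funM => //; apply: measurable_sum => i.
by apply: measurable_funM; exact: measurable_coord.
Qed.

Lemma dotcv0r n (x : 'cV[R]_n) : dotcv x 0 = 0.
Proof. by rewrite dotcvE mulmx0 mxE. Qed.

Lemma ge0_integral_mulmx n (A : 'M[R]_n) (f : 'cV[R]_n -> \bar R) : A \in unitmx ->
  measurable_fun setT f -> (forall x, 0 <= f x)%E ->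
  (\int[lebcol]_x f (A *m x) = (`|\det A|^-1)%:E * \int[lebcol]_x f x)%E.
Proof.
move=> uA mf f0; have dA : \det A != 0 by move: uA; rewrite unitmxE unitfE.
by rewrite -(linear_change uA mf f0) muleA -EFinM mulVf ?normr_eq0// mul1e.
Qed.

Lemma integral_gauss_dotcv n (u : R) : 0 < u ->
  (\int[lebcol]_(x in [set: 'cV[R]_n]) (expR (- (u * dotcv x x)))%:E =
   (Num.sqrt (pi / u) ^+ n)%:E)%E.
Proof.
move=> u0; have := @integral_gauss_dotcv_phase n u (pi / 2) 0 u0.
rewrite cos_pihalf mul0r addr0 mulr1 => <-; apply: eq_integral => x _.
by rewrite dotcv0r addr0 cos_pihalf addr0 mulr1.
Qed.

Lemma dotcvD_le n (x y : 'cV[R]_n) :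
  dotcv (x + y) (x + y) <= 2 * dotcv x x + 2 * dotcv y y.
Proof.
rewrite /dotcv !mulr_sumr -big_split/=; apply: ler_sum => i _; rewrite mxE.
have := sqr_ge0 (x i 0 - y i 0); nra.
Qed.

Lemma unit_cube_mulmx_le n (B : 'M[R]_n) (x : 'cV[R]_n) :
  (forall i, 0 <= x i 0 < 1) ->
  dotcv (B *m x) (B *m x) <= \sum_i (\sum_j `|B i j|) ^+ 2.
Proof.
move=> x01; apply: ler_sum => i _; rewrite -expr2 -(real_normK (num_real _)).
rewrite lerXn2r ?nnegrE ?normr_ge0 ?sumr_ge0// mxE (le_trans (ler_norm_sum _ _ _))//.
apply: ler_sum => j _; rewrite normrM ler_piMr//.
by have /andP[x0 x1] := x01 j; rewrite ger0_norm// ltW.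
Qed.

(** Comparison with an integral: for every [x] in the cube, the term at [z] is at most [exp (c * D)]
    times a wider Gaussian at [B *m (x + int_col z)]. Averaging over the cube and unfolding bounds
    the sum by a Gaussian integral over the whole space. *)
Lemma summable_gauss n (B : 'M[R]_n) (c : R) : B \in unitmx -> 0 < c ->
  (\esum_(z in [set: 'cV[int]_n])
     (expR (- (c * dotcv (B *m int_col z) (B *m int_col z))))%:E < +oo)%E.
Proof.
move=> uB c0; pose D := \sum_i (\sum_j `|B i j|) ^+ 2.
(* The rate [c / 2] makes up for the factor 2 in [dotcvD_le]; [D] bounds the squared norm of
   [B *m x] on the cube. *)
pose f (x : 'cV[R]_n) := expR (- (c / 2 * dotcv x x)).
have mf : measurable_fun setT f by exact: measurable_gauss_dotcv.
have mfB : measurable_fun setT (fun x : 'cV[R]_n => (f (B *m x))%:E).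
  apply/measurable_EFinP; apply: (measurableT_comp mf); exact: measurable_fun_colM.
set S := (\esum_(z in _) _)%E.
have S0 : (0 <= S)%E by apply: esum_ge0 => z _; rewrite lee_fin expR_ge0.
have mu : measurable_fun setT (fun x : 'cV[R]_n => (unit_cube x)%:E).
  exact/measurable_EFinP/measurable_unit_cube.
have u0 (x : 'cV[R]_n) : (0 <= (unit_cube x)%:E)%E by rewrite lee_fin unit_cube_ge0.
have mfz : measurable_fun setT (fun x : 'cV[R]_n =>
    (\esum_(z in [set: 'cV[int]_n]) (f (B *m (x + int_col z)))%:E)%E).
  have H := @measurable_esum R 'cV[int]_n _ 'cV[R]_n (fun z x => (f (B *m (x + int_col z)))%:E).
  refine (H _ _).
    by move=> z; apply: (measurableT_comp mfB); exact: measurable_fun_colD.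
  by move=> z x; rewrite lee_fin expR_ge0.
have fz0 (x : 'cV[R]_n) : (0 <= \esum_(z in [set: 'cV[int]_n]) (f (B *m (x + int_col z)))%:E)%E.
  by apply: esum_ge0 => z _; rewrite lee_fin expR_ge0.
have -> : S = (\int[lebcol]_(x in [set: 'cV[R]_n]) (S * (unit_cube x)%:E))%E.
  by rewrite ge0_integralZl// integral_unit_cube mule1.
apply: (@le_lt_trans _ _ (\int[lebcol]_(x in [set: 'cV[R]_n])
    ((expR (c * D))%:E * ((unit_cube x)%:E *
     \esum_(z in [set: 'cV[int]_n]) (f (B *m (x + int_col z)))%:E)))%E).
  apply: ge0_le_integral => //.
  - by move=> x _; rewrite mule_ge0.
  - by apply: emeasurable_funM => //; exact: measurable_cst.
  - apply: emeasurable_funM; first exact: measurable_cst.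
    exact: emeasurable_funM.
  - move=> x _; rewrite unit_cubeE; case: asboolP => x01; last by rewrite mule0 mul0e mule0.
    rewrite mule1 mul1e -ge0_esumZl ?expR_ge0//; last first.
      by move=> z; rewrite lee_fin expR_ge0.
    apply: le_esum => z _; rewrite -EFinM lee_fin /f -expRD ler_expR.
    have := unit_cube_mulmx_le B x01; rewrite -/D => xD.
    have := dotcvD_le (B *m x) (B *m int_col z); rewrite -mulmxDr; nra.
rewrite ge0_integralZl ?lee_fin ?expR_ge0//; last 2 first.
  - exact: emeasurable_funM.
  - by move=> x _; rewrite mule_ge0.
rewrite (ge0_integral_unfold mfB) => [|x]; last by rewrite lee_fin expR_ge0.
rewrite (@ge0_integral_mulmx n B (EFin \o f))//; last 2 first.
  - exact/measurable_EFinP.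
  - by move=> x; rewrite lee_fin expR_ge0.
by rewrite integral_gauss_dotcv ?divr_gt0// -!EFinM ltry.
Qed.

End gaussian_sums.

(** * Integration over the torus *)

Section torus.
Context {R : realType} {n : nat} (A : 'M[R]_n) (uA : A \in unitmx).
Local Notation torus := (torus_measure uA).

Let dA : \det A != 0. Proof. by move: uA; rewrite unitmxE unitfE. Qed.

Lemma indic_fundamental_domain (x : 'cV[R]_n) :
  \1_(fundamental_domain A) (A *m x) = unit_cube x :> R.
Proof.
rewrite unit_cubeE indicE; congr (_%:R); case: asboolP => x01.
  by rewrite mem_set//; exists x.
by rewrite memNset// => -[y y01 /(can_inj (mulKmx uA)) yx]; apply: x01; rewrite -yx.
Qed.

Let lebesgue_colE (B : set 'cV[R]_n) : measurable B ->
  (lebesgue_col B = `|\det A|%:E * \int[lebcol]_x (\1_B (A *m x))%:E)%E.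
Proof.
move=> mB; rewrite (@linear_change _ _ _ uA (fun x => (\1_B x)%:E))//.
- by rewrite integral_indic// setIT.
- exact/measurable_EFinP.
Qed.

Lemma lebesgue_col_fundamental_domain :
  (lebesgue_col (fundamental_domain A) = (covolume A)%:E)%E.
Proof.
rewrite lebesgue_colE; last exact: measurable_fundamental_domain.
under eq_integral do rewrite indic_fundamental_domain.
by rewrite integral_unit_cube mule1.
Qed.

(** The Jacobian of the multiplication by [A] cancels the normalization by the covolume. *)
Lemma torus_measureE (B : set 'cV[R]_n) : measurable B ->
  (torus B = \int[lebcol]_x (\1_B (A *m x) * unit_cube x)%:E)%E.
Proof.
move=> mB; have mO := measurable_fundamental_domain uA.
rewrite /torus_measure /= /mnormalize /= /mrestr setTI lebesgue_col_fundamental_domain.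
(* The total mass is a nonzero real number, which rules out the default Dirac branch of
   [mnormalize]. *)
rewrite eqe /covolume normr_eq0 (negbTE dA)/=.
rewrite lebesgue_colE; last exact: measurableI.
rewrite muleC muleA -EFinM mulVf ?normr_eq0// mul1e.
by apply: eq_integral => x _; rewrite indicI/= indic_fundamental_domain.
Qed.

Lemma ge0_integral_torus (f : 'cV[R]_n -> \bar R) :
  measurable_fun setT f -> (forall x, 0 <= f x)%E ->
  (\int[torus]_x f x = \int[lebcol]_x (f (A *m x) * (unit_cube x)%:E))%E.
Proof.
move=> mf f0; apply: ge0_integral_density => //.
- exact: measurable_fun_colM.
- exact: measurable_unit_cube.
- exact: unit_cube_ge0.
- exact: torus_measureE.
Qed.

Lemma integral_torus_cst (c : \bar R) : (\int[torus]_x c = c)%E.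
Proof.
rewrite integral_cst// [X in (_ * X)%E](_ : _ = 1%E) ?mule1//.
exact: (@probability_setT _ _ _ torus).
Qed.

Lemma measurable_fun_colB d (T : measurableType d) (f g : T -> 'cV[R]_n) :
  measurable_fun setT f -> measurable_fun setT g ->
  measurable_fun setT (fun x => f x - g x).
Proof.
move=> mf mg; apply: measurable_fun_col => i.
rewrite (_ : (fun x => _) = fun x => f x i 0 - g x i 0); last first.
  by apply/funext => x; rewrite !mxE.
by apply: measurable_funB;
  [apply: (measurableT_comp (measurable_coord i) mf)|
   apply: (measurableT_comp (measurable_coord i) mg)].
Qed.

(** For fixed [y], unfolding the lattice sum replaces the fundamental cell by R^d, where the shift
    by [- y] is invisible; the integral over [y] is then that of a constant. *)
Lemma integral_torus_periodization (f : 'cV[R]_n -> \bar R) :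
  measurable_fun setT f -> (forall x, 0 <= f x)%E ->
  (\int[torus]_x \int[torus]_y (\esum_(v in lattice A) f (x - y + v)%R) =
   ((covolume A)^-1)%:E * \int[lebcol]_x f x)%E.
Proof.
move=> mf f0.
pose F (p : 'cV[R]_n * 'cV[R]_n) :=
  (\esum_(z in [set: 'cV[int]_n]) f (p.1 - p.2 + A *m int_col z)%R)%E.
have mF : measurable_fun setT F.
  have H := @measurable_esum R 'cV[int]_n _ ('cV[R]_n * 'cV[R]_n)%type
    (fun z p => f (p.1 - p.2 + A *m int_col z)%R).
  apply: H => // z.
  apply: (measurableT_comp mf).
  apply: (measurableT_comp (measurable_fun_colD _)); exact: measurable_fun_colB.
have F0 p : (0 <= F p)%E by apply: esum_ge0.
transitivity (\int[torus]_x \int[torus]_y F (x, y))%E.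
  apply: eq_integral => x _; apply: eq_integral => y _.
  by rewrite esum_lattice.
rewrite (fubini_tonelli _ mF F0).
transitivity (\int[torus]_y (((covolume A)^-1)%:E * \int[lebcol]_x f x))%E; last first.
  exact: integral_torus_cst.
apply: eq_integral => y _.
rewrite ge0_integral_torus//; last first.
  by apply: (measurableT_comp mF); exact: measurable_fun_pair.
have mfy : measurable_fun setT (fun x : 'cV[R]_n => f (x - y)%R).
  by apply: (measurableT_comp mf); exact: (measurable_fun_colD (- y)%R).
transitivity (\int[lebcol]_x ((unit_cube x)%:E *
   \esum_(z in [set: 'cV[int]_n]) f (A *m (x + int_col z) - y)%R))%E.
  apply: eq_integral => x _; rewrite muleC; congr (_ * _)%E.
  by apply: eq_esum => z _ /=; rewrite mulmxDr addrAC.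
rewrite (@ge0_integral_unfold _ _ (fun x => f (A *m x - y)%R))//; last first.
  by apply: (measurableT_comp mfy); exact: measurable_fun_colM.
rewrite (ge0_integral_mulmx uA mfy)//; congr (_ * _)%E.
exact: (ge0_integral_translation (- y)%R).
Qed.

(** Orthogonality of characters: [x] is absorbed into the phase of the inner integral, whose
    frequency is an integer vector in lattice coordinates. *)
Lemma integral_torus_phase (w : 'cV[R]_n) (t : R) : dual_lattice A w ->
  (\int[torus]_x \int[torus]_y (1 + cos (t + 2 * pi * dotcv (x - y) w))%:E =
   (1 + cos t * (w == 0)%:R)%:E)%E.
Proof.
rewrite dual_latticeE// => -[z _ <-].
set w' := _ *m _.
have wE (y : 'cV[R]_n) : dotcv (A *m y) w' = dotcv y (int_col z).
  by rewrite dotcv_mulmx /w' mulmxA -trmx_mul mulVmx// trmx1 mul1mx.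
have w0 : (w' == 0) = (z == 0).
  apply/eqP/eqP => [|zE]; last by rewrite /w' zE /int_col raddf0 mulmx0.
  move=> /(congr1 (mulmx A^T)); rewrite mulmxA -trmx_mul mulVmx// trmx1 mul1mx mulmx0.
  by move=> zE; apply: (@int_col_inj R); rewrite /int_col zE raddf0.
transitivity (\int[torus]_x (1 + cos (t + 2 * pi * dotcv x w') * (w' == 0)%:R)%:E)%E.
  apply: eq_integral => x _.
  have mc : measurable_fun setT (fun y : 'cV[R]_n => (1 + cos (t + 2 * pi * dotcv (x - y) w'))%:E).
    apply/measurable_EFinP; apply: measurable_funD => //.
    under eq_fun do rewrite -dotcvZr dotcvDl dotcvNl -dotcvNr addrA.
    exact: measurable_cos_dotcv.
  rewrite (ge0_integral_torus mc) => [|y]; last first.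
    by rewrite lee_fin -lerBlDl sub0r cos_geN1.
  (* The frequency is [- z] because [y] enters through [x - y]. *)
  have := @integral_unit_cube_phase R n (- z) (t + 2 * pi * dotcv x w').
  rewrite oppr_eq0 -w0 => <-; apply: eq_integral => y _.
  rewrite -EFinM mulrC dotcvDl dotcvNl wE /int_col raddfN dotcvNr.
  congr (_ * (1 + cos _))%:E; ring.
have [->|_] := eqVneq w' 0.
  under eq_integral do rewrite dotcv0r mulr0 addr0.
  exact: integral_torus_cst.
under eq_integral do rewrite mulr0 addr0.
by rewrite integral_torus_cst mulr0 addr0.
Qed.

End torus.

(** * Incomplete Gamma integrals *)

Lemma is_derive_inv (R : realType) (x : R) : 0 < x ->
  is_derive x (1 : R) (fun t => t^-1) (- (x ^- 2)).
Proof.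
move=> x0; have x1 : x != 0 by rewrite gt_eqF.
apply: (is_derive_eq (@is_deriveV R id x 1 1 x1 (is_derive_id _ _))).
by rewrite /GRing.scale/= mulr1.
Qed.

Section gamma_kernel.
Context {R : realType}.
Local Notation leb := (@lebesgue_measure R).
Variables (b : R) (b0 : 0 < b).

Definition gamma_kernel (a t : R) : R := t `^ (- b - 1) * expR (- a / t).
Local Notation k := gamma_kernel.

Lemma gamma_kernel_ge0 a t : 0 <= k a t.
Proof. by rewrite mulr_ge0// ?powR_ge0// expR_ge0. Qed.

Lemma pos_derive_continuous (f df : R -> R) (c : R) : 0 < c ->
  (forall x : R, 0 < x -> is_derive x (1 : R) f (df x)) -> {for c, continuous f}.
Proof.
move=> c0 fdf; have cdf := fdf c c0.
by apply: differentiable_continuous; apply/derivable1_diffP.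
Qed.

Lemma pos_continuous_measurable (f : R -> R) (D : set (measurableTypeR R)) :
  (forall c : R, 0 < c -> {for c, continuous f}) -> D `<=` `]0, +oo[%classic ->
  measurable D -> measurable_fun D (EFin \o f).
Proof.
move=> cf D0 mD; apply/measurable_EFinP.
suff : measurable_fun (`]0%R, +oo[%classic : set (measurableTypeR R)) f.
  by apply: measurable_funS.
apply: open_continuous_measurable_fun => // x; rewrite inE/= in_itv/= andbT.
exact: cf.
Qed.

Lemma gamma_kernel_continuous a c : 0 < c -> {for c, continuous (k a)}.
Proof.
move=> c0; apply: (@pos_derive_continuous _ (fun t =>
  t `^ (- b - 1) * (expR (- a / t) * (a / t ^+ 2)) +
  expR (- a / t) * ((- b - 1) * t `^ (- b - 1 - 1)))) => // x x0.
have x1 : x != 0 by rewrite gt_eqF.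
have d1 := is_derive1_powR (- b - 1) x0.
have d2 : is_derive x (1 : R) (fun t => expR (- a / t)) (expR (- a / x) * (a / x ^+ 2)).
  have dV := is_derive_inv x0.
  by apply: is_derive_eq; rewrite /GRing.scale/=; field.
by apply: (is_derive_eq (is_deriveM d1 d2)).
Qed.

Lemma measurable_gamma_kernel a (D : set (measurableTypeR R)) :
  D `<=` `]0, +oo[%classic -> measurable D -> measurable_fun D (EFin \o k a).
Proof. by apply: pos_continuous_measurable => c; exact: gamma_kernel_continuous. Qed.

Lemma gamma_kernel_integral1y : (\int[leb]_(t in `[1%R, +oo[) (k 0 t)%:E = (b^-1)%:E)%E.
Proof.
pose F (x : R) := - b^-1 * x `^ (- b).
have dF (x : R) : 0 < x -> is_derive x (1 : R) F (x `^ (- b - 1)).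
  move=> x0; have d1 := is_derive1_powR (- b) x0.
  rewrite /F; apply: is_derive_eq; rewrite /GRing.scale/=; field.
  by rewrite gt_eqF.
have kE : k 0 = fun t => t `^ (- b - 1).
  by apply/funext => t; rewrite /k oppr0 mul0r expR0 mulr1.
rewrite kE (@ge0_continuous_FTC2y _ _ F _ 0).
- by rewrite /F powR1 mulr1 EFinN oppeK add0e.
- by move=> x _; rewrite powR_ge0.
- apply: continuous_in_subspaceT => x; rewrite inE/= in_itv/= andbT => x1.
  rewrite -kE; apply: gamma_kernel_continuous; exact: lt_le_trans x1.
- rewrite /F -(mulr0 (- b^-1)); apply: cvgMr.
  under eq_fun do rewrite powRN.
  apply/gtr0_cvgV0; first by near=> x; rewrite powR_gt0.
  apply/cvgryPge => M; near=> x.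
  (* Beyond the [b]-th root of [max M 1] the power [x ^ b] exceeds [M]; the maximum with 1 keeps the
     radicand nonnegative. *)
  rewrite (@le_trans _ _ ((Num.max M 1 `^ b^-1) `^ b))//.
    rewrite -powRrM mulVf ?gt_eqF// powRr1 ?le_max ?lexx//.
    by rewrite ler01 orbT.
  rewrite ge0_ler_powR ?nnegrE ?powR_ge0//; first exact: ltW.
- by move=> x x1; have := dF x (lt_trans ltr01 x1).
- apply: cvg_at_right_filter; exact: pos_derive_continuous ltr01 dF.
- move=> x; rewrite in_itv/= andbT => x1; have := dF x (lt_trans ltr01 x1) => dx.
  by rewrite derive1E derive_val.
Unshelve. all: by end_near. Qed.

(** The decreasing substitution [t |-> a / t] exchanges the kernel with Euler's integrand. It is
    carried out on compact intervals inside []0, +oo[], where all functions involved are smooth. *)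
Lemma gamma_kernel_itv (a x y : R) : 0 < a -> 0 < x -> x < y ->
  (\int[leb]_(t in `[(a / y)%R, (a / x)%R]) (t `^ (b - 1) * expR (- t))%:E =
   \int[leb]_(t in `[x, y]) (a `^ b * k a t)%:E)%E.
Proof.
move=> a0 x0 xy; pose F (t : R) := a / t.
have dF (t : R) : 0 < t -> is_derive t (1 : R) F (- (a / t ^+ 2)).
  move=> t0; have t1 : t != 0 by rewrite gt_eqF.
  have dV := is_derive_inv t0.
  by apply: is_derive_eq; rewrite /GRing.scale/=; field.
have F'E (t : R) : 0 < t -> derive1 F t = - (a / t ^+ 2).
  by move=> t0; have := dF t t0 => dt; rewrite derive1E derive_val.
have cF' (c : R) : 0 < c -> {for c, continuous (derive1 F)}.
  move=> c0; rewrite /prop_for /continuous_at F'E//.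
  have : - (a / t ^+ 2) @[t --> c] --> - (a / c ^+ 2).
    apply: cvgN; apply: cvgMr; apply: cvgV; first by rewrite expf_neq0// gt_eqF.
    exact: exprn_continuous.
  apply: cvg_trans; apply: near_eq_cvg; near=> t; rewrite F'E//.
  by near: t; exact: lt_nbhsr.
have cF (c : R) : 0 < c -> {for c, continuous F} by move=> c0; exact: pos_derive_continuous dF.
have y0 := lt_trans x0 xy.
rewrite -[a / y]/(F y) -[a / x]/(F x).
rewrite (@integration_by_substitution_decreasing _ F (fun t => t `^ (b - 1) * expR (- t)))//.
- apply: eq_integral => t; rewrite inE/= in_itv/= => /andP[xt ty].
  have t0 : 0 < t by exact: lt_le_trans xt.
  rewrite [X in (X%:E)%E](_ : _ = F t `^ (b - 1) * expR (- F t) * - derive1 F t)//.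
  congr EFin; rewrite F'E// opprK /F /k mulNr.
  rewrite -(mulr_powRB1 (ltW a0) b0) powRM ?invr_ge0 ?ltW// -(powR_inv1 (ltW t0)) -powRrM.
  have -> : - b - 1 = -1 * (b - 1) - 2%:R by ring.
  rewrite [t `^ (_ - 2%:R)]powRB; last by rewrite (gt_eqF t0) implybT.
  by rewrite powR_mulrn ?(ltW t0)// powR_inv1 ?(ltW t0)//; ring.
- exact: ltW.
- move=> u v; rewrite !in_itv/= => /andP[xu _] /andP[xv _] uv.
  by rewrite /F ltr_pM2l// ltf_pV2// posrE; [exact: lt_le_trans xu| exact: lt_le_trans xv].
- move=> u; rewrite in_itv/= => /andP[xu _]; apply: cF'; exact: lt_trans xu.
- by apply/cvg_ex; eexists; apply: cvg_at_right_filter; exact: cF'.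
- by apply/cvg_ex; eexists; apply: cvg_at_left_filter; exact: cF'.
- split.
  + move=> u; rewrite in_itv/= => /andP[xu _].
    by have := dF _ (lt_trans x0 xu).
  + by apply: cvg_at_right_filter; exact: cF.
  + by apply: cvg_at_left_filter; exact: cF.
- apply: continuous_in_subspaceT => u; rewrite inE/= in_itv/= => /andP[yu _].
  apply: (@pos_derive_continuous _ (fun t =>
    t `^ (b - 1) * - expR (- t) + expR (- t) * ((b - 1) * t `^ (b - 1 - 1)))).
    by apply: lt_le_trans yu; rewrite divr_gt0.
  move=> t t0; have d1 := is_derive1_powR (b - 1) t0.
  have d2 : is_derive t (1 : R) (fun t => expR (- t)) (- expR (- t)).
    by apply: is_derive_eq; rewrite /GRing.scale/=; ring.
  by apply: (is_derive_eq (is_deriveM d1 d2)).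
Unshelve. all: by end_near. Qed.

(** The map [t |-> a / t] carries [[1 / (n + 2), n + 2]] onto [[a / (n + 2), a * (n + 2)]], so both
    sides of the substitution are exhausted in step. Starting at 2 keeps the intervals
    nondegenerate. *)
Lemma bigcup_itv_ratio (a : R) : 0 < a ->
  \bigcup_n `[a / n.+2%:R, a * n.+2%:R]%classic = `]0, +oo[%classic.
Proof.
move=> a0; apply/seteqP; split => x /=.
  by move=> [n _ /=]; rewrite !in_itv/= andbT => /andP[+ _]; apply: lt_le_trans; rewrite divr_gt0.
rewrite in_itv/= andbT => x0.
pose M := Num.max (a / x) (x / a); exists (Num.truncn M) => //=.
have M0 : 0 <= M by rewrite le_max divr_ge0 ?(ltW a0) ?(ltW x0).
have : M <= (Num.truncn M).+2%:R.
  by rewrite (le_trans (ltW (truncnS_gt M)))// ler_nat.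
rewrite ge_max => /andP[]; rewrite !ler_pdivrMr// => h1 h2.
by rewrite in_itv/= ler_pdivrMr// mulrC h1/= mulrC.
Qed.

Lemma cvg_integral_itv_ratio (a : R) (f : R -> R) : 0 < a ->
  (forall t, 0 <= f t) -> (forall D : set (measurableTypeR R), D `<=` `]0, +oo[%classic ->
    measurable D -> measurable_fun D (EFin \o f)) ->
  (\int[leb]_(t in `[(a / n.+2%:R)%R, (a * n.+2%:R)%R]) (f t)%:E @[n --> \oo] -->
   \int[leb]_(t in `]0%R, +oo[) (f t)%:E)%E.
Proof.
move=> a0 f0 mf; rewrite -(bigcup_itv_ratio a0).
have H := @ge0_nondecreasing_set_cvg_integral _ (measurableTypeR R) R
  (fun n => `[(a / n.+2%:R)%R, (a * n.+2%:R)%R]%classic) (EFin \o f) leb.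
apply: H.
- move=> n m nm; apply/subsetPset => x /=; rewrite !in_itv/= => /andP[h1 h2].
  rewrite (le_trans _ h1) ?(le_trans h2)//.
    by rewrite ler_pM2l// ler_nat !ltnS.
  by rewrite ler_pM2l// lef_pV2 ?posrE// ler_nat !ltnS.
- by move=> n; exact: measurable_itv.
- move=> n; apply: mf => // x /=; rewrite !in_itv/= andbT => /andP[+ _].
  by apply: lt_le_trans; rewrite divr_gt0.
- by move=> n x _; rewrite lee_fin.
Qed.

Lemma gamma_kernel_integral (a : R) : 0 < a ->
  ((a `^ b)%:E * \int[leb]_(t in `]0%R, +oo[) (k a t)%:E =
   \int[leb]_(t in `]0%R, +oo[) (t `^ (b - 1) * expR (- t))%:E)%E.
Proof.
move=> a0; rewrite -ge0_integralZl//; last 3 first.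
- by apply: measurable_gamma_kernel => //; exact: measurable_itv.
- by move=> t _; rewrite lee_fin gamma_kernel_ge0.
- by rewrite lee_fin powR_ge0.
have g0 t : 0 <= t `^ (b - 1) * expR (- t) by rewrite mulr_ge0 ?powR_ge0 ?expR_ge0.
have mg (D : set (measurableTypeR R)) : D `<=` `]0, +oo[%classic -> measurable D ->
    measurable_fun D (EFin \o (fun t => t `^ (b - 1) * expR (- t))).
  move=> _ _; apply/measurable_EFinP; apply: measurable_funTS; apply: measurable_funM => //.
  by apply: (measurableT_comp (@measurable_expR R)); exact: measurable_funN.
have k0 t : 0 <= a `^ b * k a t by rewrite mulr_ge0 ?powR_ge0 ?gamma_kernel_ge0.
have mk (D : set (measurableTypeR R)) : D `<=` `]0, +oo[%classic -> measurable D ->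
    measurable_fun D (EFin \o (fun t => a `^ b * k a t)).
  move=> D0 mD; apply/measurable_EFinP; apply: measurable_funM => //.
  by apply/measurable_EFinP; exact: measurable_gamma_kernel.
under eq_integral do rewrite -EFinM.
have c1 := cvg_integral_itv_ratio ltr01 k0 mk.
have c2 := cvg_integral_itv_ratio a0 g0 mg.
apply: (cvg_unique _ c1) => //; apply: cvg_trans c2; apply: near_eq_cvg.
apply: nearW => n; rewrite div1r mul1r.
rewrite -gamma_kernel_itv//; first by rewrite invrK.
by rewrite (@lt_trans _ _ 1)// ?invf_lt1 ?ltr1n.
Qed.

(** Half of the exponent is spent on [exp (- a / 2)], using [1 / t >= 1]. This is the source of the
    Gaussian decay of the dual coefficients. *)
Lemma gamma_kernel_shift a t : 0 <= a -> 0 < t <= 1 ->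
  k a t <= expR (- (a / 2)) * k (a / 2) t.
Proof.
move=> a0 /andP[t0 t1]; rewrite /k mulrCA ler_wpM2l ?powR_ge0// -expRD ler_expR.
have : 1 <= t^-1 by rewrite invf_ge1.
rewrite !mulNr; nra.
Qed.

(** Near 0 the exponential beats the power: [exp y >= y^m / m!] with [y = a / t] and [m > b + 1]
    bounds the kernel on []0, 1]] by [m! / a^m]. *)
Lemma gamma_kernel_integral01_lty a : 0 < a ->
  (\int[leb]_(t in `]0%R, 1%R]) (k a t)%:E < +oo)%E.
Proof.
move=> a0; pose m := (Num.truncn (b + 1)).+1.
pose M := m`!%:R / a ^+ m.
apply: (@le_lt_trans _ _ (\int[leb]_(t in `]0%R, 1%R]) M%:E)%E).
  apply: ge0_le_integral => //.
  - by move=> t _; rewrite lee_fin gamma_kernel_ge0.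
  - apply: measurable_gamma_kernel; last exact: measurable_itv.
    by move=> x /=; rewrite !in_itv/= andbT => /andP[].
  - move=> t /=; rewrite in_itv/= lee_fin => /andP[t0 t1].
    have at0 : 0 < a / t by rewrite divr_gt0.
    have h : (a / t) ^+ m <= m`!%:R * expR (a / t).
      have := @expR_ge1Dxn _ (a / t) m.-1 (ltW at0); rewrite prednK//.
      have f0 : 0 < m`!%:R :> R by rewrite ltr0n fact_gt0.
      move=> h; rewrite [_%:R * _]mulrC -ler_pdivrMr//; apply: le_trans h; lra.
    have e0 : expR (- a / t) <= M * t ^+ m.
      rewrite mulNr expRN -[leLHS]mul1r ler_pdivrMr ?expR_gt0//.
      move: h; rewrite expr_div_n ler_pdivrMr ?exprn_gt0// => h.
      rewrite (_ : M * _ * _ = m`!%:R * expR (a / t) * t ^+ m / a ^+ m); last first.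
        by rewrite /M; ring.
      by rewrite ler_pdivlMr ?exprn_gt0// mul1r.
    have bm : 0 <= - b - 1 + m%:R.
      have := truncnS_gt (b + 1); rewrite -/m; lra.
    rewrite (le_trans (ler_wpM2l (powR_ge0 _ _) e0))// mulrCA.
    rewrite -powR_mulrn ?(ltW t0)// -powRD; last by rewrite (gt_eqF t0) implybT.
    rewrite ler_piMr ?divr_ge0 ?exprn_ge0 ?(ltW a0)//.
    have := @ge0_ler_powR R _ bm t 1; rewrite powR1; apply => //.
    - by rewrite nnegrE ltW.
    - by rewrite nnegrE.
by rewrite integral_cst//= lebesgue_measure_itv/= lte01 oppr0 adde0 mule1 ltry.
Qed.


End gamma_kernel.

(** * Complete integral of the kernel and its tail *)

Section gamma_tail.
Context {R : realType}.
Local Notation leb := (@lebesgue_measure R).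
Variables (b : R) (b0 : 0 < b).
Local Notation k := (gamma_kernel b).

Lemma gamma_kernel_anti a a' t : 0 < t -> a <= a' -> k a' t <= k a t.
Proof.
by move=> t0 aa'; rewrite ler_wpM2l ?powR_ge0// ler_expR ler_pM2r ?invr_gt0// lerN2.
Qed.

Let sub1y : `[1%R, +oo[%classic `<=` (`]0%R, +oo[%classic : set (measurableTypeR R)).
Proof. by move=> t /=; rewrite !in_itv/= !andbT; apply: lt_le_trans. Qed.

Lemma gamma_kernel_integral1y_lty a : 0 <= a ->
  (\int[leb]_(t in `[1%R, +oo[) (k a t)%:E < +oo)%E.
Proof.
move=> a0; apply: (@le_lt_trans _ _ (\int[leb]_(t in `[1%R, +oo[) (k 0 t)%:E)%E).
  apply: ge0_le_integral => //.
  - by move=> t _; rewrite lee_fin gamma_kernel_ge0.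
  - by apply: measurable_gamma_kernel => //; exact: measurable_itv.
  - by apply: measurable_gamma_kernel => //; exact: measurable_itv.
  - move=> t /sub1y/=; rewrite in_itv/= andbT => t0.
    by rewrite lee_fin gamma_kernel_anti.
by rewrite gamma_kernel_integral1y// ltry.
Qed.

Lemma gamma_kernel_Gamma a : 0 < a ->
  \int[leb]_(t in `]0, 1]) k a t + \int[leb]_(t in `[1, +oo[) k a t = a `^ (- b) * Gamma b.
Proof.
move=> a0.
have i01 := gamma_kernel_integral01_lty b a0.
have i1y := gamma_kernel_integral1y_lty (ltW a0).
have g01 : (0 <= \int[leb]_(t in `]0%R, 1%R]) (k a t)%:E)%E.
  by apply: integral_ge0 => t _; rewrite lee_fin gamma_kernel_ge0.
have g1y : (0 <= \int[leb]_(t in `[1%R, +oo[) (k a t)%:E)%E.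
  by apply: integral_ge0 => t _; rewrite lee_fin gamma_kernel_ge0.
rewrite /Rintegral -fineD ?ge0_fin_numE//.
have E : (\int[leb]_(t in `]0%R, +oo[) (k a t)%:E = \int[leb]_(t in `]0%R, 1%R]) (k a t)%:E +
    \int[leb]_(t in `[1%R, +oo[) (k a t)%:E)%E.
  rewrite -[X in (_ + X)%E]integral_itv_obnd_cbnd; last first.
    apply: measurable_gamma_kernel; last exact: measurable_itv.
    by move=> t /=; rewrite !in_itv/= !andbT; apply: lt_trans.
  rewrite -ge0_integral_setU//=.
  - congr (integral _ _ _); apply/seteqP; split => t /=; rewrite !in_itv/= ?andbT.
      by case: (leP t 1) => t1 t0; [left; rewrite t0|right].
    by case=> [/andP[]//|]; apply: lt_trans.
  - rewrite (_ : _ `|` _ = `]0%R, +oo[%classic); last first.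
      apply/seteqP; split => t /=; rewrite !in_itv/= ?andbT.
        by case=> [/andP[]//|]; apply: lt_trans.
      by case: (leP t 1) => t1 t0; [left; rewrite t0|right].
    by apply: measurable_gamma_kernel => //; exact: measurable_itv.
  - by move=> t _; rewrite lee_fin gamma_kernel_ge0.
  - apply/disj_setPS => t /=; rewrite !in_itv/= andbT => -[/andP[_ t1]].
    by rewrite ltNge t1.
rewrite /Gamma /Rintegral -(gamma_kernel_integral b0 a0) fineM//; last first.
  by rewrite E fin_numD !ge0_fin_numE// i01.
by rewrite -E /= mulrA powRN mulVf ?mul1r// gt_eqF// powR_gt0.
Qed.

(** The tail of [k a] is its complete integral minus the part over []0, 1]], and [k 0] has tail
    [1 / b]. The part over []0, 1]] is left in the formula because the dual sum will cancel it. *)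
Lemma gamma_kernel_tail a : 0 < a ->
  (\int[leb]_(t in `[1%R, +oo[) (k 0 t - k a t)%:E =
   (b^-1 - a `^ (- b) * Gamma b + \int[leb]_(t in `]0%R, 1%R]) k a t)%:E)%E.
Proof.
move=> a0; rewrite -gamma_kernel_Gamma// opprD addrA addrAC addrNK.
have i1y := gamma_kernel_integral1y_lty (ltW a0).
have g1y : (0 <= \int[leb]_(t in `[1%R, +oo[) (k a t)%:E)%E.
  by apply: integral_ge0 => t _; rewrite lee_fin gamma_kernel_ge0.
suff E : ((\int[leb]_(t in `[1%R, +oo[) (k 0 t - k a t)%:E) +
    \int[leb]_(t in `[1%R, +oo[) (k a t)%:E = (b^-1)%:E)%E.
  rewrite EFinB -E /Rintegral fineK ?ge0_fin_numE// addeK// ge0_fin_numE//.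
have km : 0 <= a by exact: ltW.
rewrite -ge0_integralD//.
- by rewrite -gamma_kernel_integral1y//; apply: eq_integral => t _; rewrite -EFinD subrK.
- move=> t /sub1y/=; rewrite in_itv/= andbT => t0.
  by rewrite lee_fin subr_ge0 gamma_kernel_anti.
- apply/measurable_EFinP; apply: measurable_funB; apply/measurable_EFinP;
  by apply: measurable_gamma_kernel => //; exact: measurable_itv.
- by move=> t _; rewrite lee_fin gamma_kernel_ge0.
- by apply: measurable_gamma_kernel => //; exact: measurable_itv.
Qed.

End gamma_tail.

Lemma dotcv_gt0 (R : realType) n (x : 'cV[R]_n) : x != 0 -> 0 < dotcv x x.
Proof.
move=> /matrix0Pn[i [j xij]]; rewrite /dotcv (bigD1 i)//= ltr_pwDl//.
  by rewrite -(ord1 j) -expr2 lt0r sqrf_eq0 xij sqr_ge0.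
by apply: sumr_ge0 => k _; rewrite -expr2 sqr_ge0.
Qed.

(** * The direct sum *)

Section riesz_direct.
Context {R : realType} {d : nat} (A : 'M[R]_d) (uA : A \in unitmx) (s : R).
Hypotheses (s0 : 0 < s) (sd : s < d%:R).
Local Notation leb := (@lebesgue_measure R).
Local Notation torus := (torus_measure uA).
Local Notation b := ((d%:R - s) / 2).

Let b0 : 0 < b. Proof. by rewrite divr_gt0// subr_gt0. Qed.

Definition riesz_cst : R := pi `^ (d%:R / 2) / Gamma (s / 2).

Lemma Gamma_ge0 (a : R) : 0 <= Gamma a.
Proof. by apply: Rintegral_ge0 => t _; rewrite mulr_ge0 ?powR_ge0 ?expR_ge0. Qed.

Lemma riesz_cst_ge0 : 0 <= riesz_cst.
Proof. by rewrite divr_ge0 ?powR_ge0 ?Gamma_ge0. Qed.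

Lemma riesz_kernelE (a t : R) : 0 < t ->
  pi `^ (d%:R / 2) / t `^ (d%:R / 2) * expR (- a / t) * (t `^ (s / 2 - 1) / Gamma (s / 2)) =
  riesz_cst * gamma_kernel b a t.
Proof.
move=> t0; rewrite /riesz_cst /gamma_kernel.
have -> : - b - 1 = (s / 2 - 1) - d%:R / 2 by field.
rewrite [t `^ (_ - d%:R / 2)]powRB; last by rewrite (gt_eqF t0) implybT.
ring.
Qed.

(** The restriction to [t >= 1] is carried by an indicator, so that the weight lives on the full
    product of R^d and the line and Tonelli's theorem applies. *)
Definition riesz_weight (r t : R) : R :=
  expR (- r * t) * (t `^ (s / 2 - 1) / Gamma (s / 2)) * \1_`[1%R, +oo[%classic t.

Definition riesz_gauss (x : 'cV[R]_d) : \bar R :=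
  (\int[leb]_(t in `[1%R, +oo[) (expR (- norm2 x ^+ 2 * t) *
        (t `^ (s / 2 - 1) / Gamma (s / 2)))%:E)%E.

Lemma riesz_gaussE x :
  riesz_gauss x = (\int[leb]_t (riesz_weight (dotcv x x) t)%:E)%E.
Proof.
rewrite /riesz_gauss integral_mkcond; apply: eq_integral => t _.
by rewrite patchE /riesz_weight indicE sqr_norm2; case: ifPn; rewrite ?mulr1 ?mulr0.
Qed.

Lemma riesz_weight_ge0 r t : 0 <= riesz_weight r t.
Proof. by rewrite !mulr_ge0 ?expR_ge0 ?powR_ge0 ?invr_ge0 ?Gamma_ge0// indicE. Qed.

Lemma measurable_riesz_weight : measurable_fun setT
  (fun p : 'cV[R]_d * measurableTypeR R => riesz_weight (dotcv p.1 p.1) p.2).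
Proof.
have mp2 : measurable_fun setT (snd : 'cV[R]_d * measurableTypeR R -> measurableTypeR R).
  exact: measurable_snd.
have md : measurable_fun setT (fun p : 'cV[R]_d * measurableTypeR R => dotcv p.1 p.1).
  apply: measurable_sum => i; apply: measurable_funM;
  exact: (measurableT_comp (measurable_coord i) measurable_fst).
apply: measurable_funM; last first.
  have mI : measurable_fun [set: measurableTypeR R] (\1_`[1%R, +oo[%classic : _ -> R).
    exact: measurable_indic.
  exact: (measurableT_comp mI mp2).
apply: measurable_funM.
  apply: (measurableT_comp (@measurable_expR R)); apply: measurable_funM => //.
  exact: measurable_funN.
apply: measurable_funM => //.
exact: (measurableT_comp (measurable_powR (s / 2 - 1)) mp2).
Qed.

Lemma measurable_riesz_gauss : measurable_fun setT riesz_gauss.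
Proof.
rewrite (_ : riesz_gauss = fun x => (\int[leb]_t (riesz_weight (dotcv x x) t)%:E)%E).
  have H := @measurable_fun_fubini_tonelli_F _ _ _ _ R leb
    (fun p : 'cV[R]_d * measurableTypeR R => (riesz_weight (dotcv p.1 p.1) p.2)%:E).
  apply: H => [|p]; first by apply/measurable_EFinP; exact: measurable_riesz_weight.
  by rewrite lee_fin riesz_weight_ge0.
by apply/funext => x; rewrite riesz_gaussE.
Qed.

Lemma riesz_gauss_ge0 x : (0 <= riesz_gauss x)%E.
Proof.
by rewrite riesz_gaussE; apply: integral_ge0 => t _; rewrite lee_fin riesz_weight_ge0.
Qed.

Lemma riesz_directE x :
  riesz_direct A s x = (\esum_(v in lattice A) riesz_gauss (x + v))%E.
Proof. by []. Qed.

Lemma measurable_riesz_direct : measurable_fun setT (riesz_direct A s).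
Proof.
rewrite (_ : riesz_direct A s = (fun x => \esum_(z in [set: 'cV[int]_d])
    riesz_gauss (x + A *m int_col z))%E); last first.
  by apply/funext => x; rewrite riesz_directE esum_lattice.
have H := @measurable_esum R 'cV[int]_d _ 'cV[R]_d (fun z x => riesz_gauss (x + A *m int_col z)).
apply: H => [z|z x]; last exact: riesz_gauss_ge0.
exact: (measurableT_comp measurable_riesz_gauss (measurable_fun_colD _)).
Qed.

Lemma riesz_direct_ge0 x : (0 <= riesz_direct A s x)%E.
Proof. by apply: esum_ge0 => v _; exact: riesz_gauss_ge0. Qed.

Definition cos_char (q x : 'cV[R]_d) : R := cos (2 * pi * dotcv x q).

Lemma measurable_cos_char q : measurable_fun setT (cos_char q).
Proof.
rewrite (_ : cos_char q = fun x => cos (0 + dotcv x ((2 * pi) *: q))).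
  exact: measurable_cos_dotcv.
by apply/funext => x; rewrite add0r dotcvZr.
Qed.

Lemma cos_char_periodic q x v : dual_lattice A q -> lattice A v ->
  cos_char q (x + v) = cos_char q x.
Proof.
move=> dq /dq; rewrite dotcvC => /intrP[m vm].
by rewrite /cos_char dotcvDl vm mulrDr periodic2piz//; exact: cosD2pi.
Qed.

Lemma subr_cos_ge0 (t : R) : 0 <= 1 - cos t.
Proof. by rewrite subr_ge0 cos_le1. Qed.

Lemma sqrt_exp_powR (t : R) : 0 < t ->
  Num.sqrt (pi / t) ^+ d = pi `^ (d%:R / 2) / t `^ (d%:R / 2).
Proof.
move=> t0; have pit : 0 <= pi / t by rewrite divr_ge0 ?pi_ge0 ?(ltW t0).
rewrite -powR12_sqrt// -powR_mulrn ?powR_ge0// -powRrM [2^-1 * _]mulrC.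
rewrite powRM ?pi_ge0 ?invr_ge0 ?(ltW t0)//; congr (_ * _).
by rewrite -(powR_inv1 (ltW t0)) -powRrM mulN1r powRN.
Qed.

(** [1 - cos_char q] is invariant under the lattice, so it can enter the lattice sum before the
    average is unfolded. For fixed [t] the integral over R^d is then a Gaussian one. *)
Lemma integral_riesz_direct (q : 'cV[R]_d) : dual_lattice A q -> q != 0 ->
  (\int[torus]_x \int[torus]_y (riesz_direct A s (x - y) * (1 - cos_char q (x - y))%:E) =
   ((covolume A)^-1 * (riesz_cst * (b^-1 - (pi ^+ 2 * norm2 q ^+ 2) `^ (- b) * Gamma b +
     \int[leb]_(t in `]0%R, 1%R]) gamma_kernel b (pi ^+ 2 * norm2 q ^+ 2) t)))%:E)%E.
Proof.
move=> dq q0.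
pose a := pi ^+ 2 * norm2 q ^+ 2.
have a0 : 0 < a by rewrite /a sqr_norm2 mulr_gt0 ?exprn_gt0 ?pi_gt0 ?dotcv_gt0.
have sub1y : `[1%R, +oo[%classic `<=` (`]0%R, +oo[%classic : set (measurableTypeR R)).
  by move=> t /=; rewrite !in_itv/= !andbT; apply: lt_le_trans.
pose f x := (riesz_gauss x * (1 - cos_char q x)%:E)%E.
have mc : measurable_fun setT (fun x => 1 - cos_char q x).
  by apply: measurable_funB => //; exact: measurable_cos_char.
have mf : measurable_fun setT f.
  apply: emeasurable_funM; first exact: measurable_riesz_gauss.
  exact/measurable_EFinP.
have f0 x : (0 <= f x)%E by rewrite mule_ge0 ?riesz_gauss_ge0// lee_fin subr_cos_ge0.
transitivity (\int[torus]_x \int[torus]_y \esum_(v in lattice A) f (x - y + v)%R)%E.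
  apply: eq_integral => x _; apply: eq_integral => y _.
  rewrite riesz_directE !esum_lattice// muleC -ge0_esumZl ?subr_cos_ge0//; last first.
    by move=> z; exact: riesz_gauss_ge0.
  apply: eq_esum => z _; rewrite muleC /f.
  by rewrite (@cos_char_periodic _ (x - y) (A *m int_col z))//; exists z.
rewrite integral_torus_periodization//; rewrite [RHS]EFinM; congr (_ * _)%E.
transitivity (\int[lebcol]_x \int[leb]_t
    (riesz_weight (dotcv x x) t * (1 - cos_char q x))%:E)%E.
  apply: eq_integral => x _; rewrite /f riesz_gaussE muleC -ge0_integralZl//.
  - by apply: eq_integral => t _; rewrite -EFinM mulrC.
  - by apply/measurable_EFinP; exact: (measurable_fun_pair2 x measurable_riesz_weight).
  - by move=> t _; rewrite lee_fin riesz_weight_ge0.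
  - by rewrite lee_fin subr_cos_ge0.
pose F (p : 'cV[R]_d * measurableTypeR R) :=
  (riesz_weight (dotcv p.1 p.1) p.2 * (1 - cos_char q p.1))%:E.
have mF : measurable_fun setT F.
  apply/measurable_EFinP; apply: measurable_funM; first exact: measurable_riesz_weight.
  exact: (measurableT_comp mc measurable_fst).
have F0 p : (0 <= F p)%E by rewrite lee_fin mulr_ge0 ?riesz_weight_ge0 ?subr_cos_ge0.
rewrite (fubini_tonelli (m1 := @lebesgue_col R d) (m2 := leb) _ mF F0).
transitivity (\int[leb]_(t in `[1%R, +oo[)
   (riesz_cst%:E * (gamma_kernel b 0 t - gamma_kernel b a t)%:E))%E; last first.
  rewrite ge0_integralZl//; last 3 first.
  - apply/measurable_EFinP; apply: measurable_funB; apply/measurable_EFinP;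
    by apply: measurable_gamma_kernel => //; exact: measurable_itv.
  - move=> t /sub1y/=; rewrite in_itv/= andbT => t0.
    by rewrite lee_fin subr_ge0 gamma_kernel_anti// ltW.
  - by rewrite lee_fin riesz_cst_ge0.
  by rewrite gamma_kernel_tail// -EFinM.
rewrite [RHS]integral_mkcond; apply: eq_integral => t _; rewrite patchE; case: ifPn => [|t1].
  rewrite inE/= in_itv/= andbT => t1; have t0 : 0 < t by exact: lt_le_trans t1.
  (* [1 - cos] is written as [1 + cos (pi + _)], the form treated by
     [integral_gauss_dotcv_phase]. *)
  transitivity (\int[lebcol]_(x in [set: 'cV[R]_d])
     ((t `^ (s / 2 - 1) / Gamma (s / 2))%:E *
      (expR (- (t * dotcv x x)) * (1 + cos (pi + dotcv x ((2 * pi) *: q))))%:E))%E.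
    apply: eq_integral => x _; rewrite /F /riesz_weight /= indicE mem_set/= ?in_itv/= ?t1//.
    rewrite mulr1 -EFinM [pi + _]addrC cosDpi dotcvZr -/(cos_char q x).
    rewrite [t * _]mulrC mulNr; congr EFin; ring.
  rewrite ge0_integralZl//; last 2 first.
  - apply/measurable_EFinP; apply: measurable_funM; first exact: measurable_gauss_dotcv.
    by apply: measurable_funD => //; exact: measurable_cos_dotcv.
  - by rewrite lee_fin divr_ge0 ?powR_ge0 ?Gamma_ge0.
  rewrite integral_gauss_dotcv_phase// -!EFinM; congr EFin.
  rewrite sqrt_exp_powR// cospi.
  (* The squared frequency [4 pi^2 |q|^2] over [4 t] is [a / t], whence the choice of [a]. *)
  have -> : - dotcv ((2 * pi) *: q) ((2 * pi) *: q) / (4 * t) = - a / t.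
    rewrite dotcvZr dotcvC dotcvZr /a sqr_norm2; field; exact: lt0r_neq0.
  rewrite mulrBr -!riesz_kernelE// oppr0 mul0r expR0; ring.
transitivity (\int[lebcol]_(x in [set: 'cV[R]_d]) (0 : \bar R))%E; last exact: integral0.
apply: eq_integral => x _; rewrite /F /riesz_weight /= indicE memNset ?mulr0 ?mul0r//.
by move: t1; rewrite notin_setE.
Qed.

End riesz_direct.

(** * Averages over the torus of functions of a difference *)

Section torus_average.
Context {R : realType} {n : nat} (A : 'M[R]_n) (uA : A \in unitmx).
Local Notation torus := (torus_measure uA).
Local Open Scope ereal_scope.

(** An integral over the product measure rather than an iterated one, so that linearity and
    countable sums take a single application of each integration rule. *)
Definition torus_avg (f : 'cV[R]_n -> \bar R) : \bar R :=
  \int[(torus \x torus)]_p f (p.1 - p.2)%R.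

Lemma measurable_diff (f : 'cV[R]_n -> \bar R) : measurable_fun setT f ->
  measurable_fun setT (fun p : 'cV[R]_n * 'cV[R]_n => f (p.1 - p.2)%R).
Proof.
by move=> mf; apply: (measurableT_comp mf); exact: measurable_fun_colB.
Qed.

Lemma torus_avgE (f : 'cV[R]_n -> \bar R) :
  measurable_fun setT f -> (forall x, 0 <= f x) ->
  torus_avg f = \int[torus]_x \int[torus]_y f (x - y)%R.
Proof.
by move=> mf f0; rewrite /torus_avg (fubini_tonelli1 _ (measurable_diff mf)).
Qed.

Lemma torus_avgD (f g : 'cV[R]_n -> \bar R) :
  measurable_fun setT f -> (forall x, 0 <= f x) ->
  measurable_fun setT g -> (forall x, 0 <= g x) ->
  torus_avg (fun x => f x + g x) = torus_avg f + torus_avg g.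
Proof.
move=> mf f0 mg g0; rewrite /torus_avg ge0_integralD//; exact: measurable_diff.
Qed.

Lemma torus_avgZl (k : R) (f : 'cV[R]_n -> \bar R) : (0 <= k)%R ->
  measurable_fun setT f -> (forall x, 0 <= f x) ->
  torus_avg (fun x => k%:E * f x) = k%:E * torus_avg f.
Proof.
move=> k0 mf f0; rewrite /torus_avg ge0_integralZl//; exact: measurable_diff.
Qed.

Lemma torus_avg_esum (I : countType) (f : I -> 'cV[R]_n -> \bar R) :
  (forall i, measurable_fun setT (f i)) -> (forall i x, 0 <= f i x) ->
  torus_avg (fun x => \esum_(i in [set: I]) f i x) = \esum_(i in [set: I]) torus_avg (f i).
Proof.
move=> mf f0; rewrite /torus_avg.
by rewrite (@ge0_integral_esum R I _ _ _
  (fun i (p : 'cV[R]_n * 'cV[R]_n) => f i (p.1 - p.2)%R))// => i;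
  exact: measurable_diff.
Qed.

Lemma torus_avg_cst (k : R) : (0 <= k)%R -> torus_avg (fun=> k%:E) = k%:E.
Proof.
move=> k0; rewrite torus_avgE//.
under eq_integral do rewrite integral_torus_cst.
exact: integral_torus_cst.
Qed.

End torus_average.

(** * The dual sum *)

Section dual_lattice.
Context {R : realType} {d : nat} (A : 'M[R]_d) (uA : A \in unitmx).

Local Notation B := (invmx A)^T.

Let uB : B \in unitmx. Proof. by rewrite unitmx_tr unitmx_inv. Qed.

Lemma dual_latticeD w w' : dual_lattice A w -> dual_lattice A w' -> dual_lattice A (w + w').
Proof. by move=> dw dw' l Al; rewrite dotcvDl rpredD ?dw ?dw'. Qed.

Lemma dual_latticeN w : dual_lattice A w -> dual_lattice A (- w).
Proof. by move=> dw l Al; rewrite dotcvNl rpredN dw. Qed.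

Lemma esum_dual_lattice (f : 'cV[R]_d -> \bar R) :
  (\esum_(w in dual_lattice A `\ 0%R) f w =
   \esum_(z in [set: 'cV[int]_d]) if z == 0%R then 0%E else f (B *m int_col z))%E.
Proof.
rewrite setDE esum_mkcondr dual_latticeE// esum_lattice//; apply: eq_esum => z _.
have [->|z0] := eqVneq z 0.
  by rewrite /int_col raddf0 mulmx0 memNset//; exact.
rewrite mem_set// => zE; move/eqP: z0; apply; apply: (@int_col_inj R).
by apply: (can_inj (mulKmx uB)); rewrite zE /int_col raddf0 mulmx0.
Qed.

Lemma dotcv_mulmx_le (M : 'M[R]_d) (x : 'cV[R]_d) :
  dotcv (M *m x) (M *m x) <= (\sum_i (\sum_j `|M i j|) ^+ 2) * dotcv x x.
Proof.
rewrite -[dotcv x x]sqr_norm2 mulr_suml; apply: ler_sum => i _.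
rewrite -expr2 -(real_normK (num_real _)) -exprMn.
have n0 : 0 <= norm2 x by exact: sqrtr_ge0.
rewrite lerXn2r ?nnegrE ?normr_ge0 ?mulr_ge0 ?sumr_ge0// mxE (le_trans (ler_norm_sum _ _ _))//.
rewrite mulr_suml; apply: ler_sum => j _; rewrite normrM ler_wpM2l//.
rewrite -(@ler_pXn2r _ 2) ?nnegrE// real_normK ?num_real// sqr_norm2 /dotcv (bigD1 j)//=.
by rewrite -expr2 lerDl sumr_ge0// => l _; rewrite -expr2 sqr_ge0.
Qed.

(** [A^T] sends dual vectors to integer vectors, whose squared norm is at least 1 when they are
    nonzero, and it multiplies squared norms by at most [C]. *)
Lemma dual_lattice_discrete :
  exists2 e : R, 0 < e & forall w, dual_lattice A w -> w != 0 -> e <= dotcv w w.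
Proof.
pose C := \sum_i (\sum_j `|A^T i j|) ^+ 2.
have C0 : 0 <= C by apply: sumr_ge0 => i _; exact: sqr_ge0.
(* [C + 1] rather than [C], to be positive without further argument. *)
exists (C + 1)^-1 => [|w]; first by rewrite invr_gt0; lra.
rewrite dual_latticeE// => -[z _ wE] w0.
have AwE : A^T *m w = int_col z by rewrite -wE mulmxA -trmx_mul mulVmx// trmx1 mul1mx.
have z0 : int_col z != 0 :> 'cV[R]_d.
  by apply: contra_neq w0 => zE; rewrite -wE -/(int_col z) zE mulmx0.
have := dotcv_mulmx_le A^T w; rewrite AwE -/C => h.
have h1 : 1 <= dotcv (int_col z) (int_col z) :> R.
  have := dotcv_gt0 z0; have /intrP[m ->] := @dotcv_int R _ z z.
  by rewrite ltr0z ler1z -gtz0_ge1.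
have w1 := dotcv_ge0 w.
rewrite -[leLHS]mul1r ler_pdivrMr; last by lra.
nra.
Qed.

End dual_lattice.

Section riesz_dual.
Context {R : realType} {d : nat} (A : 'M[R]_d) (uA : A \in unitmx) (s : R).
Hypotheses (s0 : 0 < s) (sd : s < d%:R).
Local Notation leb := (@lebesgue_measure R).
Local Notation torus := (torus_measure uA).
Local Notation b := ((d%:R - s) / 2).

Let b0 : 0 < b. Proof. by rewrite divr_gt0// subr_gt0. Qed.

Definition riesz_coef (w : 'cV[R]_d) : R :=
  @riesz_cst R d s * \int[leb]_(t in `]0, 1]) gamma_kernel b (pi ^+ 2 * norm2 w ^+ 2) t.

Lemma riesz_coef_ge0 w : 0 <= riesz_coef w.
Proof.
by rewrite mulr_ge0 ?riesz_cst_ge0//; apply: Rintegral_ge0 => t _; exact: gamma_kernel_ge0.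
Qed.

Lemma riesz_coefN w : riesz_coef (- w) = riesz_coef w.
Proof. by rewrite /riesz_coef !sqr_norm2 dotcvNl dotcvNr opprK. Qed.

Let sub01 : `]0%R, 1%R]%classic `<=` (`]0%R, +oo[%classic : set (measurableTypeR R)).
Proof. by move=> t /=; rewrite !in_itv/= andbT => /andP[]. Qed.

Let int01 a : 0 < a -> leb.-integrable `]0%R, 1%R] (EFin \o gamma_kernel b a).
Proof.
move=> a0; apply/integrableP; split.
  by apply: measurable_gamma_kernel => //; exact: measurable_itv.
under eq_integral do rewrite gee0_abs ?lee_fin ?gamma_kernel_ge0//.
exact: gamma_kernel_integral01_lty.
Qed.

Lemma riesz_coefE w : w != 0 ->
  \int[leb]_(t in `]0, 1])
       (pi `^ (d%:R / 2) / t `^ (d%:R / 2) *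
        expR (- (pi ^+ 2 * norm2 w ^+ 2) / t) *
        (t `^ (s / 2 - 1) / Gamma (s / 2))) = riesz_coef w.
Proof.
move=> w0; rewrite /riesz_coef -RintegralZl//; last first.
  by apply: int01; rewrite sqr_norm2 mulr_gt0 ?exprn_gt0 ?pi_gt0 ?dotcv_gt0.
apply: eq_Rintegral => t /set_mem/sub01/=; rewrite in_itv/= andbT => t0.
exact: riesz_kernelE.
Qed.

(** [gamma_kernel_shift] extracts a Gaussian factor in [w]. The kernel of halved parameter that
    remains decreases in the norm of [w], which [dual_lattice_discrete] bounds below. *)
Lemma riesz_coef_le : exists2 K : R, 0 <= K &
  forall w, dual_lattice A w -> w != 0 ->
    riesz_coef w <= K * expR (- (pi ^+ 2 / 2 * dotcv w w)).
Proof.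
have [e e0 he] := dual_lattice_discrete uA.
pose a := pi ^+ 2 * e.
have pp : 0 < pi ^+ 2 :> R by rewrite exprn_gt0 ?pi_gt0.
have a0 : 0 < a by rewrite mulr_gt0.
exists (@riesz_cst R d s * \int[leb]_(t in `]0, 1]) gamma_kernel b (a / 2) t).
  by rewrite mulr_ge0 ?riesz_cst_ge0//; apply: Rintegral_ge0 => t _; exact: gamma_kernel_ge0.
move=> w dw w0; rewrite -mulrA ler_wpM2l ?riesz_cst_ge0// [leRHS]mulrC sqr_norm2.
have ew := he w dw w0.
rewrite -RintegralZl//; last by apply: int01; rewrite divr_gt0.
apply: le_Rintegral => //.
- by apply: int01; rewrite mulr_gt0// dotcv_gt0.
- rewrite (_ : EFin \o _ = fun t => ((expR (- (pi ^+ 2 / 2 * dotcv w w)))%:E *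
    (EFin \o gamma_kernel b (a / 2)) t)%E)//.
  by apply: integrableZl => //; apply: int01; rewrite divr_gt0.
move=> t /=; rewrite in_itv/= => t01; have /andP[t0 _] := t01.
have pw : 0 <= pi ^+ 2 * dotcv w w by rewrite mulr_ge0 ?dotcv_ge0// ltW.
apply: (le_trans (gamma_kernel_shift b pw t01)).
rewrite mulrAC ler_wpM2l ?expR_ge0//; apply: gamma_kernel_anti => //.
by rewrite /a [leLHS]mulrAC ler_pM2l// divr_gt0.
Qed.

Lemma summable_riesz_coef :
  (\esum_(w in dual_lattice A `\ 0%R) (riesz_coef w)%:E < +oo)%E.
Proof.
have [K K0 hK] := riesz_coef_le; rewrite esum_dual_lattice//.
have uB : (invmx A)^T \in unitmx by rewrite unitmx_tr unitmx_inv.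
have c0 : 0 < pi ^+ 2 / 2 :> R by rewrite divr_gt0// exprn_gt0// pi_gt0.
have := summable_gauss uB c0.
set S := (\esum_(z in _) _)%E => S1.
have S0 : (0 <= S)%E by apply: esum_ge0 => z _; rewrite lee_fin expR_ge0.
apply: (@le_lt_trans _ _ (K%:E * S)%E); last first.
  by rewrite -(fineK (_ : S \is a fin_num)) ?ge0_fin_numE// -EFinM ltry.
rewrite -ge0_esumZl//.
apply: le_esum => z _; case: ifPn => z0.
  by rewrite mule_ge0// lee_fin ?expR_ge0.
rewrite -EFinM lee_fin; apply: hK; first by rewrite dual_latticeE//; exists z.
apply: contra_neq z0 => zE; apply: (@int_col_inj R).
by apply: (can_inj (mulKmx uB)); rewrite zE /int_col raddf0 mulmx0.
Qed.

Definition riesz_coef_sum : R :=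
  fine (\esum_(w in dual_lattice A `\ 0%R) (riesz_coef w)%:E)%E.

Lemma riesz_coef_sumE :
  (\esum_(w in dual_lattice A `\ 0%R) (riesz_coef w)%:E = riesz_coef_sum%:E)%E.
Proof.
rewrite fineK// ge0_fin_numE ?summable_riesz_coef//.
by apply: esum_ge0 => w _; rewrite lee_fin riesz_coef_ge0.
Qed.

Definition riesz_dual_pos (x : 'cV[R]_d) : \bar R :=
  (\esum_(w in dual_lattice A `\ 0%R) (riesz_coef w * (1 + cos_char w x))%:E)%E.

Lemma cos_char_ge0 (w x : 'cV[R]_d) : 0 <= 1 + cos_char w x.
Proof. by rewrite -lerBlDl sub0r cos_geN1. Qed.

Lemma riesz_dual_pos_ge0 x : (0 <= riesz_dual_pos x)%E.
Proof.
by apply: esum_ge0 => w _; rewrite lee_fin mulr_ge0 ?riesz_coef_ge0 ?cos_char_ge0.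
Qed.

Lemma riesz_dual_pos_fin x : riesz_dual_pos x \is a fin_num.
Proof.
rewrite ge0_fin_numE ?riesz_dual_pos_ge0//.
apply: (@le_lt_trans _ _ (riesz_coef_sum%:E + riesz_coef_sum%:E)%E); last by rewrite -EFinD ltry.
have c0 w : (dual_lattice A `\ 0) w -> (0 <= (riesz_coef w)%:E)%E.
  by rewrite lee_fin riesz_coef_ge0.
rewrite -riesz_coef_sumE -esumD//; apply: le_esum => w _.
rewrite -EFinD lee_fin mulrDr mulr1 lerD2l ler_piMr ?riesz_coef_ge0//.
exact: cos_le1.
Qed.

(** [sum_set] subtracts the sum of the negative parts from that of the positive parts; both are at
    most the sum of the coefficients, so every quantity is finite. *)
Lemma Re_riesz_dual x :
  complex.Re (riesz_dual A s x) = fine (riesz_dual_pos x) - riesz_coef_sum.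
Proof.
(* The unreduced real part of the product with a real coefficient, hence the [sin _ * 0]; the next
   equality holds by conversion. *)
pose f (w : 'cV[R]_d) : R := cos (2 * pi * dotcv x w) * \int[leb]_(t in `]0, 1])
       (pi `^ (d%:R / 2) / t `^ (d%:R / 2) *
        expR (- (pi ^+ 2 * norm2 w ^+ 2) / t) *
        (t `^ (s / 2 - 1) / Gamma (s / 2))) - sin (2 * pi * dotcv x w) * 0.
have -> : complex.Re (riesz_dual A s x) = sum_set (dual_lattice A `\ 0) f by [].
rewrite /sum_set.
have fE w : w != 0 -> f w = riesz_coef w * cos_char w x.
  by move=> w0; rewrite /f riesz_coefE//= mulr0 subr0 mulrC.
set P := (\esum_(i in _) (f^\+ i)%:E)%E; set N := (\esum_(i in _) (f^\- i)%:E)%E.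
have c0 w : (dual_lattice A `\ 0) w -> (0 <= (riesz_coef w)%:E)%E.
  by rewrite lee_fin riesz_coef_ge0.
have f_le w : (dual_lattice A `\ 0) w -> `|f w| <= riesz_coef w.
  move=> [_ /eqP w0]; rewrite fE// normrM ger0_norm ?riesz_coef_ge0//.
  by rewrite ler_piMr ?riesz_coef_ge0// ler_norml cos_geN1 cos_le1.
have P0 : (0 <= P)%E by apply: esum_ge0 => w _; rewrite lee_fin funrpos_ge0.
have N0 : (0 <= N)%E by apply: esum_ge0 => w _; rewrite lee_fin funrneg_ge0.
have Pfin : P \is a fin_num.
  rewrite ge0_fin_numE// (le_lt_trans _ summable_riesz_coef)//.
  apply: le_esum => w Dw; rewrite lee_fin (le_trans _ (f_le w Dw))//.
  by rewrite /funrpos ge_max ler_norm normr_ge0.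
have Nfin : N \is a fin_num.
  rewrite ge0_fin_numE// (le_lt_trans _ summable_riesz_coef)//.
  apply: le_esum => w Dw; rewrite lee_fin (le_trans _ (f_le w Dw))//.
  by rewrite /funrneg ge_max -normrN ler_norm normr_ge0.
(* Termwise, the positive part of [f] plus the coefficient equals the negative part plus the
   coefficient times [1 + cos], so only nonnegative families are added. *)
have E : (P + riesz_coef_sum%:E = N + riesz_dual_pos x)%E.
  rewrite -riesz_coef_sumE /riesz_dual_pos -!esumD//.
  - apply: eq_esum => w [_ /eqP w0]; rewrite -!EFinD; congr EFin.
    rewrite /funrpos /funrneg fE// mulrDr mulr1; set y := riesz_coef w * _.
    case: (leP 0 y) => y0; case: (leP 0 (- y)) => y1; lra.
  - by move=> w _; rewrite lee_fin funrneg_ge0.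
  - by move=> w _; rewrite lee_fin mulr_ge0 ?riesz_coef_ge0 ?cos_char_ge0.
  - by move=> w _; rewrite lee_fin funrpos_ge0.
move: E; rewrite -(fineK Pfin) -(fineK Nfin) -(fineK (riesz_dual_pos_fin x)) -!EFinD.
by move=> [E] /=; lra.
Qed.

End riesz_dual.

(** * Torus averages of the potential *)

Section riesz_average.
Context {R : realType} {d : nat} (A : 'M[R]_d) (uA : A \in unitmx) (s : R).
Hypotheses (s0 : 0 < s) (sd : s < d%:R).
Local Notation leb := (@lebesgue_measure R).
Local Notation torus := (torus_measure uA).
Local Notation b := ((d%:R - s) / 2).
Local Notation avg := (torus_avg uA).

Let B := (invmx A)^T.
Let uB : B \in unitmx. Proof. by rewrite unitmx_tr unitmx_inv. Qed.

Lemma measurable_phase (t : R) (w : 'cV[R]_d) :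
  measurable_fun setT (fun x : 'cV[R]_d => (1 + cos (t + 2 * pi * dotcv x w))%:E).
Proof.
apply/measurable_EFinP; apply: measurable_funD => //.
under eq_fun do rewrite -dotcvZr.
exact: measurable_cos_dotcv.
Qed.

Lemma phase_ge0 (t : R) : (0 <= (1 + cos t)%:E)%E.
Proof. by rewrite lee_fin -lerBlDl sub0r cos_geN1. Qed.

Lemma torus_avg_phase (t : R) (w : 'cV[R]_d) : dual_lattice A w ->
  avg (fun x => (1 + cos (t + 2 * pi * dotcv x w))%:E) = (1 + cos t * (w == 0)%:R)%:E.
Proof.
move=> dw; rewrite torus_avgE; first exact: integral_torus_phase.
  exact: measurable_phase.
by move=> x; exact: phase_ge0.
Qed.

Lemma measurable_cos_char_mul (w q : 'cV[R]_d) :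
  measurable_fun setT (fun x => ((1 + cos_char w x) * (1 - cos_char q x))%:E).
Proof.
apply/measurable_EFinP; apply: measurable_funM.
  by apply: measurable_funD => //; exact: measurable_cos_char.
by apply: measurable_funB => //; exact: measurable_cos_char.
Qed.

Lemma cos_char_mul_ge0 (w q x : 'cV[R]_d) :
  0 <= (1 + cos_char w x) * (1 - cos_char q x).
Proof. by rewrite mulr_ge0 ?cos_char_ge0 ?subr_cos_ge0. Qed.

Lemma torus_avg_cos_char_mul (w q : 'cV[R]_d) :
  dual_lattice A w -> dual_lattice A q -> w != 0 -> q != 0 ->
  avg (fun x => ((1 + cos_char w x) * (1 - cos_char q x))%:E) =
  (1 - ((w == q)%:R + (w == - q)%:R) / 2)%:E.
Proof.
move=> dw dq w0 q0; set M := avg _.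
have h2 : 0 <= 2^-1 :> R by [].
have p0 (t : R) (u x : 'cV[R]_d) : (0 <= (1 + cos (t + 2 * pi * dotcv x u))%:E)%E.
  exact: phase_ge0.
have hp0 (t : R) (u x : 'cV[R]_d) :
    (0 <= (2^-1)%:E * (1 + cos (t + 2 * pi * dotcv x u))%:E)%E.
  by rewrite mule_ge0.
have mp (t : R) u := measurable_phase t u.
have hmp (t : R) (u : 'cV[R]_d) : measurable_fun setT
    (fun x : 'cV[R]_d => (2^-1)%:E * (1 + cos (t + 2 * pi * dotcv x u))%:E)%E.
  by apply: emeasurable_funM => //; exact: measurable_cst.
(* Product to sum: [(1 + cos a) (1 - cos c) + 2] is the sum of [1 + cos a], [1 + cos (pi + c)] and
   the halves of [1 + cos (pi + a + c)] and [1 + cos (pi + a - c)]. Adding 2 makes every term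
   nonnegative. *)
have E : (M + 2%:E = (1 + cos 0 * (w == 0)%:R)%:E + ((1 + cos pi * (q == 0)%:R)%:E +
    ((2^-1)%:E * (1 + cos pi * (w + q == 0)%:R)%:E +
     (2^-1)%:E * (1 + cos pi * (w - q == 0)%:R)%:E)))%E.
  rewrite -!torus_avg_phase//; [|exact/dual_latticeD/dual_latticeN|exact: dual_latticeD].
  rewrite -!torus_avgZl// -(torus_avg_cst uA (_ : 0 <= 2))//.
  rewrite -!torus_avgD//.
  - rewrite /torus_avg; apply: eq_integral => -[x y] _ /=.
    rewrite -!EFinM -!EFinD; congr EFin; rewrite /cos_char.
    set a := 2 * pi * dotcv (x - y) w; set c := 2 * pi * dotcv (x - y) q.
    have -> : 2 * pi * dotcv (x - y) (w + q) = a + c by rewrite dotcvDr mulrDr.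
    have -> : 2 * pi * dotcv (x - y) (w - q) = a - c.
      by rewrite dotcvDr dotcvNr mulrDr mulrN.
    rewrite add0r ![pi + _]addrC !cosDpi cosD cosB; by field.
  - by apply: emeasurable_funD => //; apply: emeasurable_funD.
  - by move=> x; rewrite !adde_ge0.
  - by apply: emeasurable_funD.
  - by move=> x; rewrite adde_ge0.
  - exact: measurable_cos_char_mul.
  - by move=> x; rewrite lee_fin cos_char_mul_ge0.
have Mfin : M \is a fin_num.
  by move: E; case: M => //=; rewrite -!EFinM -!EFinD.
move: E; rewrite -(fineK Mfin) -!EFinM -!EFinD => -[E]; congr EFin.
move: E; rewrite (negbTE w0) (negbTE q0) subr_eq0 addr_eq0 cospi /= !mulr0; lra.
Qed.

(** The terms at [q] and [- q] each lose half of their coefficient; the coefficient is even, so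
    together they lose [riesz_coef s q]. *)
Lemma torus_avg_riesz_dual (q : 'cV[R]_d) : dual_lattice A q -> q != 0 ->
  avg (fun x => (riesz_dual_pos A s x * (1 - cos_char q x)%:E)%E) =
  (riesz_coef_sum A s - riesz_coef s q)%:E.
Proof.
move=> dq q0.
pose f (z : 'cV[int]_d) (x : 'cV[R]_d) : \bar R := if z == 0 then 0%E else
  ((riesz_coef s (B *m int_col z))%:E *
   ((1 + cos_char (B *m int_col z) x) * (1 - cos_char q x))%:E)%E.
have f0 z x : (0 <= f z x)%E.
  rewrite /f; case: ifPn => // _.
  by rewrite mule_ge0// lee_fin ?riesz_coef_ge0 ?cos_char_mul_ge0.
have mf z : measurable_fun setT (f z).
  rewrite /f; case: eqP => _; first exact: measurable_cst.
  apply: emeasurable_funM; [exact: measurable_cst|exact: measurable_cos_char_mul].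
transitivity (avg (fun x => \esum_(z in [set: 'cV[int]_d]) f z x)%E).
  congr (torus_avg _ _); apply/funext => x.
  rewrite /riesz_dual_pos esum_dual_lattice// muleC -ge0_esumZl ?subr_cos_ge0//; last first.
    move=> z; case: ifPn => // _.
    by rewrite lee_fin mulr_ge0 ?riesz_coef_ge0 ?cos_char_ge0.
  apply: eq_esum => z _; rewrite /f; case: ifPn => _; first by rewrite mule0.
  by rewrite -!EFinM; congr EFin; ring.
rewrite (torus_avg_esum uA mf f0).
have wz z : z != 0 -> dual_lattice A (B *m int_col z) /\ B *m int_col z != 0.
  move=> z0; split; first by rewrite dual_latticeE//; exists z.
  apply: contra_neq z0 => zE; apply: (@int_col_inj R).
  by apply: (can_inj (mulKmx uB)); rewrite zE /int_col raddf0 mulmx0.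
(* [g] is what the average leaves of the coefficient and [h] what it removes. They add up to the
   coefficient, and since [h] has a finite sum, the sum of [g] follows by subtraction. *)
pose g (w : 'cV[R]_d) : R := riesz_coef s w * (1 - ((w == q)%:R + (w == - q)%:R) / 2).
pose h (w : 'cV[R]_d) : R := riesz_coef s w * (((w == q)%:R + (w == - q)%:R) / 2).
have g0 w : 0 <= g w.
  rewrite mulr_ge0 ?riesz_coef_ge0// subr_ge0 ler_pdivrMr// mul1r.
  by rewrite -natrD ler_nat; case: (w == q); case: (w == - q).
have h0 w : 0 <= h w.
  by rewrite mulr_ge0 ?riesz_coef_ge0// divr_ge0.
transitivity (\esum_(w in dual_lattice A `\ 0%R) (g w)%:E)%E.
  rewrite esum_dual_lattice//; apply: eq_esum => z _; rewrite /f.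
  have [z0|z0] := eqVneq z 0; first exact: torus_avg_cst.
  have [dw w0] := wz z z0.
  rewrite torus_avgZl ?riesz_coef_ge0//; last 2 first.
  - exact: measurable_cos_char_mul.
  - by move=> x; rewrite lee_fin cos_char_mul_ge0.
  by rewrite torus_avg_cos_char_mul// -EFinM.
set G := (\esum_(w in _) _)%E.
have E1 : (\esum_(w in dual_lattice A `\ 0%R) (h w)%:E = (riesz_coef s q)%:E)%E.
  have eq1 u : dual_lattice A u -> u != 0 ->
      (\esum_(w in dual_lattice A `\ 0%R) (riesz_coef s w * ((w == u)%:R / 2))%:E =
       (riesz_coef s u / 2)%:E)%E.
    move=> du u0.
    rewrite (esumID [set u]); last first.
      by move=> w _; rewrite lee_fin mulr_ge0 ?riesz_coef_ge0 ?divr_ge0.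
    rewrite [X in (_ + X)%E]esum1 ?adde0; last first.
      by move=> w [_ /eqP wu]; rewrite (negbTE wu) mul0r mulr0.
    rewrite (_ : _ `&` _ = [set u]).
      by rewrite esum_set1 eqxx ?div1r// lee_fin mulr_ge0 ?riesz_coef_ge0.
    apply/seteqP; split => [w [_ ->]//|w -> /=].
    by split => //; split => //; exact/eqP.
  transitivity (\esum_(w in dual_lattice A `\ 0%R)
    ((riesz_coef s w * ((w == q)%:R / 2))%:E + (riesz_coef s w * ((w == - q)%:R / 2))%:E))%E.
    by apply: eq_esum => w _; rewrite -EFinD /h; congr EFin; ring.
  rewrite esumD; last 2 first.
  - by move=> w _; rewrite lee_fin mulr_ge0 ?riesz_coef_ge0 ?divr_ge0.
  - by move=> w _; rewrite lee_fin mulr_ge0 ?riesz_coef_ge0 ?divr_ge0.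
  rewrite !eq1 ?oppr_eq0//; last exact: dual_latticeN.
  by rewrite riesz_coefN -EFinD -splitr.
have E : (G + (riesz_coef s q)%:E = (riesz_coef_sum A s)%:E)%E.
  rewrite -riesz_coef_sumE// -E1 -esumD; last 2 first.
  - by move=> w _; rewrite lee_fin.
  - by move=> w _; rewrite lee_fin.
  by apply: eq_esum => w _; rewrite -EFinD /g /h; congr EFin; ring.
by rewrite EFinB -E addeK.
Qed.

Definition riesz_pos (x : 'cV[R]_d) : \bar R :=
  (riesz_direct A s x + ((covolume A)^-1)%:E * riesz_dual_pos A s x)%E.

Lemma measurable_riesz_dual_pos : measurable_fun setT (riesz_dual_pos A s).
Proof.
rewrite (_ : riesz_dual_pos A s = fun x => (\esum_(z in [set: 'cV[int]_d])
  if z == 0%R then 0%E else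
   (riesz_coef s (B *m int_col z) * (1 + cos_char (B *m int_col z) x))%:E)%E); last first.
  by apply/funext => x; rewrite /riesz_dual_pos esum_dual_lattice.
have H := @measurable_esum R 'cV[int]_d _ 'cV[R]_d (fun z x => if z == 0%R then 0%E else
   (riesz_coef s (B *m int_col z) * (1 + cos_char (B *m int_col z) x))%:E).
apply: H => [z|z x]; case: eqP => _ //.
  apply/measurable_EFinP; apply: measurable_funM => //.
  by apply: measurable_funD => //; exact: measurable_cos_char.
by rewrite lee_fin mulr_ge0 ?riesz_coef_ge0 ?cos_char_ge0.
Qed.

Lemma covolume_inv_ge0 : 0 <= (covolume A)^-1.
Proof. by rewrite invr_ge0 normr_ge0. Qed.

Lemma measurable_riesz_pos : measurable_fun setT riesz_pos.
Proof.
apply: emeasurable_funD; first exact: measurable_riesz_direct.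
apply: emeasurable_funM; [exact: measurable_cst|exact: measurable_riesz_dual_pos].
Qed.

Lemma riesz_pos_ge0 x : (0 <= riesz_pos x)%E.
Proof.
rewrite adde_ge0 ?riesz_direct_ge0// mule_ge0 ?lee_fin ?covolume_inv_ge0//.
exact: riesz_dual_pos_ge0.
Qed.

Lemma riesz_potentialE x :
  riesz_potential A s x = (riesz_pos x - ((covolume A)^-1 * riesz_coef_sum A s)%:E)%E.
Proof.
rewrite /riesz_potential Re_riesz_dual// mulrBr EFinB /riesz_pos addeA; congr (_ + _ - _)%E.
by rewrite EFinM fineK// riesz_dual_pos_fin.
Qed.

Lemma measurable_subr_cos_char (q : 'cV[R]_d) :
  measurable_fun setT (fun x => (1 - cos_char q x)%:E).
Proof.
by apply/measurable_EFinP; apply: measurable_funB => //; exact: measurable_cos_char.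
Qed.

(** The kernel integrals over []0, 1]] from the direct and the dual part cancel. The shift survives
    in full because [1 - cos_char q] averages to 1. *)
Lemma torus_avg_riesz_pos (q : 'cV[R]_d) : dual_lattice A q -> q != 0 ->
  avg (fun x => (riesz_pos x * (1 - cos_char q x)%:E)%E) =
  ((covolume A)^-1 * (@riesz_cst R d s * (b^-1 -
     (pi ^+ 2 * norm2 q ^+ 2) `^ (- b) * Gamma b)) +
   (covolume A)^-1 * riesz_coef_sum A s)%:E.
Proof.
move=> dq q0; have mq := measurable_subr_cos_char q.
have q1 x : (0 <= (1 - cos_char q x)%:E)%E by rewrite lee_fin subr_cos_ge0.
have md : measurable_fun setT (fun x => (riesz_direct A s x * (1 - cos_char q x)%:E)%E).
  by apply: emeasurable_funM => //; exact: measurable_riesz_direct.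
have d0 x : (0 <= riesz_direct A s x * (1 - cos_char q x)%:E)%E.
  by rewrite mule_ge0 ?riesz_direct_ge0.
have mp : measurable_fun setT (fun x => (riesz_dual_pos A s x * (1 - cos_char q x)%:E)%E).
  by apply: emeasurable_funM => //; exact: measurable_riesz_dual_pos.
have p0 x : (0 <= riesz_dual_pos A s x * (1 - cos_char q x)%:E)%E.
  by rewrite mule_ge0 ?riesz_dual_pos_ge0.
transitivity (avg (fun x => (riesz_direct A s x * (1 - cos_char q x)%:E +
   ((covolume A)^-1)%:E * (riesz_dual_pos A s x * (1 - cos_char q x)%:E))%E)).
  congr (torus_avg _ _); apply/funext => x; rewrite muleA /riesz_pos ge0_muleDl//.
    exact: riesz_direct_ge0.
  by rewrite mule_ge0 ?lee_fin ?covolume_inv_ge0 ?riesz_dual_pos_ge0.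
rewrite torus_avgD//; last 2 first.
- by apply: emeasurable_funM => //; exact: measurable_cst.
- by move=> x; rewrite mule_ge0// lee_fin covolume_inv_ge0.
rewrite torus_avgZl ?covolume_inv_ge0// torus_avg_riesz_dual//.
rewrite torus_avgE// integral_riesz_direct// -EFinM -EFinD; congr EFin.
rewrite /riesz_coef; ring.
Qed.

End riesz_average.

(** * Pairs of points of a point process *)

Section density_measure.
Context d (T : measurableType d) (R : realType).
Variables (mu : {measure set T -> \bar R}) (h : T -> R).
Hypotheses (mh : measurable_fun setT h) (h0 : forall x, 0 <= h x).
Local Open Scope ereal_scope.

Lemma density_measure : exists m : {measure set T -> \bar R},
  forall B, measurable B -> m B = \int[mu]_x (\1_B x * h x)%:E.
Proof.
pose nu (B : set T) := \int[mu]_(x in B) (h x)%:E.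
have nu0 : nu set0 = 0 by rewrite /nu integral_set0.
have nu_ge0 B : 0 <= nu B by apply: integral_ge0 => x _; rewrite lee_fin.
have nuS : semi_sigma_additive nu.
  move=> F mF tF mUF; rewrite /nu ge0_integral_bigcup//; last 2 first.
  - by apply/measurable_EFinP; exact: measurable_funTS.
  - by move=> x _; rewrite lee_fin.
  apply: is_cvg_ereal_nneg_natsum_cond => n _ _; exact: nu_ge0.
pose m : {measure set T -> \bar R} := HB.pack nu (isMeasure.Build _ _ _ nu nu0 nu_ge0 nuS).
exists m => B mB.
rewrite /= /nu integral_mkcond; apply: eq_integral => x _.
by rewrite patchE indicE; case: ifPn => _; rewrite ?mul1r ?mul0r.
Qed.

(** The laws of all ordered pairs of points have to be added into one measure before a uniqueness
    theorem can be applied to them. *)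
Lemma sum_measure (l : seq {measure set T -> \bar R}) :
  exists m : {measure set T -> \bar R},
    (forall B, measurable B -> m B = \sum_(k <- l) k B) /\
    (forall f, measurable_fun setT f -> (forall x, 0 <= f x) ->
      \int[m]_x f x = \sum_(k <- l) \int[k]_x f x).
Proof.
elim: l => [|k l [m [mE mf]]].
  exists mzero; split=> [B mB|f mf f0]; rewrite big_nil//.
  by rewrite integral_measure_zero.
exists (measure_add k m); split=> [B mB|f mF f0]; rewrite big_cons.
  by rewrite -mE//; exact: measure_addE.
by rewrite ge0_integral_measure_add// mf.
Qed.

End density_measure.

(** * Measures on pairs determined off the diagonal *)

Section off_diagonal.
Context d (S : measurableType d) (R : realType).
(** A countable family separating points: it makes the diagonal measurable and covers its complement
    by rectangles with disjoint sides. *)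
Variable C : nat -> set S.
Hypothesis mC : forall n, measurable (C n).
Hypothesis sepC : forall x y, x <> y -> exists2 n, C n x & ~ C n y.

Definition pair_diagonal : set (S * S) := [set p | p.1 = p.2].

Lemma off_diagonalE : ~` pair_diagonal = \bigcup_n (C n `*` ~` C n).
Proof.
apply/seteqP; split => [[x y] /= xy|[x y] [n _ [/= Cx Cy]] /= xy].
  by have [n Cx Cy] := sepC xy; exists n.
have {}xy : x = y := xy; by apply: Cy; rewrite -xy.
Qed.

Lemma measurable_pair_diagonal : measurable pair_diagonal.
Proof.
rewrite -[pair_diagonal]setCK off_diagonalE; apply: measurableC.
by apply: bigcup_measurable => n _; apply: measurableX => //; exact: measurableC.
Qed.

(** A pi-system on which the two measures will agree: on rectangles with disjoint sides by
    assumption, on measurable parts of the diagonal because these are null. *)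
Let G : set (set (S * S)) := [set E | measurable E /\ E `<=` pair_diagonal] `|`
  [set E | exists D1 D2, [/\ measurable D1, measurable D2, D1 `&` D2 = set0 & E = D1 `*` D2]].

Let G_measurable E : G E -> measurable E.
Proof. by move=> [[]//|[D1 [D2 [mD1 mD2 _ ->]]]]; exact: measurableX. Qed.

Let G_setI : setI_closed G.
Proof.
move=> E F GE GF; have mE := G_measurable GE; have mF := G_measurable GF.
move: GE => [[_ Ed]|[D1 [D2 [mD1 mD2 D12 EE]]]].
  by left; split; [exact: measurableI|move=> p [/Ed]].
move: GF => [[_ Fd]|[D3 [D4 [mD3 mD4 D34 FE]]]].
  by left; split; [exact: measurableI|move=> p [_ /Fd]].
right; exists (D1 `&` D3), (D2 `&` D4); split; try exact: measurableI.
- by rewrite setIACA D12 set0I.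
- by rewrite EE FE setXI.
Qed.

(** A general rectangle is the union of its diagonal part and of the pieces
    [(D1 & C k) x (D2 \ C k)], whose sides are disjoint. *)
Let measurable_G : @measurable _ (S * S)%type = <<s G>>.
Proof.
have [G0 GC GU] := smallest_sigma_algebra setT G.
have GT : <<s G>> `<=` @measurable _ (S * S)%type.
  apply: smallest_sub; first exact: sigma_algebra_measurable.
  by move=> E; exact: G_measurable.
apply/seteqP; split => //.
rewrite measurable_prod_measurableType; apply: smallest_sub => // _ [D1 mD1 [D2 mD2 <-]].
pose F n := if n is k.+1 then (D1 `&` C k) `*` (D2 `&` ~` C k) else D1 `*` D2 `&` pair_diagonal.
have -> : D1 `*` D2 = \bigcup_n F n.
  apply/seteqP; split => [p Dp|p [[_ []//|k _ [[/= ? _] [? _]]]//]].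
  have [pd|pd] := pselect (pair_diagonal p); first by exists 0%N.
  have : (~` pair_diagonal) p by [].
  by rewrite off_diagonalE => -[n _ [Cx Cy]]; exists n.+1 => //; case: Dp.
apply: GU => n; apply: sub_sigma_algebra; case: n => [|n].
  left; split; last exact: subIsetr.
  by apply: measurableI; [exact: measurableX|exact: measurable_pair_diagonal].
right; exists (D1 `&` C n), (D2 `&` ~` C n); split => //.
- exact: measurableI.
- by apply: measurableI => //; exact: measurableC.
- by rewrite setIACA setICr setI0.
Qed.

Lemma off_diagonal_measure_unique (m1 m2 : {measure set (S * S) -> \bar R}) :
  (forall D1 D2, measurable D1 -> measurable D2 -> D1 `&` D2 = set0 ->
     m1 (D1 `*` D2) = m2 (D1 `*` D2)) ->
  m1 pair_diagonal = 0%E -> m2 pair_diagonal = 0%E -> (m1 setT < +oo)%E ->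
  forall E, measurable E -> m1 E = m2 E.
Proof.
move=> m12 d1 d2 m1oo; pose g n := if n is k.+1 then C k `*` ~` C k else pair_diagonal.
have md := measurable_pair_diagonal.
have null (m : {measure set (S * S) -> \bar R}) E : m pair_diagonal = 0%E -> measurable E ->
    E `<=` pair_diagonal -> m E = 0%E.
  by move=> md0 mE Ed; apply/eqP; rewrite eq_le measure_ge0 andbT -md0 le_measure ?inE.
have Gg n : G (g n).
  case: n => [|n]; first by left; split.
  by right; exists (C n), (~` C n); split => //; [exact: measurableC|exact: setICr].
apply: (measure_unique G g) => //.
- apply/seteqP; split => // p _; have [pd|pd] := pselect (pair_diagonal p); first by exists 0%N.
  have : (~` pair_diagonal) p by [].
  by rewrite off_diagonalE => -[n _ Cn]; exists n.+1.
- move=> E [[mE Ed]|[D1 [D2 [mD1 mD2 D12 ->]]]]; last exact: m12.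
  by rewrite (null m1 E)// (null m2 E).
- move=> k; apply: le_lt_trans m1oo; apply: le_measure; rewrite ?inE//.
  exact: G_measurable.
Qed.

End off_diagonal.

Lemma measurable_pair_tuple d (S : measurableType d) :
  measurable_fun setT (fun p : S * S => [tuple p.1; p.2] : 2.-tuple S).
Proof.
apply/measurable_fun_tnthP => -[[|[|//]] i2].
  by rewrite (_ : _ \o _ = fst)//; exact: measurable_fst.
by rewrite (_ : _ \o _ = snd)//; exact: measurable_snd.
Qed.

Section product_power_integral.
Context d (S : measurableType d) (R : realType).
Variable mu : {sigma_finite_measure set S -> \bar R}.
Local Open Scope ereal_scope.

Lemma ge0_integral_product_powerS n (F : n.+1.-tuple S -> \bar R) :
  measurable_fun setT F -> (forall x, 0 <= F x) ->
  \int[product_power mu n.+1]_x F x =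
  \int[mu]_x \int[product_power mu n]_t F (consT (x, t)).
Proof.
move=> mF F0; rewrite /= /product_step.
have mc := @measurable_consT _ S n.
rewrite (ge0_integral_pushforward mc)//= fubini_tonelli1//.
exact: (measurableT_comp mF mc).
Qed.

Lemma ge0_integral_product_power2 (F : 2.-tuple S -> \bar R) :
  measurable_fun setT F -> (forall x, 0 <= F x) ->
  \int[product_power mu 2]_x F x = \int[(mu \x mu)]_p F [tuple p.1; p.2].
Proof.
move=> mF F0; rewrite ge0_integral_product_powerS//.
have mF2 : measurable_fun setT (fun p : S * S => F [tuple p.1; p.2]).
  exact: (measurableT_comp mF (@measurable_pair_tuple _ S)).
rewrite (fubini_tonelli1 _ mF2)//; apply: eq_integral => x _.
have mFx : measurable_fun setT (fun t : 1.-tuple S => F (consT (x, t))).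
  exact: (measurableT_comp mF (measurableT_comp (@measurable_consT _ S 1) (pair1_measurable x))).
rewrite (ge0_integral_product_powerS mFx)//; apply: eq_integral => y _.
rewrite integral_dirac//; last first.
  exact: (measurableT_comp mFx (measurableT_comp (@measurable_consT _ S 0) (pair1_measurable y))).
rewrite diracT mul1e /fubini_F /=; congr F; exact: val_inj.
Qed.

End product_power_integral.

(** * Campbell's formula for ordered pairs of points *)

Section pair_process.
Context {dO d : measure_display} {O : measurableType dO} {S : measurableType d}
  {R : realType}.
Variables (P : probability O R) (mu : {sigma_finite_measure set S -> \bar R}).
Variable C : nat -> set S.
Hypothesis mC : forall n, measurable (C n).
Hypothesis sepC : forall x y, x <> y -> exists2 n, C n x & ~ C n y.
Variables (n : nat) (X : {RV P >-> n.-tuple S}) (rho : 2.-tuple S -> R).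
Hypotheses (simpleX : simple_process X) (rhoX : joint_intensity mu X rho).
Hypotheses (mrho : measurable_fun setT rho) (rho0 : forall x, 0 <= rho x).
Hypothesis rho_diag : forall x, rho [tuple x; x] = 0.

Let phi (p : 'I_n * 'I_n) (o : O) : S * S := (tnth (X o) p.1, tnth (X o) p.2).

Let mphi p : measurable_fun setT (phi p).
Proof.
have mX : measurable_fun setT X by exact: measurable_funP.
by apply: measurable_fun_pair; apply: (measurableT_comp (measurable_tnth _) mX).
Qed.

Let h (p : S * S) : R := rho [tuple p.1; p.2].

Let mh : measurable_fun setT h.
Proof. exact: (measurableT_comp mrho (@measurable_pair_tuple _ S)). Qed.

(** Disjointness of [D1] and [D2] discards the pairs with equal indices. *)
Lemma prod_point_count (x : n.-tuple S) (D1 D2 : set S) : D1 `&` D2 = set0 ->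
  (point_count x D1 * point_count x D2 =
   \sum_(p : 'I_n * 'I_n | p.1 != p.2) `[< (D1 `*` D2) (tnth x p.1, tnth x p.2) >])%N.
Proof.
move=> D12; rewrite /point_count big_distrlr/= pair_big/=.
rewrite (bigID (fun p : 'I_n * 'I_n => p.1 != p.2))/= [X in (_ + X)%N]big1 ?addn0.
  by apply: eq_bigr => -[i j] _; rewrite asbool_and mulnb.
move=> [i j] /=; rewrite negbK => /eqP <-; rewrite mulnb -asbool_and.
case: asboolP => //= -[Di1 Di2]; exfalso.
by have : (D1 `&` D2) (tnth x i) by []; rewrite D12.
Qed.

Let pairs := [seq p <- index_enum ('I_n * 'I_n)%type | p.1 != p.2].

Let phim p : {mfun O >-> (S * S)%type} :=
  HB.pack (phi p) (isMeasurableFun.Build _ _ _ _ _ (mphi p)).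

Local Open Scope ereal_scope.

(** [M1] is the sum of the laws of the ordered pairs of points and [M2] the measure of density
    [rho]; once they are known to coincide, both sides are the integral of [f]. *)
Lemma integral_pair_process (f : S * S -> \bar R) :
  measurable_fun setT f -> (forall p, 0 <= f p) ->
  \int[P]_o \sum_(p : 'I_n * 'I_n | p.1 != p.2) f (tnth (X o) p.1, tnth (X o) p.2) =
  \int[(mu \x mu)]_p (f p * (rho [tuple p.1; p.2])%:E).
Proof.
move=> mf f0.
have [M1 [M1E M1f]] := sum_measure
  [seq (pushforward P (phim p) : {measure set (S * S)%type -> \bar R}) | p <- pairs].
have [M2 M2E] := @density_measure _ _ _ (mu \x mu) h mh (fun p => rho0 _).
have M12 : forall E, measurable E -> M1 E = M2 E.
  apply: (off_diagonal_measure_unique mC sepC).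
  - move=> D1 D2 mD1 mD2 D12; rewrite M1E; last exact: measurableX.
    rewrite M2E; last exact: measurableX.
    rewrite big_map big_filter.
    pose D (i : 'I_2) := if i == ord0 then D1 else D2.
    have mD i : measurable (D i) by rewrite /D; case: ifP.
    have tD : trivIset setT D.
      apply/trivIsetP => i j _ _; rewrite /D; case: i => [[|[]]//] ?; case: j => [[|[]]//] ? //= _.
      by rewrite setIC.
    have rhoDE := rhoX mD tD; rewrite unlock /= in rhoDE.
    transitivity (\int[P]_o \sum_(p : 'I_n * 'I_n | p.1 != p.2) (\1_(D1 `*` D2) (phi p o))%:E).
      rewrite -big_filter.
      under [in RHS]eq_integral do rewrite -big_filter.
      rewrite ge0_integral_sum//; last first.
        move=> p; apply/measurable_EFinP.
        have mI : measurable_fun setT (\1_(D1 `*` D2) : (S * S)%type -> R).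
          by apply: measurable_indic; exact: measurableX.
        exact: (measurableT_comp mI (mphi p)).
      apply: eq_bigr => p _; transitivity (\int[P]_o (\1_(phi p @^-1` (D1 `*` D2)) o)%:E).
        rewrite integral_indic ?setIT//.
        by rewrite -[_ @^-1` _]setTI; apply: mphi => //; exact: measurableX.
      by apply: eq_integral => o _; rewrite !indicE.
    transitivity (\int[product_power mu 2]_(x in [set x | forall i, D i (tnth x i)]) (rho x)%:E).
      rewrite -rhoDE; apply: eq_integral => o _.
      rewrite big_ord_recl big_ord1 prod_point_count// sumEFin natr_sum; congr EFin.
    set E := [set x | _].
    have EE (x : 2.-tuple S) : E x <-> D1 (tnth x ord0) /\ D2 (tnth x ord_max).
      by split=> [Ex|[h1 h2] i]; [split; [exact: (Ex ord0)|exact: (Ex ord_max)]|];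
        rewrite /D; case: ifPn => [/eqP ->//|i0]; rewrite (_ : i = ord_max)//;
        apply/val_inj; case: i i0 => [[|[]]].
    have mE : measurable E.
      rewrite (_ : E = (fun x => tnth x ord0) @^-1` D1 `&` (fun x => tnth x ord_max) @^-1` D2).
        by apply: measurableI; rewrite -[_ @^-1` _]setTI; apply: measurable_tnth.
      by apply/seteqP; split => x /EE.
    rewrite [LHS]integral_mkcond ge0_integral_product_power2; last 2 first.
    - by apply/(measurable_restrictT _ mE); apply/measurable_EFinP; exact: measurable_funTS.
    - by move=> x; rewrite erestrict_ge0// => y _; rewrite lee_fin.
    apply: eq_integral => -[x y] _; rewrite patchE indicE /=.
    have -> : ([tuple x; y] \in E) = ((x, y) \in D1 `*` D2).
      by apply/idP/idP => /set_mem Dxy; apply/mem_set; [move: Dxy => /EE|apply/EE].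
    by case: ifP => _; rewrite ?mul1r ?mul0r.
  (* [M1] ignores the diagonal because the points are almost surely distinct. *)
  - rewrite M1E; last exact: measurable_pair_diagonal mC sepC.
    rewrite big_map big1_seq// => p; rewrite mem_filter => /andP[_ /andP[p12 _]].
    have [N [mN PN subN]] := simpleX.
    have md : measurable (phi p @^-1` @pair_diagonal _ S).
      by rewrite -[_ @^-1` _]setTI; apply: mphi => //; exact: measurable_pair_diagonal mC sepC.
    apply/eqP; rewrite eq_le measure_ge0 andbT.
    change (P (phi p @^-1` @pair_diagonal _ S) <= 0).
    rewrite -PN; apply: le_measure; rewrite ?inE//.
    move=> o /= op; apply: subN => /= /tuple_uniqP inj.
    exact: (elimN eqP p12 (inj _ _ op)).
  (* [M2] ignores it because [rho] vanishes there. *)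
  - rewrite M2E; last exact: measurable_pair_diagonal mC sepC.
    rewrite -[RHS](integral0 (mu \x mu) setT); apply: eq_integral => -[x y] _.
    rewrite indicE /h /=; have [xy|xy] := pselect (x = y).
      by rewrite -xy rho_diag mulr0.
    by rewrite memNset ?mul0r.
  - rewrite M1E// big_map; apply: lte_sum_pinfty => p _.
    change (P (phi p @^-1` setT) < +oo).
    by rewrite preimage_setT probability_setT ltry.
transitivity (\int[M1]_p f p).
  rewrite M1f// big_map.
  under eq_integral do rewrite -big_filter.
  rewrite ge0_integral_sum//; last by move=> p; exact: (measurableT_comp mf (mphi p)).
  by apply: eq_bigr => p _; rewrite ge0_integral_pushforward.
rewrite (eq_measure_integral M2); last by move=> E mE _; exact: M12.
apply: (ge0_integral_density (phi := id)) => //.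
Qed.

End pair_process.

(** * A countable family separating the points of R^d *)

Section separating.
Context {R : realType} {d : nat}.

(** Both orientations are listed, since either of two distinct points may have the smaller
    coordinate; an integer that decodes to nothing gives the empty set. *)
Definition rat_half_space (n : nat) : set 'cV[R]_d :=
  if unpickle n is Some (i, q, c) then
    [set x : 'cV[R]_d | if c : bool then x (i : 'I_d) 0 < ratr (q : rat) else ratr q < x i 0]
  else set0.

Lemma measurable_rat_half_space n : measurable (rat_half_space n).
Proof.
rewrite /rat_half_space; case: unpickle => // -[[i q] c].
have mi := @measurable_coord R d i.
case: c.
  rewrite (_ : [set _ | _] = setT `&` (fun x : 'cV[R]_d => x i 0) @^-1` `]-oo, ratr q[%classic).
    exact: mi.
  by apply/seteqP; split => x /=; rewrite in_itv/=; [|case].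
rewrite (_ : [set _ | _] = setT `&` (fun x : 'cV[R]_d => x i 0) @^-1` `]ratr q, +oo[%classic).
  exact: mi.
by apply/seteqP; split => x /=; rewrite in_itv/= andbT; [|case].
Qed.

Lemma rat_half_space_sep (x y : 'cV[R]_d) : x <> y ->
  exists2 n, rat_half_space n x & ~ rat_half_space n y.
Proof.
move=> xy; have [i xyi] : exists i, x i 0 != y i 0.
  apply: contra_notP xy => /forallNP xy; apply/colP => i.
  by have /negP := xy i; rewrite negbK => /eqP.
have [xi|yi|xyE] := ltgtP (x i 0) (y i 0); last by rewrite xyE eqxx in xyi.
- have [q] := rat_in_itvoo xi; rewrite in_itv/= => /andP[xq qy].
  exists (pickle (i, q, true)); rewrite /rat_half_space pickleK//=.
  by apply/negP; rewrite -leNgt ltW.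
- have [q] := rat_in_itvoo yi; rewrite in_itv/= => /andP[yq qx].
  exists (pickle (i, q, false)); rewrite /rat_half_space pickleK//=.
  by apply/negP; rewrite -leNgt ltW.
Qed.

End separating.

Lemma det_mx2 (K : comNzRingType) (M : 'M[K]_2) :
  \det M = M ord0 ord0 * M ord_max ord_max - M ord0 ord_max * M ord_max ord0.
Proof.
rewrite (expand_det_row _ ord0) !big_ord_recl big_ord0 /cofactor !det_mx11 !mxE /=.
rewrite !expr0 expr1 !mul1r addr0 mulN1r mulrN.
have -> : lift ord0 ord0 = ord_max :> 'I_2 by exact: val_inj.
have -> : lift ord_max ord0 = ord0 :> 'I_2 by exact: val_inj.
by congr (_ * M _ _ - _ * M _ _); exact: val_inj.
Qed.

(** * The process of the lattice kernel *)

Section lattice_process.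
Context {R : realType} {d : nat} (A : 'M[R]_d) (uA : A \in unitmx).
Variable kappa : 'cV[R]_d -> bool.
Hypothesis hkappa : finite_set [set w | dual_lattice A w /\ kappa w].

Local Notation n := (kernel_rank A kappa).
Let supp : set 'cV[R]_d := [set w | dual_lattice A w /\ kappa w].
Let L : seq 'cV[R]_d := finmap.enum_fset (fset_set supp).

Let mem_L w : (w \in L) = (w \in supp).
Proof. exact: in_fset_set. Qed.

(** Sums over the infinite dual lattice have finite support by [hkappa] and become sums over a
    list. *)
Lemma fsum_kappa (V : nmodType) (f : 'cV[R]_d -> V) :
  (forall w, ~~ kappa w -> f w = 0) ->
  \sum_(w \in dual_lattice A) f w = \sum_(w <- L) f w.
Proof.
move=> f0; rewrite -(@fsbig_widen _ _ _ _ supp); first exact: fsbig_finite.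
  by move=> w [].
by move=> w /= [dw nw]; apply: f0; apply/negP => kw; apply: nw.
Qed.

Let kappa_L w : w \in L -> dual_lattice A w /\ kappa w.
Proof. by rewrite mem_L => /set_mem. Qed.

Lemma kernel_rankE : n = size L.
Proof.
rewrite /kernel_rank (@fsum_kappa nat); last by move=> w /negbTE ->.
rewrite (eq_big_seq (fun=> 1)); last by move=> w /kappa_L[_ ->].
exact: sum1_size.
Qed.

(** The same ordinals index the frequencies here and the points of the process, since the rank of
    the kernel is the number of both. *)
Let l (i : 'I_n) : 'cV[R]_d := nth 0 L i.

Let lL i : l i \in L.
Proof. by rewrite mem_nth// -kernel_rankE. Qed.

Let l_dual i : dual_lattice A (l i). Proof. by have [] := kappa_L (lL i). Qed.
Let l_kappa i : kappa (l i). Proof. by have [] := kappa_L (lL i). Qed.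

Let uniq_L : uniq L. Proof. exact: finmap.fset_uniq. Qed.

Let l_inj : injective l.
Proof.
by move=> i j /eqP; rewrite nth_uniq -?kernel_rankE// => /eqP ij; exact: val_inj.
Qed.

Lemma sum_L (V : nmodType) (f : 'cV[R]_d -> V) : \sum_(w <- L) f w = \sum_i f (l i).
Proof. by rewrite (big_nth 0) -kernel_rankE big_mkord. Qed.

Let cs (z : 'cV[R]_d) : R := \sum_i cos (2 * pi * dotcv z (l i)).
Let sn (z : 'cV[R]_d) : R := \sum_i sin (2 * pi * dotcv z (l i)).

Lemma lattice_kernelE u v : lattice_kernel A kappa u v = (cs (u - v) +i* sn (u - v))%C.
Proof.
rewrite /lattice_kernel fsum_kappa; last by move=> w /negbTE ->; rewrite mul0r.
rewrite sum_L /cs /sn.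
rewrite (eq_bigr (fun i => (cos (2 * pi * dotcv (u - v) (l i)) +i*
   sin (2 * pi * dotcv (u - v) (l i)))%C)); last first.
  by move=> i _; rewrite l_kappa mul1r.
by elim/big_rec3 : _ => // i a b c _ ->.
Qed.

(** The terms [i = j] vanish; keeping them lets the double sum match [n^2] minus the squared modulus
    of the kernel. *)
Let r (z : 'cV[R]_d) : R := \sum_i \sum_j (1 - cos_char (l i - l j) z).

Lemma csn_sqr z : cs z * cs z + sn z * sn z = \sum_i \sum_j cos_char (l i - l j) z.
Proof.
rewrite /cs /sn !big_distrlr/= -big_split/=; apply: eq_bigr => i _.
rewrite -big_split/=; apply: eq_bigr => j _.
by rewrite /cos_char dotcvDr dotcvNr mulrBr cosB.
Qed.

Lemma rhoE (rho : 2.-tuple 'cV[R]_d -> R) :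
  (forall x, ((rho x)%:C)%C =
     \det (\matrix_(i, j) lattice_kernel A kappa (tnth x i) (tnth x j))) ->
  rho = fun x => r (tnth x ord0 - tnth x ord_max).
Proof.
move=> rhoE; apply/funext => x.
have := congr1 (@complex.Re R) (rhoE x); rewrite det_mx2 !mxE !lattice_kernelE /= => ->.
set z := tnth x ord0 - tnth x ord_max.
have -> : tnth x ord_max - tnth x ord0 = - z by rewrite opprB.
rewrite !subrr.
have csN : cs (- z) = cs z by apply: eq_bigr => i _; rewrite dotcvNl mulrN cosN.
have snN : sn (- z) = - sn z.
  by rewrite -sumrN; apply: eq_bigr => i _; rewrite dotcvNl mulrN sinN.
have cs0 : cs 0 = n%:R.
  rewrite /cs (eq_bigr (fun=> 1)) ?sumr_const ?card_ord// => i _.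
  by rewrite dotcvC dotcv0r mulr0 cos0.
have sn0 : sn 0 = 0.
  by rewrite /sn big1// => i _; rewrite dotcvC dotcv0r mulr0 sin0.
rewrite csN snN cs0 sn0 /r.
under [in RHS]eq_bigr do rewrite sumrB sumr_const card_ord.
rewrite sumrB -csn_sqr sumr_const card_ord -(mulr_natr n%:R); ring.
Qed.

Variables (dO : measure_display) (O : measurableType dO) (P : probability O R).
Variable X : {RV P >-> n.-tuple 'cV[R]_d}.
Hypothesis hdet : determinantal (torus_measure uA) (lattice_kernel A kappa) X.
Variable s : R.
Hypotheses (s0 : 0 < s) (sd : s < d%:R).
Local Notation b := ((d%:R - s) / 2).

(** The excess of [riesz_pos] over the potential. *)
Let K := (covolume A)^-1 * riesz_coef_sum A s.

Lemma riesz_energyE (x : n.-tuple 'cV[R]_d) :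
  (riesz_energy A s x =
   \sum_(p : 'I_n * 'I_n | p.1 != p.2) riesz_pos A s (tnth x p.1 - tnth x p.2) -
   (\sum_(p : 'I_n * 'I_n | p.1 != p.2) K)%:E)%E.
Proof.
rewrite /riesz_energy -EFinN -sumrN -sumEFin -big_split/=.
by apply: eq_bigr => p _; rewrite riesz_potentialE.
Qed.

(** For a nonzero dual vector [q], the torus average of the potential times [1 - cos_char q]. *)
Let V (q : 'cV[R]_d) : R := (covolume A)^-1 * (@riesz_cst R d s * (b^-1 -
     (pi ^+ 2 * norm2 q ^+ 2) `^ (- b) * Gamma b)).

Lemma integral_riesz_pos :
  (\int[P]_o \sum_(p : 'I_n * 'I_n | p.1 != p.2)
      riesz_pos A s (tnth (X o) p.1 - tnth (X o) p.2) =
   (\sum_(p : 'I_n * 'I_n | p.1 != p.2) (V (l p.1 - l p.2) + K))%:E)%E.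
Proof.
have [simpleX /(_ 2 isT)[rho /rhoE rhoE rhoX]] := hdet.
have rE z : r z = \sum_(p : 'I_n * 'I_n | p.1 != p.2) (1 - cos_char (l p.1 - l p.2) z).
  rewrite /r pair_bigA/= (bigID (fun p : 'I_n * 'I_n => p.1 != p.2))/=.
  rewrite [X in _ + X]big1 ?addr0// => -[i j] /=; rewrite negbK => /eqP <-.
  by rewrite subrr /cos_char dotcv0r mulr0 cos0 subrr.
have r0 z : 0 <= r z by rewrite rE; apply: sumr_ge0 => p _; exact: subr_cos_ge0.
have mrho : measurable_fun setT rho.
  rewrite rhoE; apply: measurable_sum => i; apply: measurable_sum => j.
  apply: measurable_funB => //; apply: (measurableT_comp (measurable_cos_char _)).
  by apply: measurable_fun_colB; exact: measurable_tnth.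
have rho0 x : 0 <= rho x by rewrite rhoE.
have rho_diag x : rho [tuple x; x] = 0.
  rewrite rhoE /= subrr /r big1// => i _; rewrite big1// => j _.
  by rewrite /cos_char dotcvC dotcv0r mulr0 cos0 subrr.
have mG := measurable_riesz_pos uA s.
have G0 := riesz_pos_ge0 A s.
pose f (q : 'cV[R]_d * 'cV[R]_d) := riesz_pos A s (q.1 - q.2).
rewrite (integral_pair_process measurable_rat_half_space rat_half_space_sep simpleX
  rhoX mrho rho0 rho_diag (f := f) (measurable_diff mG)) => [|q]; last exact: riesz_pos_ge0.
pose g (p : 'I_n * 'I_n) (z : 'cV[R]_d) :=
  (riesz_pos A s z * (1 - cos_char (l p.1 - l p.2) z)%:E)%E.
have g0 p z : (0 <= g p z)%E by rewrite mule_ge0// lee_fin subr_cos_ge0.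
have mg p : measurable_fun setT (g p).
  by apply: emeasurable_funM => //; exact: measurable_subr_cos_char.
transitivity (\int[(torus_measure uA \x torus_measure uA)]_q
    \sum_(p : 'I_n * 'I_n | p.1 != p.2) g p (q.1 - q.2)%R)%E.
  apply: eq_integral => -[x y] _; rewrite rhoE /f /= rE -sumEFin ge0_sume_distrr//.
  by move=> p _; rewrite lee_fin subr_cos_ge0.
under eq_integral do rewrite -big_filter.
rewrite ge0_integral_sum//; last by move=> p; exact: measurable_diff.
rewrite big_filter -sumEFin; apply: eq_bigr => p p12.
rewrite -[LHS]/(torus_avg uA (g p)) torus_avg_riesz_pos//.
  by apply: dual_latticeD => //; exact: dual_latticeN.
by rewrite subr_eq0; apply: contra_neq p12 => /l_inj.
Qed.

(** The shifted energy has finite expectation, so the constant [K] may be subtracted once per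
    ordered pair of points. It cancels the [K] of each ordered pair of frequencies, because both
    kinds of pairs have the same index set. *)
Lemma integral_riesz_energy :
  (\int[P]_o riesz_energy A s (X o) =
   (\sum_(p : 'I_n * 'I_n | p.1 != p.2) V (l p.1 - l p.2))%:E)%E.
Proof.
under eq_integral do rewrite riesz_energyE.
set k := \sum_(p | _) K.
pose F o := (\sum_(p : 'I_n * 'I_n | p.1 != p.2)
      riesz_pos A s (tnth (X o) p.1 - tnth (X o) p.2)%R)%E.
have F0 o : (0 <= F o)%E by apply: sume_ge0 => p _; exact: riesz_pos_ge0.
have mF : measurable_fun setT F.
  rewrite /F; under eq_fun do rewrite -big_filter.
  apply: emeasurable_sum => p; apply: (measurableT_comp (measurable_riesz_pos uA s)).
  have mX : measurable_fun setT X by exact: measurable_funP.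
  by apply: measurable_fun_colB; apply: (measurableT_comp (measurable_tnth _) mX).
have intF : P.-integrable setT F.
  apply/integrableP; split => //; under eq_integral do rewrite gee0_abs//.
  by rewrite integral_riesz_pos ltry.
have intk : P.-integrable setT (fun=> k%:E) by exact: finite_measure_integrable_cst.
rewrite (integralB _ intF intk)// integral_riesz_pos.
have -> : (\int[P]_o k%:E = k%:E)%E.
  by rewrite integral_cst// -[RHS]mule1; congr (_ * _)%E; exact: (@probability_setT _ _ _ P).
by rewrite -EFinB big_split/= addrK.
Qed.

(** Outside the list [T] of pairs of distinct frequencies, one of the two factors [kappa] is 0. *)
Lemma fsum_off_diagonal :
  \sum_(p \in [set p : 'cV[R]_d * 'cV[R]_d |
          [/\ dual_lattice A p.1, dual_lattice A p.2 & p.1 <> p.2]])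
        ((kappa p.1)%:R * (kappa p.2)%:R / norm2 (p.1 - p.2) `^ (d%:R - s)) =
  \sum_(p : 'I_n * 'I_n | p.1 != p.2) (norm2 (l p.1 - l p.2) `^ (d%:R - s))^-1.
Proof.
pose pl (p : 'I_n * 'I_n) := (l p.1, l p.2).
pose T : seq ('cV[R]_d * 'cV[R]_d) :=
  [seq pl p | p <- index_enum ('I_n * 'I_n)%type & p.1 != p.2].
have pl_inj : injective pl by move=> [i j] [i' j'] [/l_inj -> /l_inj ->].
have uT : uniq T by rewrite map_inj_uniq// filter_uniq// index_enum_uniq.
have TP w : w \in T <-> [/\ w.1 \in L, w.2 \in L & w.1 != w.2].
  split=> [/mapP[[i j]]|[]].
    rewrite mem_filter => /andP[/= ij _] -> /=; split => //.
    by apply: contra_neq ij => /l_inj.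
  case: w => w w' /= wL w'L ww'.
  have iw : (index w L < n)%N by rewrite kernel_rankE index_mem.
  have iw' : (index w' L < n)%N by rewrite kernel_rankE index_mem.
  apply/mapP; exists (Ordinal iw, Ordinal iw'); last by rewrite /pl /l /= !nth_index.
  rewrite mem_filter mem_index_enum andbT/=; apply: contra_neq ww' => -[E].
  by rewrite -(nth_index 0 wL) E nth_index.
rewrite -(@fsbig_widen _ _ _ _ [set` T]); last 2 first.
- move=> w /= /TP[/kappa_L[d1 _] /kappa_L[d2 _] /eqP w12]; split => //.
- move=> w /= [[d1 d2 w12] nT]; have [k1|_] := boolP (kappa w.1); last by rewrite !mul0r.
  have [k2|_] := boolP (kappa w.2); last by rewrite mulr0 mul0r.
  exfalso; apply: nT; apply/TP; split; rewrite ?mem_L; [exact/mem_set|exact/mem_set|exact/eqP].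
rewrite fsbig_finite//= (perm_big T)/=; last first.
  apply: uniq_perm => //; first exact: finmap.fset_uniq.
  move=> w; rewrite in_fset_set; last exact: finite_seq.
  by apply/idP/idP => [/set_mem|wT]; [|exact: mem_set].
rewrite big_map big_filter; apply: eq_bigr => -[i j] _ /=.
by rewrite !l_kappa !mul1r.
Qed.

Lemma sum_pair_cst (c : R) : \sum_(p : 'I_n * 'I_n | p.1 != p.2) c = c * (n%:R ^+ 2 - n%:R).
Proof.
have -> : \sum_(p : 'I_n * 'I_n | p.1 != p.2) c =
    \sum_(p : 'I_n * 'I_n) c - \sum_(p : 'I_n * 'I_n | p.1 == p.2) c.
  by rewrite [in RHS](bigID (fun p : 'I_n * 'I_n => p.1 == p.2))/= addrAC subrr add0r.
have -> : \sum_(p : 'I_n * 'I_n | p.1 == p.2) c = \sum_(i : 'I_n) c.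
  transitivity (\sum_(i : 'I_n) \sum_(j | i == j) c); first by rewrite pair_big_dep.
  by apply: eq_bigr => i _; under eq_bigl do rewrite eq_sym; rewrite big_pred1_eq.
rewrite !sumr_const card_prod !card_ord -(mulr_natr c (n * n)) -(mulr_natr c n) natrM; ring.
Qed.

(** [1 / b] is [2 / (d - s)], and [(pi^2 |q|^2)^(- b)] contributes [pi^(s - d)], which joins the
    [pi^(d / 2)] of [riesz_cst] to form [pi^(s - d / 2)]. *)
Lemma riesz_termE (q : 'cV[R]_d) :
  V q = 2 * pi `^ (d%:R / 2) / (Gamma (s / 2) * (d%:R - s) * covolume A) -
    pi `^ (s - d%:R / 2) * Gamma b / (Gamma (s / 2) * covolume A) *
    (norm2 q `^ (d%:R - s))^-1.
Proof.
rewrite /V /riesz_cst.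
have nq : 0 <= norm2 q by exact: sqrtr_ge0.
have -> : (pi ^+ 2 * norm2 q ^+ 2) `^ (- b) = pi `^ (s - d%:R) * (norm2 q `^ (d%:R - s))^-1.
  rewrite -exprMn -powR_mulrn ?mulr_ge0 ?pi_ge0// -powRrM.
  have -> : 2%:R * - b = - (d%:R - s) by field.
  rewrite powRM ?pi_ge0//; congr (_ * _); last by rewrite powRN.
  by congr (_ `^ _); ring.
have -> : s - d%:R / 2 = d%:R / 2 + (s - d%:R) by field.
rewrite [pi `^ (_ + (s - _))]powRD; last by rewrite (gt_eqF (pi_gt0 R)) implybT.
have -> : b^-1 = 2 * (d%:R - s)^-1 by rewrite invfM invrK mulrC.
rewrite !invfM; ring.
Qed.

End lattice_process.

Theorem theorem1 (R : realType) (d : nat) (hd : (0 < d)%N)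
    (A : 'M[R]_d) (uA : A \in unitmx)
    (kappa : 'cV[R]_d -> bool)
    (hkappa : finite_set [set w | dual_lattice A w /\ kappa w])
    (dO : measure_display) (O : measurableType dO) (P : probability O R)
    (X : {RV P >-> (kernel_rank A kappa).-tuple 'cV[R]_d})
    (hX : forall o i, fundamental_domain A (tnth (X o) i))
    (hdet : determinantal (torus_measure uA) (lattice_kernel A kappa) X)
    (s : R) (hs0 : 0 < s) (hsd : s < d%:R) :
  (\int[P]_o riesz_energy A s (X o) =
   (2 * pi `^ (d%:R / 2) / (Gamma (s / 2) * (d%:R - s) * covolume A) *
      ((kernel_rank A kappa)%:R ^+ 2 - (kernel_rank A kappa)%:R) -
    pi `^ (s - d%:R / 2) * Gamma ((d%:R - s) / 2) /
      (Gamma (s / 2) * covolume A) *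
      \sum_(p \in [set p : 'cV[R]_d * 'cV[R]_d |
          [/\ dual_lattice A p.1, dual_lattice A p.2 & p.1 <> p.2]])
        ((kappa p.1)%:R * (kappa p.2)%:R / norm2 (p.1 - p.2) `^ (d%:R - s)))%:E
  )%E.
Proof.
rewrite (integral_riesz_energy hkappa hdet)// fsum_off_diagonal//; congr EFin.
(* The first constant is spread over the [n^2 - n] ordered pairs, so that the identity becomes
   termwise. *)
rewrite mulr_sumr -sum_pair_cst -sumrB; apply: eq_bigr => p _; exact: riesz_termE.
Qed.
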